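(* Assume that the final set $\mathbf{X}_r=\{0\}$ is locally stable for $\dot{\mathbf{x}}=\mathbf{F}(\mathbf{x})$ with local domain of attraction $\mathcal{N}_\delta$ for a fixed $\delta>0$. Let $\gamma$ be a given real number bounding the collision probability. Suppose there exists a density function $\rho\in \mathcal{L}_1(\mathbf{X}_1)\cap \mathcal{C}^1(\mathbf{X}_1,\mathbb{R}_{\ge 0})$ satisfying $$\nabla\cdot(\mathbf{F}(\mathbf{x})\rho(\mathbf{x}))=h_0(\mathbf{x})\quad\text{for a.e. } \mathbf{x}\in\mathbf{X}_1,$$ $$\int_{\mathbf{X}_1}p(\mathbf{x})\rho(\mathbf{x})\,d\mathbf{x}\le\gamma .$$ (These conditions are convex in $\rho$.) Then the stochastic safety navigation requirement holds, that is: (i) for almost every (with respect to Lebesgue measure) initial condition $\mathbf{x}\in\mathbf{X}_0$, the trajectory $\mathbf{s}_t(\mathbf{x})$ converges asymptotically to $\mathbf{X}_r$ as $t\to\infty$; and (ii) the probability of collision with the unsafe set is at most $\gamma$: $$\int_0^\infty\int_{\mathbf{X}_1}p(\mathbf{s}_t(\mathbf{x}))\,d\mu_0(\mathbf{x})\,dt\le\gamma .$$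
   Context: Consider $\dot{\mathbf{x}}=\mathbf{F}(\mathbf{x})$ on $\mathbf{X}\subseteq\mathbb{R}^n$ with $\mathbf{F}\in\mathcal{C}^1(\mathbf{X},\mathbb{R}^n)$, and let $\mathbf{s}_t(\mathbf{x})$ denote its solution at time $t$ starting from $\mathbf{x}$. The point $0$ is an equilibrium point, and the final (terminal) set is $\mathbf{X}_r=\{0\}$. $\mathcal{N}_\delta$ is a neighborhood of $\mathbf{X}_r$ for a fixed $\delta>0$, and $\mathbf{X}_1:=\mathbf{X}\setminus\mathcal{N}_\delta$. $\mathbf{X}_0\subseteq\mathbf{X}$ is the initial set; $\mu_0$ is a probability measure supported on $\mathbf{X}_0$, with probability density function $h_0\in\mathcal{L}_1(\mathbf{X},\mathbb{R}_{\ge0})$, i.e. $d\mu_0(\mathbf{x})=h_0(\mathbf{x})\,d\mathbf{x}$. The unsafe set is described probabilistically by a probability density function $p$ on $\mathbf{X}$: for a Borel set $A\subseteq\mathbf{X}$, the probability that $A$ is unsafe is $\mu_p(A)=\int_A p(\mathbf{x})\,d\mathbf{x}$. $\mathcal{L}_1(\mathbf{Y})$ and $\mathcal{C}^k(\mathbf{Y},\mathbf{Z})$ denote, respectively, the real-valued integrable functions on $\mathbf{Y}$ and the $k$ times continuously differentiable functions from $\mathbf{Y}$ to $\mathbf{Z}$; $\nabla\cdot$ is the divergence. Stochastic safety navigation problem: navigate almost every (w.r.t. Lebesgue measure) trajectory of the system starting from $\mathbf{X}_0$ to $\mathbf{X}_r$ asymptotically while ensuring $\int_0^\infty\int_{\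mathbf{X}_1}p(\mathbf{s}_t(\mathbf{x}))\,d\mu_0(\mathbf{x})\,dt\le\gamma$.
   Formalization: Mended: (ii) as written is proved only if p has zero integral over N_δ; otherwise the collision integral counts only times when s_t(x) lies in X_1. Also, h_0>0 a.e. on X_0 is assumed (needed for (i)), and N_δ is taken to be forward invariant. *)

(* Defs.v *)
From HB Require Import structures.
From mathcomp Require Import all_boot all_order all_algebra.
From mathcomp Require Import all_classical all_reals all_analysis.
From mathcomp Require Import measurable_realfun.
Import Order.TTheory GRing.Theory Num.Theory.
Import numFieldNormedType.Exports.

Set Implicit Arguments.
Unset Strict Implicit.
Unset Printing Implicit Defensive.

Local Open Scope classical_set_scope.
Local Open Scope ring_scope.

(* R^n is given its Borel sigma-algebra. *)
HB.instance Definition rV_isMeasurable (R : realType) (n : nat) :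
  isMeasurable default_measure_display 'rV[R]_n :=
  @isMeasurable.Build _ (g_sigma_algebraType (@open 'rV[R]_n))
    (@open 'rV[R]_n).-sigma.-measurable
    measurable0 (@measurableC _ _) (@bigcupT_measurable _ _).

Section borel_rV.
Context (R : realType) (n : nat).

Lemma open_measurable_rV (U : set 'rV[R]_n) : open U -> measurable U.
Proof. exact: sub_sigma_algebra. Qed.

Lemma continuous_measurable_rV d (T : measurableType d) (f : T -> 'rV[R]_n) :
  (forall U, open U -> measurable (f @^-1` U)) -> measurable_fun setT f.
Proof.
move=> fU; apply: (@measurability _ _ _ _ setT f (@open 'rV[R]_n)) => //.
by move=> _ [U oU <-]; rewrite setTI; exact: fU.
Qed.

Lemma measurable_coord_rV (j : 'I_n) :
  measurable_fun setT ((fun v => v 0 j) : 'rV[R]_n -> measurableTypeR R).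
Proof.
apply: (measurability _ (RGenOpens.measurableE R)) => //.
move=> _ [_ [a [b ->] <-]]; rewrite setTI.
apply: open_measurable_rV; apply: open_comp; last exact: interval_open.
by move=> v _; exact: coord_continuous.
Qed.

Lemma measurable_fun_rV d (T : measurableType d) (f : T -> 'rV[R]_n) :
  (forall j, measurable_fun setT ((fun x => f x 0 j) : T -> measurableTypeR R)) ->
  measurable_fun setT f.
Proof.
move=> mf; apply: continuous_measurable_rV => U oU.
pose q (a : 'rV[rat]_n) : 'rV[R]_n := map_mx ratr a.
pose B (ak : 'rV[rat]_n * nat) := ball (q ak.1) (ak.2.+1%:R^-1 : R).
pose D := [set ak | B ak `<=` U].
have UE : U = \bigcup_(ak in D) B ak.
  apply/seteqP; split => [x Ux|x [ak] /[apply]//].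
  move: oU; rewrite openE => /(_ _ Ux)/nbhs_ballP[e /= e0 eU].
  have [k ke] : exists k : nat, k.+1%:R^-1 < e / 2.
    exists (Num.truncn (e / 2)^-1); rewrite invf_plt ?posrE ?divr_gt0//.
    by rewrite truncnS_gt.
  have k0 : 0 < k.+1%:R^-1 :> R by rewrite invr_gt0.
  have [a ax] : exists a : 'rV[rat]_n, ball (q a) k.+1%:R^-1 x.
    have H j : exists r : rat, ball (x 0 j) (k.+1%:R^-1) (ratr r : R).
      have [y [xy [r _ ry]]] := @dense_rat R (ball (x 0 j) k.+1%:R^-1)
        (ex_intro _ (x 0 j) (ballxx _ k0)) (ball_open _ _).
      by exists r; rewrite ry.
    have [g gP] := choice H.
    exists (\row_j g j); split => // i j; rewrite !mxE ord1.
    exact/ball_sym/gP.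
  exists (a, k) => // y axy; apply: eU.
  rewrite (splitr e); apply: (@ball_triangle _ _ (q a)).
    by apply: ball_sym; apply: le_ball ax; exact: ltW.
  by apply: le_ball axy; exact: ltW.
rewrite UE preimage_bigcup bigcup_mkcond.
apply: countable_bigcupT_measurable => // -[a k]; case: ifP => // _.
have -> : f @^-1` B (a, k) = \bigcap_(j in [set: 'I_n])
    ((fun x => f x 0 j) @^-1` ball (ratr (a 0 j) : R) k.+1%:R^-1).
  apply/seteqP; split => [x [_ H] j _|x H].
    by move: (H 0 j); rewrite mxE.
  by split => [|i j]; rewrite ?invr_gt0// mxE ord1; exact: H.
apply: fin_bigcap_measurable; first exact: finite_finset.
move=> j _; rewrite -[X in measurable X]setTI; apply: mf => //.
exact: measurable_ball.
Qed.

End borel_rV.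

Section lebesgue_rV.
Context (R : realType).

Definition rV_cons n (xv : measurableTypeR R * 'rV[R]_n) : 'rV[R]_n.+1 :=
  row_mx (xv.1)%:M xv.2.

Definition rV_uncons n (w : 'rV[R]_n.+1) : measurableTypeR R * 'rV[R]_n :=
  (w 0 0, @rsubmx R 1 1 n w).

Lemma rV_consK n : cancel (@rV_cons n) (@rV_uncons n).
Proof.
move=> [x v]; congr pair; last exact: row_mxKr.
have -> : 0 = @lshift 1 n 0 :> 'I_n.+1 by exact/val_inj.
by rewrite (@row_mxEl R 1 1 n) mxE eqxx mulr1n.
Qed.

Lemma measurable_rV_cons n : measurable_fun setT (@rV_cons n).
Proof.
apply: measurable_fun_rV => j; case: (@split_ordP 1 n j) => i ->.
- have -> : (fun x => @rV_cons n x 0 (@lshift 1 n i)) = fst.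
    by apply/funext => x; rewrite (@row_mxEl R 1 1 n) ord1 mxE eqxx mulr1n.
  exact: measurable_fst.
- have -> : (fun x => @rV_cons n x 0 (@rshift 1 n i)) = (fun v : 'rV[R]_n => v 0 i) \o snd.
    by apply/funext => x; rewrite (@row_mxEr R 1 1 n).
  apply: measurableT_comp; first exact: measurable_coord_rV.
  exact: measurable_snd.
Qed.

Lemma measurable_rV_uncons n : measurable_fun setT (@rV_uncons n).
Proof.
apply/measurable_fun_pairP; split; first exact: measurable_coord_rV.
apply: measurable_fun_rV => j.
have -> : (fun w => (snd \o @rV_uncons n) w 0 j) =
          (fun w : 'rV[R]_n.+1 => w 0 (@rshift 1 n j)).
  by apply/funext => w /=; rewrite mxE.
exact: measurable_coord_rV.
Qed.

Section cons_measure.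
Context (n : nat) (m : {sigma_finite_measure set 'rV[R]_n -> \bar R}).
Local Open Scope ereal_scope.

Definition cons_measure : set 'rV[R]_n.+1 -> \bar R :=
  pushforward (@lebesgue_measure R \x m) (@rV_cons n).

HB.instance Definition _ := Measure.copy cons_measure
  (measure_function_pushforward__canonical__measure_function_Measure
    (@lebesgue_measure R \x m) (@measurable_rV_cons n)).

Let cons_measure_sigma_finite : sigma_finite setT cons_measure.
Proof.
have /sigma_finiteP[F [FT ndF Foo]] := sigma_finiteT (@lebesgue_measure R).
have /sigma_finiteP[G [GT ndG Goo]] := sigma_finiteT m.
exists (fun k => @rV_uncons n @^-1` (F k `*` G k)).
  apply/seteqP; split => // w _.
  have [k _ Fk] : (\bigcup_k F k) (w ord0 ord0) by rewrite -FT.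
  have [l _ Gl] : (\bigcup_l G l) (@rsubmx R 1 1 n w) by rewrite -GT.
  exists (maxn k l) => //; split.
  - by move: Fk; exact/subsetPset/ndF/leq_maxl.
  - by move: Gl; exact/subsetPset/ndG/leq_maxr.
move=> k; have [mF Fk] := Foo k; have [mG Gk] := Goo k; split.
  rewrite -[X in measurable X]setTI; apply: measurable_rV_uncons => //.
  exact: measurableX.
rewrite /= /cons_measure /pushforward -comp_preimage.
rewrite [X in X @^-1` _](_ : _ = id); last first.
  by apply/funext => x /=; rewrite rV_consK.
by rewrite product_measure1E// lte_mul_pinfty// ge0_fin_numE.
Qed.

HB.instance Definition _ := Measure_isSigmaFinite.Build _ _ _ cons_measure
  cons_measure_sigma_finite.

End cons_measure.

(* n-fold product of the Lebesgue measure of the line; R^0 is a point, of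
   mass 1. *)
Fixpoint lebesgue_rV n : {sigma_finite_measure set 'rV[R]_n -> \bar R} :=
  if n is n'.+1 then cons_measure (lebesgue_rV n') else \d_(0 : 'rV[R]_0).

End lebesgue_rV.

Lemma lebesgue_rV_box (R : realType) n (A : 'I_n -> set (measurableTypeR R)) :
  (forall j, measurable (A j)) ->
  (lebesgue_rV R n [set v | forall j, A j (v ord0 j)] =
   \prod_(j < n) lebesgue_measure (A j))%E.
Proof.
elim: n A => [|n IHn] A mA.
  by rewrite big_ord0 /= diracE mem_set// => -[].
rewrite big_ord_recl -IHn//= /cons_measure /pushforward -product_measure1E//.
  congr (product_measure1 _ _ _); apply/seteqP; split => [[x v] /= H|[x v] /=].
    split => [|j].
      move: (H ord0); have -> : ord0 = @lshift 1 n ord0 by exact/val_inj.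
      by rewrite (@row_mxEl R 1 1 n) mxE eqxx mulr1n.
    move: (H (lift ord0 j)); rewrite -(@rshift1 n j).
    by rewrite (@row_mxEr R 1 1 n).
  move=> [H1 H2] j; case: (@split_ordP 1 n j) => i ->.
    rewrite (@row_mxEl R 1 1 n) ord1 mxE eqxx mulr1n.
    by have -> : @lshift 1 n 0 = ord0 by exact/val_inj.
  by rewrite (@row_mxEr R 1 1 n) rshift1; exact: H2.
rewrite [X in measurable X](_ : _ = \bigcap_(j in [set: 'I_n])
    ((fun v : 'rV[R]_n => v ord0 j) @^-1` A (lift ord0 j))).
  apply: fin_bigcap_measurable => [|j _]; first exact: finite_finset.
  by rewrite -[X in measurable X]setTI; exact: measurable_coord_rV.
by apply/seteqP; split => v H j; [move=> _|]; exact: H.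
Qed.

Section safety.
Context (R : realType) (n : nat).
Implicit Types (X Y N : set 'rV[R]_n) (F : 'rV[R]_n -> 'rV[R]_n).
Implicit Types (s : R -> 'rV[R]_n -> 'rV[R]_n) (f h p rho : 'rV[R]_n -> R).

(* Continuous differentiability on a set that need not be open is that of an
   extension to a neighbourhood; as f is a total function, f itself plays the
   part of the extension, and its values far from Y are irrelevant. *)
Definition C1_on (V : normedModType R) Y (f : 'rV[R]_n -> V) : Prop :=
  exists U : set 'rV[R]_n,
    [/\ open U, Y `<=` U,
        forall x, U x -> differentiable f x &
        forall v x, U x -> {for x, continuous ('D_v f)}].

Definition divergence (G : 'rV[R]_n -> 'rV[R]_n) (x : 'rV[R]_n) : R :=
  \sum_(j < n) 'D_(delta_mx 0 j) (fun y => G y 0 j) x.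

(* s t x is the solution of x' = F(x) at time t >= 0 issued from x; the state
   space X is forward invariant and solutions are global in forward time. The
   values of s at t < 0 or outside X are irrelevant. *)
Definition solution_map X F s : Prop :=
  forall x, X x ->
    [/\ s 0 x = x,
        forall t, 0 <= t -> X (s t x),
        {within `[0, +oo[, continuous (s^~ x)} &
        forall t : R, 0 < t -> is_derive t 1 (s^~ x) (F (s t x))].

(* Lyapunov stability of 0 in X, together with a set N of initial conditions
   that the dynamics does not leave and from which it converges to 0. *)
Definition locally_stable X s N : Prop :=
  [/\ forall e : R, 0 < e -> exists2 d : R, 0 < d &
        forall x, X x -> `|x| < d -> forall t, 0 <= t -> `|s t x| < e,
      forall x, X x -> N x -> forall t, 0 <= t -> N (s t x) &
      forall x, X x -> N x -> s t x @[t --> +oo] --> (0 : 'rV[R]_n)].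

Definition prob_density X f : Prop :=
  [/\ measurable_fun X f, forall x, X x -> 0 <= f x &
      (\int[lebesgue_rV R n]_(x in X) (f x)%:E = 1)%E].

Definition has_density (mu : probability 'rV[R]_n R) X f : Prop :=
  prob_density X f /\
  forall A, measurable A ->
    mu A = (\int[lebesgue_rV R n]_(x in X `&` A) (f x)%:E)%E.

(* X0 is, up to Lebesgue-null sets, the set where the density h is positive:
   h carries no mass outside X0 and charges every non-null part of X0. *)
Definition supported_on X h (X0 : set 'rV[R]_n) : Prop :=
  {ae lebesgue_rV R n, forall x, X x -> (X0 x <-> 0 < h x)}.

Definition navigation_density X1 F h p (gamma : R) rho : Prop :=
  [/\ (lebesgue_rV R n).-integrable X1 (EFin \o rho),
      C1_on X1 rho /\ (forall x, X1 x -> 0 <= rho x),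
      {ae lebesgue_rV R n, forall x, X1 x ->
        divergence (fun y => rho y *: F y) x = h x} &
      (\int[lebesgue_rV R n]_(x in X1) (p x * rho x)%:E <= gamma%:E)%E].

End safety.

(* Main.v *)
(* For f >= 0 and a compact set K put P_t f x = f (s t x) if the trajectory of x
   stays in K during [0, t], and P_t f x = 0 otherwise. On small cubes s h agrees
   up to o(h) with a near-identity affine map, a product of shears and a diagonal
   matrix up to O(h^2), so that the integral of P_h f is at most that of
   (1 - h div F + o(h)) f over K. With the continuity equation this gives, for
   f supported in X1 = X \ N and small eta > 0, the one-step inequality
     int (rho + eta) P_h f + h int h0 f <= int (rho + eta (1 + C h)) f,
   where eta absorbs the o(h) errors at points where rho is small. Iterating it,
   then letting eta and h tend to 0 and K exhaust the common domain of F and rho,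
   bounds the occupation measure:
     int_0^oo int_X1 f (s t x) h0 x dx dt <= int_X1 f rho.
   For f = p this is the collision bound. For f = 1 the total time spent outside
   N is integrable against h0, so almost every trajectory starting where h0 > 0
   enters N, from which it converges to 0. *)
Require Import Defs.
From HB Require Import structures.
From mathcomp Require Import all_boot all_order all_algebra.
From mathcomp Require Import all_classical all_reals all_analysis.
From mathcomp Require Import measurable_realfun ring lra.
Import Order.TTheory GRing.Theory Num.Theory.
Import numFieldNormedType.Exports.

Set Implicit Arguments.
Unset Strict Implicit.
Unset Printing Implicit Defensive.

Local Open Scope classical_set_scope.
Local Open Scope ring_scope.

(** Only an upper bound on the occupation measure is needed, so no change of variables for the flow
    is proved. The flow is never differentiated in its initial point; it is known only forward in
    time, on a set X that is merely measurable. Instead, gaps between nearby trajectories are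
    compared with the linear map [1 + h J], and the set of points whose endpoints lie in a cube is
    enclosed, after two shears, in a slightly enlarged box. Compactness of K makes all errors
    uniform, and killing at the exit from K preserves the semigroup law that the iteration needs.
    The constant C of the one-step inequality depends on K, F and rho but not on eta: over a time T
    the parameter eta grows at most by the factor exp(C (T + 1)), so it can be started small enough
    to stay small. The limit in K loses nothing because N is forward invariant: a trajectory outside
    N at time t was outside N before, so its past is a compact curve in the common domain of F and
    rho. *)

(** * Measures dominated by a density, and translation invariance *)

Section density_comparison.
Context d (T : measurableType d) (R : realType).
Variables (m1 m2 : {measure set T -> \bar R}) (w : T -> \bar R).
Hypothesis mw : measurable_fun setT w.
Hypothesis w0 : forall x, (0 <= w x)%E.
Hypothesis m12 : forall A, measurable A -> (m1 A <= \int[m2]_(x in A) w x)%E.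
Local Open Scope ereal_scope.
Import HBNNSimple.

(** The left integral is a supremum over simple functions below [f]; for each of these the bound on
    sets is applied level set by level set, with [w] kept inside the integral. *)
Lemma integral_le_density (f : T -> \bar R) : measurable_fun setT f ->
  (forall x, 0 <= f x) -> \int[m1]_x f x <= \int[m2]_x (f x * w x).
Proof.
move=> mf f0; rewrite ge0_integralTE//; apply: ge_ereal_sup => _ [h hf <-].
rewrite sintegralE.
have -> : \int[m2]_x (f x * w x) = \int[m2]_x (w x * f x).
  by apply: eq_integral => x _; rewrite muleC.
apply: (@le_trans _ _ (\int[m2]_x (w x * (h x)%:E))); last first.
  apply: ge0_le_integral => //.
  - by move=> x _; rewrite mule_ge0// lee_fin.
  - by apply: emeasurable_funM => //; exact/measurable_EFinP.
  - exact: emeasurable_funM.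
  - by move=> x _; apply: lee_pmul => //; rewrite lee_fin.
have -> : \int[m2]_x (w x * (h x)%:E) = \int[m2]_x
    (\sum_(r \in range h) w x * (r * \1_(h @^-1` [set r]) x)%:E).
  apply: eq_integral => x _; rewrite fimfunE -fsumEFin// ge0_mule_fsumr// => r.
  by rewrite EFinM nnfun_muleindic_ge0.
rewrite ge0_integral_fsum//; last 2 first.
  - move=> r; apply: emeasurable_funM => //; exact/measurable_EFinP/measurableT_comp.
  - by move=> r x _; rewrite mule_ge0//; exact: nnfun_muleindic_ge0.
apply: lee_fsum => // r [x _ <-].
under [leRHS]eq_integral do rewrite EFinM muleCA.
rewrite ge0_integralZl//; last 3 first.
- by apply: emeasurable_funM => //; exact/measurable_EFinP.
- by move=> y _; rewrite mule_ge0// lee_fin.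
- by rewrite lee_fin.
rewrite lee_wpmul2l ?lee_fin//.
have -> : \int[m2]_y (w y * (\1_(h @^-1` [set h x]) y)%:E) =
          \int[m2]_(y in h @^-1` [set h x]) w y.
  by rewrite [RHS]integral_mkcond/=; apply: eq_integral => y _;
    rewrite patchE indicE; case: ifP; rewrite ?mule1 ?mule0.
exact: m12.
Qed.

End density_comparison.

Section lebesgue_translation.
Context (R : realType).
Local Notation mu := (@lebesgue_measure R).

Let addr_mfun (a : R) : measurable_fun setT ((fun x => x + a) : measurableTypeR R -> measurableTypeR R).
Proof. by apply: measurable_funD => //; exact: measurable_cst. Qed.

Lemma lebesgue_measure_addr (a : R) (A : set (measurableTypeR R)) :
  measurable A -> mu ((fun x => x + a) @^-1` A) = mu A.
Proof.
move=> mA.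
pose mm : {measure set (measurableTypeR R) -> \bar R} := measure_function_pushforward__canonical__measure_function_Measure mu (addr_mfun a).
apply/esym; apply: (@lebesgue_measure_unique R mm) => // X [[x y] _ <-] /=.
rewrite /pushforward.
have -> : ((fun x0 => x0 + a) @^-1` `]x, y]) = `](x - a), (y - a)]%classic.
  by apply/seteqP; split => z/=; rewrite !in_itv/= ltrBlDr lerBrDr.
rewrite !lebesgue_measure_itv/= !lte_fin ltrD2r; case: ifP => // _.
by rewrite -!EFinD; congr EFin; ring.
Qed.

Lemma integral_addr (a : R) (f : R -> \bar R) :
  measurable_fun setT f -> (forall x, 0 <= f x)%E ->
  (\int[mu]_x f (x + a)%R = \int[mu]_x f x)%E.
Proof.
move=> mf f0.
pose mm : {measure set (measurableTypeR R) -> \bar R} := measure_function_pushforward__canonical__measure_function_Measure mu (addr_mfun a).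
transitivity (\int[mm]_x f x)%E.
  by rewrite (ge0_integral_pushforward (addr_mfun a)).
by apply: eq_measure_integral => A mA _; exact: lebesgue_measure_addr.
Qed.

End lebesgue_translation.

(** * Volume under shears and near-identity linear maps *)

Section volume_preserving.
Context (R : realType).
Local Notation lam := (lebesgue_rV R).

Definition preserves_volume n (phi : 'rV[R]_n -> 'rV[R]_n) :=
  measurable_fun setT phi /\
  forall A, measurable A -> lam n (phi @^-1` A) = lam n A.

Lemma preserves_volume_comp n (phi psi : 'rV[R]_n -> 'rV[R]_n) :
  preserves_volume phi -> preserves_volume psi -> preserves_volume (psi \o phi).
Proof.
move=> [mphi phiE] [mpsi psiE]; split; first exact: measurableT_comp.
move=> A mA; rewrite comp_preimage phiE ?psiE//.
by rewrite -[X in measurable X]setTI; exact: mpsi.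
Qed.

Lemma measurable_mulmxr n m (M : 'M[R]_(n, m)) :
  measurable_fun setT (fun w : 'rV[R]_n => w *m M).
Proof.
apply: measurable_fun_rV => j.
under eq_fun do rewrite mxE.
apply: measurable_sum => k; apply: measurable_funM => //.
exact: measurable_coord_rV.
Qed.

Lemma measurable_addrV d (T : measurableType d) n (f g : T -> 'rV[R]_n) :
  measurable_fun setT f -> measurable_fun setT g ->
  measurable_fun setT (fun x => f x + g x).
Proof.
move=> mf mg; apply: measurable_fun_rV => j.
under eq_fun do rewrite mxE.
by apply: measurable_funD; apply: (measurableT_comp (measurable_coord_rV j)).
Qed.

Lemma rV_unconsK n : cancel (@rV_uncons R n) (@rV_cons R n).
Proof.
move=> w; rewrite /rV_cons /rV_uncons/=.
have -> : (w 0 0)%:M = @lsubmx R 1 1 n w.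
  apply/matrixP => i j; rewrite !ord1 !mxE eqxx mulr1n; congr (w _ _).
  exact/val_inj.
exact: (@hsubmxK R 1 1 n w).
Qed.

(** [product_measure1] integrates the measures of sections at a fixed first coordinate; a shear that
    moves the first coordinate needs the other order. *)
Lemma product_measure12E d1 d2 (T1 : measurableType d1) (T2 : measurableType d2)
    (m1 : {sigma_finite_measure set T1 -> \bar R})
    (m2 : {sigma_finite_measure set T2 -> \bar R}) (A : set (T1 * T2)) :
  measurable A -> ((m1 \x m2) A = (m1 \x^ m2) A)%E.
Proof. by apply: product_measure_unique => B C mB mC; exact: product_measure2E. Qed.

Lemma preserves_volume_cons n (Phi : measurableTypeR R * 'rV[R]_n -> measurableTypeR R * 'rV[R]_n)
    (phi : 'rV[R]_n.+1 -> 'rV[R]_n.+1) :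
  measurable_fun setT phi ->
  (forall z, phi (rV_cons z) = rV_cons (Phi z)) ->
  (forall A, measurable A ->
    (@lebesgue_measure R \x lam n)%E (Phi @^-1` A) = (@lebesgue_measure R \x lam n)%E A) ->
  preserves_volume phi.
Proof.
move=> mphi phiE PhiE; split => // A mA.
rewrite /= /cons_measure /pushforward -[RHS]PhiE.
  by congr (product_measure1 _ _ _); apply/seteqP; split => z /=; rewrite phiE.
by rewrite -[X in measurable X]setTI; exact: measurable_rV_cons.
Qed.

Lemma product_volume_fiberr n (phi : R -> 'rV[R]_n -> 'rV[R]_n) A :
  (forall x, preserves_volume (phi x)) -> measurable A ->
  (@lebesgue_measure R \x lam n)%E ((fun z => (z.1, phi z.1 z.2)) @^-1` A) =
  (@lebesgue_measure R \x lam n)%E A.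
Proof.
move=> phiE mA; rewrite /product_measure1; apply: eq_integral => x _ /=.
rewrite -[RHS](phiE x).2; last exact: measurable_xsection.
by congr (lam n _); apply/seteqP; split => v; rewrite /xsection/= !inE/= inE.
Qed.

Lemma product_volume_fiberl n (c : 'rV[R]_n -> R) (A : set (measurableTypeR R * 'rV[R]_n)) :
  measurable_fun setT (c : 'rV[R]_n -> measurableTypeR R) -> measurable A ->
  (@lebesgue_measure R \x lam n)%E ((fun z => (z.1 + c z.2, z.2)) @^-1` A) =
  (@lebesgue_measure R \x lam n)%E A.
Proof.
move=> mc mA.
have mP : measurable ((fun z : measurableTypeR R * 'rV[R]_n => (z.1 + c z.2, z.2) : measurableTypeR R * 'rV[R]_n) @^-1` A).
  rewrite -[X in measurable X]setTI; apply: measurable_fun_pair => //.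
  apply: measurable_funD => //.
  exact: measurableT_comp.
rewrite !product_measure12E// /product_measure2.
apply: eq_integral => v _ /=.
rewrite -[RHS](lebesgue_measure_addr (c v)); last exact: measurable_ysection.
by congr (lebesgue_measure _); apply/seteqP; split => x; rewrite /ysection/= !inE/= inE.
Qed.

Lemma preserves_volume0 (phi : 'rV[R]_0 -> 'rV[R]_0) : preserves_volume phi.
Proof.
have -> : phi = id by apply/funext => v; apply/rowP => -[].
by split => //; exact: measurable_id.
Qed.

Lemma rV_consD n x y (v u : 'rV[R]_n) :
  rV_cons (x, v) + rV_cons (y, u) = rV_cons (x + y, v + u).
Proof. by rewrite /rV_cons/= (@add_row_mx R 1 1 n) -raddfD. Qed.

Lemma preserves_volume_addr n (u : 'rV[R]_n) : preserves_volume (fun w => w + u).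
Proof.
elim: n u => [u|n IHn u]; first exact: preserves_volume0.
rewrite -(rV_unconsK u); case: (rV_uncons u) => y {}u.
apply: (@preserves_volume_cons _ (fun z => (z.1 + y, z.2 + u))).
- by apply: measurable_addrV => //; exact: measurable_cst.
- by move=> [x v]; rewrite rV_consD.
- move=> A mA; rewrite -[RHS](@product_volume_fiberl n (cst y))//.
  rewrite -[RHS](@product_volume_fiberr n (fun _ v => v + u))//.
  rewrite -[X in measurable X]setTI; apply: measurable_fun_pair => //.
  exact: measurable_funD.
Qed.

Lemma rV_cons_mulmx n x (v : 'rV[R]_n) (M : 'M[R]_(1 + n)) :
  rV_cons (x, v) *m M = rV_cons (x * M 0 0 + (v *m dlsubmx M) 0 0,
                                 x *: ursubmx M + v *m drsubmx M) :> 'rV[R]_n.+1.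
Proof.
rewrite -[in LHS](@submxK R 1 n 1 n M) /rV_cons/= (@mul_row_block R 1 1 n 1 n) !mul_scalar_mx.
apply: f_equal2 => //; apply/matrixP => i j; rewrite !ord1 !mxE eqxx mulr1n.
by congr (_ * M _ _ + _); exact/val_inj.
Qed.

(** Vectors are rows, so an upper unitriangular matrix leaves the first coordinate alone. At a fixed
    first coordinate the tail undergoes the smaller triangular map followed by a translation, and
    the induction goes through sections. *)
Lemma preserves_volume_upper n (M : 'M[R]_n) :
  (forall i j : 'I_n, (j < i)%N -> M i j = 0) -> (forall i, M i i = 1) ->
  preserves_volume (mulmxr M).
Proof.
elim: n M => [M _ _|n IHn M M0 M1]; first exact: preserves_volume0.
have D_vol : preserves_volume (mulmxr (@drsubmx R 1 n 1 n M)).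
  apply: IHn => [i j ji|i]; first by rewrite !mxE M0//= !rshift1 /= /bump !leq0n.
  by rewrite !mxE M1.
apply: (@preserves_volume_cons _
  (fun z => (z.1, z.2 *m @drsubmx R 1 n 1 n M + z.1 *: @ursubmx R 1 n 1 n M))).
- exact: measurable_mulmxr.
- move=> [x v] /=; rewrite rV_cons_mulmx M1 mulr1.
  have -> : @dlsubmx R 1 n 1 n M = 0.
    by apply/matrixP => i j; rewrite !mxE M0//= ord1.
  by rewrite mulmx0 [(0 : 'M[R]_1) 0 0]mxE addr0 [X in (_, X)]addrC.
- move=> A mA; apply: (@product_volume_fiberr n (fun x v => v *m _ + x *: _)) => // x.
  exact: (preserves_volume_comp D_vol (preserves_volume_addr _)).
Qed.

(** Here the first coordinate is translated by a function [c] of the tail, then the tail undergoes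
    the smaller triangular map: one slicing in each direction. *)
Lemma preserves_volume_lower n (M : 'M[R]_n) :
  (forall i j : 'I_n, (i < j)%N -> M i j = 0) -> (forall i, M i i = 1) ->
  preserves_volume (mulmxr M).
Proof.
elim: n M => [M _ _|n IHn M M0 M1]; first exact: preserves_volume0.
have D_vol : preserves_volume (mulmxr (@drsubmx R 1 n 1 n M)).
  apply: IHn => [i j ji|i]; first by rewrite !mxE M0//= !rshift1 /= /bump !leq0n.
  by rewrite !mxE M1.
pose c (v : 'rV[R]_n) := (v *m @dlsubmx R 1 n 1 n M) 0 0.
apply: (@preserves_volume_cons _ (fun z => (z.1 + c z.2, z.2 *m @drsubmx R 1 n 1 n M))).
- exact: measurable_mulmxr.
- move=> [x v] /=; rewrite rV_cons_mulmx M1 mulr1.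
  have -> : @ursubmx R 1 n 1 n M = 0.
    by apply/matrixP => i j; rewrite !mxE M0//= ord1.
  by rewrite scaler0 add0r.
- move=> A mA.
  rewrite -[RHS](@product_volume_fiberr n (fun _ => mulmxr (@drsubmx R 1 n 1 n M)))//.
  rewrite -[RHS](@product_volume_fiberl n c)//.
    apply: (measurableT_comp (measurable_coord_rV 0)); exact: measurable_mulmxr.
  rewrite -[X in measurable X]setTI; apply: measurable_fun_pair => //.
  exact: (measurableT_comp D_vol.1).
Qed.

End volume_preserving.

Section rV_norm.
Context (R : realType).

Lemma ler_norm_coord n (v : 'rV[R]_n) j : `|v 0 j| <= `|v|.
Proof.
rewrite [leRHS]/Num.norm /= mx_normrE; apply/bigmax_geP; right => /=.
by exists (0, j).
Qed.

Lemma subr_coord n (u v : 'rV[R]_n) j : (u - v) 0 j = u 0 j - v 0 j.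
Proof. by rewrite !mxE. Qed.

Lemma rV_norm_le n (v : 'rV[R]_n) (e : R) :
  0 <= e -> (forall j, `|v 0 j| <= e) -> `|v| <= e.
Proof.
move=> e0 ve; rewrite [leLHS]/Num.norm /= mx_normrE; apply/bigmax_leP; split => //.
by move=> [i j] _ /=; rewrite ord1.
Qed.

(** A crude bound for the operator norm relative to the sup norm on rows; only its finiteness
    matters. *)
Definition mx_sum_norm m n (M : 'M[R]_(m, n)) := \sum_i \sum_j `|M i j|.

Lemma mx_sum_norm_ge0 m n (M : 'M[R]_(m, n)) : 0 <= mx_sum_norm M.
Proof. by apply: sumr_ge0 => i _; exact: sumr_ge0. Qed.

Lemma norm_mulmx_le m n (w : 'rV[R]_m) (M : 'M[R]_(m, n)) :
  `|w *m M| <= `|w| * mx_sum_norm M.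
Proof.
apply: rV_norm_le => [|j]; first by rewrite mulr_ge0// mx_sum_norm_ge0.
rewrite mxE (le_trans (ler_norm_sum _ _ _))// /mx_sum_norm mulr_sumr.
apply: ler_sum => k _; rewrite normrM; apply: ler_pM => //; first exact: ler_norm_coord.
by rewrite (bigD1 j)//= lerDl sumr_ge0.
Qed.

End rV_norm.

Section near_identity.
Context (R : realType).

Lemma prod1Dh n (b : 'I_n -> R) : exists2 C, 0 <= C & forall h, 0 <= h <= 1 ->
  `|\prod_j (1 + h * b j) - 1 - h * \sum_j b j| <= C * h ^+ 2.
Proof.
elim: n b => [b|n IHn b].
  by exists 0 => // h _; rewrite !big_ord0 subrr mulr0 subr0 normr0 mul0r.
have [C C0 HC] := IHn (fun j => b (lift ord0 j)).
set t := \sum_j b (lift ord0 j) in HC.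
exists (C * (1 + `|b ord0|) + `|b ord0 * t|).
  by rewrite addr_ge0// mulr_ge0// addr_ge0.
move=> h h01; rewrite !big_ord_recl -/t; have := HC h h01.
set P := \prod_j _ => HP.
have -> : (1 + h * b ord0) * P - 1 - h * (b ord0 + t) =
  (1 + h * b ord0) * (P - 1 - h * t) + h ^+ 2 * (b ord0 * t) by ring.
rewrite [leRHS]mulrDl; apply: le_trans (ler_normD _ _) _; apply: lerD; last first.
  by rewrite normrM ger0_norm ?sqr_ge0// mulrC.
rewrite normrM mulrAC mulrC; apply: ler_pM => //.
case/andP: h01 => h0 h1; rewrite (le_trans (ler_normD _ _))// normr1 lerD2l.
by rewrite normrM ger0_norm// ler_piMl.
Qed.

(* The strict lower and upper parts and the diagonal of A give a factorization
   of 1 + hA into two shears and a diagonal matrix up to O(h^2). *)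
Definition mx_low n (A : 'M[R]_n) : 'M[R]_n := \matrix_(i, j) (if (j < i)%N then A i j else 0).
Definition mx_up n (A : 'M[R]_n) : 'M[R]_n := \matrix_(i, j) (if (i < j)%N then A i j else 0).
Definition mx_dia n (A : 'M[R]_n) : 'M[R]_n := \matrix_(i, j) (if i == j then A i j else 0).

Lemma mx_lowupdia n (A : 'M[R]_n) : mx_low A + mx_up A + mx_dia A = A.
Proof.
apply/matrixP => i j; rewrite !mxE -val_eqE.
by case: ltngtP => _; rewrite ?add0r ?addr0.
Qed.

Lemma shear_factorization n (A : 'M[R]_n) : exists2 C, 0 <= C &
  forall h, 0 <= h <= 1 -> forall w : 'rV[R]_n,
  `|w *m (1%:M + h *: mx_low A) *m (1%:M + h *: mx_up A) *m (1%:M + h *: mx_dia A)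
    - w *m (1%:M + h *: A)| <= C * h ^+ 2 * `|w|.
Proof.
set X := mx_low A; set Y := mx_up A; set Z := mx_dia A.
exists (mx_sum_norm (X *m Y + X *m Z + Y *m Z) + mx_sum_norm (X *m Y *m Z)).
  by rewrite addr_ge0// mx_sum_norm_ge0.
move=> h /andP[h0 h1] w.
rewrite -!mulmxA -mulmxBr.
have -> : (1%:M + h *: X) *m ((1%:M + h *: Y) *m (1%:M + h *: Z)) - (1%:M + h *: A)
   = h ^+ 2 *: (X *m Y + X *m Z + Y *m Z) + (h ^+ 2 * h) *: (X *m Y *m Z).
  rewrite -(mx_lowupdia A) -/X -/Y -/Z.
  rewrite !(mulmxDl, mulmxDr, mul1mx, mulmx1) -?scalemxAl -?scalemxAr -?scalemxAl.
  rewrite !scalerDr !scalerA -!expr2 !mulmxA.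
  apply/matrixP => i j; rewrite !mxE; ring.
rewrite mulmxDr -!scalemxAr; apply: le_trans (ler_normD _ _) _; rewrite !normrZ.
rewrite 2!mulrDl !ger0_norm ?mulr_ge0 ?exprn_ge0//; apply: lerD.
  rewrite [leRHS]mulrAC [leRHS]mulrC; apply: ler_wpM2l; first exact: sqr_ge0.
  by rewrite [leRHS]mulrC; exact: norm_mulmx_le.
apply: (@le_trans _ _ (h ^+ 2 * `|w *m (X *m Y *m Z)|)).
  by apply: ler_wpM2r => //; rewrite ler_piMr// sqr_ge0.
rewrite [leRHS]mulrAC [leRHS]mulrC; apply: ler_wpM2l; first exact: sqr_ge0.
by rewrite [leRHS]mulrC -(mulmxA X Y Z); exact: norm_mulmx_le.
Qed.

End near_identity.

Section near_identity_volume.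
Context (R : realType).
Local Notation lam := (lebesgue_rV R).

Lemma lebesgue_rV_closed_box n (a : 'I_n -> R) (l : 'I_n -> R) : (forall j, 0 <= l j) ->
  lam n [set v : 'rV[R]_n | forall j, a j <= v ord0 j <= a j + l j] = (\prod_j l j)%:E.
Proof.
move=> l0.
pose B j : set (measurableTypeR R) := `[a j, a j + l j]%classic.
transitivity (lam n [set v : 'rV[R]_n | forall j, B j (v ord0 j)]).
  apply: (congr1 (lam n)); apply/seteqP; split => v /= H j; move: (H j);
    by rewrite /B/= in_itv/=.
rewrite lebesgue_rV_box => [|j]; last exact: measurable_itv.
rewrite -prodEFin; apply: eq_bigr => j _; rewrite /B.
rewrite lebesgue_measure_itv/= lte_fin; case: ifPn => [_|].
  by rewrite -EFinD addrAC subrr add0r.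
by rewrite -leNgt gerDl => lj; congr EFin; apply/eqP; rewrite eq_le l0 lj.
Qed.

Lemma measurable_box n (B : 'I_n -> set (measurableTypeR R)) :
  (forall j, measurable (B j)) ->
  measurable [set v : 'rV[R]_n | forall j, B j (v ord0 j)].
Proof.
move=> mB; rewrite [X in measurable X](_ : _ = \bigcap_(j in [set: 'I_n])
    ((fun v : 'rV[R]_n => v ord0 j) @^-1` B j)).
  apply: fin_bigcap_measurable => [|j _]; first exact: finite_finset.
  by rewrite -[X in measurable X]setTI; exact: measurable_coord_rV.
by apply/seteqP; split => v H j; [move=> _|]; exact: H.
Qed.

(** The product is the volume ratio of the enclosing box below: each side is enlarged by the factor
    [1 + h * e1] and contracted by a diagonal entry of [1 + h A]. *)
Lemma near_identity_jacobian n (A : 'M[R]_n) (e : R) : 0 < e ->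
  exists e1 h1 : R, [/\ 0 < e1, 0 < h1, h1 <= 1,
    forall h j, 0 <= h <= h1 -> 0 < 1 + h * A j j &
    forall h, 0 <= h <= h1 ->
      \prod_(j < n) ((1 + h * e1) / (1 + h * A j j)) <= 1 - h * \tr A + e * h].
Proof.
(* The slack [e * h] is shared out: [e1 * n <= e / 4] pays for the numerators, and the last bound on
   [h] leaves at most [e / 2] for the terms of order h^2, whose coefficients [C3] collects. *)
move=> e0; pose e1 := e / (4 * (n%:R + 1)); pose t := \tr A.
have e10 : 0 < e1 by rewrite divr_gt0// mulr_gt0.
have [C1 C10 H1] := prod1Dh (fun _ : 'I_n => e1).
have [C2 C20 H2] := prod1Dh (fun j : 'I_n => A j j).
pose C3 := C1 + C2 + t ^+ 2 + e * `|t| + (`|t| + e) * C2.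
have e0' := ltW e0.
have C30 : 0 <= C3 by rewrite /C3 !(sqr_ge0, addr_ge0, mulr_ge0).
(* With [h <= 1 / (2 m)] both [|h A j j|] and [|h tr A|] are at most 1/2, so the denominators are
   positive and the claimed bound is nonnegative. *)
pose m := 1 + \sum_j `|A j j|.
have m0 : 0 < m by rewrite /m ltr_pwDl// sumr_ge0.
exists e1, (Num.min (Num.min 1 (2 * m)^-1) (e / (2 * (C3 + 1)))).
have C31 : 0 < C3 + 1 by rewrite ltr_wpDl.
have pos h j : 0 <= h <= Num.min (Num.min 1 (2 * m)^-1) (e / (2 * (C3 + 1))) ->
    0 < 1 + h * A j j.
  rewrite !le_min => /andP[h0 /andP[/andP[h1 hm] _]].
  have Am : `|A j j| <= m.
    by rewrite /m (bigD1 j)//= addrCA lerDl addr_ge0// sumr_ge0.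
  have : `|h * A j j| <= 2^-1.
    rewrite normrM ger0_norm// (le_trans (ler_pM h0 _ hm Am))//.
    by rewrite invfM mulfVK// gt_eqF.
  rewrite ler_norml => /andP[+ _]; lra.
split => //.
- by rewrite !lt_min ltr01 invr_gt0 mulr_gt0//= divr_gt0// mulr_gt0.
- by rewrite !ge_min lexx.
move=> h hh; have := hh; rewrite !le_min => /andP[h0 /andP[/andP[h1 hm] hC]].
rewrite big_split/= prodfV ler_pdivrMr; last by apply: prodr_gt0 => j _; exact: pos.
have h01 : 0 <= h <= 1 by rewrite h0.
have := H1 h h01; have := H2 h h01.
rewrite -/(\tr A) -/t sumr_const card_ord -mulr_natr.
set P1 := \prod_j (1 + h * e1); set P2 := \prod_j (1 + h * A j j).
rewrite !ler_norml => /andP[hP2 _] /andP[_ hP1].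
have ne1 : e1 * n%:R <= e / 4.
  have : e1 * (n%:R + 1) = e / 4 by rewrite /e1; field; rewrite gt_eqF.
  by rewrite mulrDr mulr1 => <-; rewrite lerDl ltW.
have hC3 : h * (C3 + 1) <= e / 2.
  by move: hC; rewrite invfM mulrA ler_pdivlMr.
have w0 : 0 <= 1 - h * t + e * h.
  have : `|h * t| <= 2^-1.
    rewrite normrM ger0_norm// (@le_trans _ _ ((2 * m)^-1 * m))//.
      apply: ler_pM => //; rewrite (le_trans (ler_norm_sum _ _ _))//.
      by rewrite /m lerDr.
    by rewrite invfM mulfVK// gt_eqF.
  have : 0 <= e * h by rewrite mulr_ge0// ltW.
  by rewrite ler_norml => ? /andP[_]; lra.
apply: (@le_trans _ _ ((1 - h * t + e * h) * (1 + h * t - C2 * h ^+ 2))); last first.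
  apply: ler_wpM2l => //; lra.
have : P1 <= 1 + h * (e / 4) + C1 * h ^+ 2.
  have := ler_wpM2l h0 ne1; lra.
move=> /le_trans; apply.
have hq : 0 <= h ^+ 2 by exact: sqr_ge0.
have E : h * (h * C3) <= h * (e / 2).
  by apply: ler_wpM2l => //; lra.
have Et : h ^+ 2 * (e * t) <= h ^+ 2 * (e * `|t|).
  by rewrite ler_wpM2l// ler_wpM2l ?ler_norm// ltW.
have Eh : h ^+ 2 * (h * ((t - e) * C2)) >= - (h ^+ 2 * ((`|t| + e) * C2)).
  rewrite -mulrN ler_wpM2l// lerNl -mulrN -mulNr opprB.
  rewrite (@le_trans _ _ (h * ((`|t| + e) * C2)))//.
    rewrite ler_wpM2l// ler_wpM2r// addrC lerD2r lerNl.
    by rewrite -[leRHS]opprK lerN2 -normrN ler_norm.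
  by rewrite ler_piMl// mulr_ge0// addr_ge0// ltW.
have -> : (1 - h * t + e * h) * (1 + h * t - C2 * h ^+ 2) = 
   1 + e * h + h ^+ 2 * (- C2 - t ^+ 2 + e * t) + h ^+ 2 * (h * ((t - e) * C2)) by ring.
rewrite /C3 in E.
have Et' : h ^+ 2 * (e * t) >= - (h ^+ 2 * (e * `|t|)).
  have T1 : - `|t| <= t by rewrite lerNl -normrN ler_norm.
  by have := ler_wpM2l hq (ler_wpM2l e0' T1); rewrite !mulrN.
have eh0 : 0 <= e * h := mulr_ge0 e0' h0.
clear - E Et Eh Et' eh0; lra.
Qed.

Lemma mulmx_dia n (w : 'rV[R]_n) (A : 'M[R]_n) h j :
  (w *m (1%:M + h *: mx_dia A)) 0 j = w 0 j * (1 + h * A j j).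
Proof.
rewrite mxE (bigD1 j)//= big1 ?addr0 => [|k kj]; first by rewrite !mxE eqxx.
by rewrite !mxE (negbTE kj) mulr0 addr0 mulr0.
Qed.

(** Nothing is assumed of [Y] but closeness of its differences to those of the linear map. The two
    shears preserve the volume of [S] and carry it into a box; the diagonal factor is accounted for
    in the sides of that box, so no inverse or Jacobian of [Y] appears. *)
Lemma volume_near_identity n (A : 'M[R]_n) (e : R) : 0 < e ->
  exists e1 h1 : R, [/\ 0 < e1, 0 < h1 &
    forall h, 0 < h <= h1 -> forall (S : set 'rV[R]_n) (Y : 'rV[R]_n -> 'rV[R]_n)
      (q : 'I_n -> R) (l : R), measurable S -> 0 < l ->
    (forall x, S x -> forall j, q j <= Y x 0 j <= q j + l) ->
    (forall x x', S x -> S x' ->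
      `|x - x'| <= 2 * l /\
      `|(x - x') *m (1%:M + h *: A) - (Y x - Y x')| <= e1 * h * l) ->
    (lam n S <= ((1 - h * \tr A + e * h) * l ^+ n)%:E)%E].
Proof.
move=> e0; have [e2 [h2 [e20 h20 h21 dpos hjac]]] := near_identity_jacobian A e0.
have [C C0 HC] := shear_factorization A.
have C1 : 0 < C + 1 by rewrite ltr_wpDl.
(* Two errors of size [e2 / 4 * h * l]: one from replacing [Y] by the linear map, one from the shear
   factorization, where differences of points of [S] have norm at most [2 * l] and
   [h * (C + 1) <= e2 / 8]. *)
exists (e2 / 4), (Num.min h2 (e2 / (8 * (C + 1)))); split.
- by rewrite divr_gt0.
- by rewrite lt_min h20 divr_gt0// mulr_gt0.
move=> h /andP[h0]; rewrite le_min => /andP[hh2 hC] S Y q l mS l0 SY SS.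
have hh : 0 <= h <= h2 by rewrite ltW.
have h01 : 0 <= h <= 1 by rewrite ltW//= (le_trans hh2).
have jac := hjac _ hh.
have J0 : 0 <= 1 - h * \tr A + e * h.
  apply: le_trans jac; apply: prodr_ge0 => j _.
  by rewrite divr_ge0 ?(ltW (dpos _ _ _))// addr_ge0// mulr_ge0 ?ltW.
have [->|/set0P[x0 Sx0]] := eqVneq S set0.
  by rewrite measure0 lee_fin mulr_ge0// exprn_ge0// ltW.
pose L : 'M[R]_n := 1%:M + h *: mx_low A; pose U : 'M[R]_n := 1%:M + h *: mx_up A.
pose D : 'M[R]_n := 1%:M + h *: mx_dia A.
have LU_vol : preserves_volume (mulmxr U \o mulmxr L).
  apply: preserves_volume_comp.
    apply: preserves_volume_lower => [i j ij|i]; rewrite !mxE.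
      by rewrite (ltnNge j) (ltnW ij)/= mulr0 addr0 -val_eqE ltn_eqF.
    by rewrite eqxx ltnn mulr0 addr0.
  apply: preserves_volume_upper => [i j ij|i]; rewrite !mxE.
    by rewrite (ltnNge i) (ltnW ij)/= mulr0 addr0 -val_eqE gtn_eqF.
  by rewrite eqxx ltnn mulr0 addr0.
pose dd j := 1 + h * A j j.
have dd0 j : 0 < dd j by exact: dpos.
(* The cube containing the values of [Y] is moved so as to match [Y x0] with the image of the
   reference point [x0], widened by [e2 * h * l / 2] on each side, and divided by the diagonal
   entries. *)
pose a j := ((x0 *m L *m U *m D) 0 j + q j - Y x0 0 j - e2 * h * l / 2) / dd j.
pose r j := l * ((1 + h * e2) / dd j).
have r0 j : 0 <= r j.
  rewrite /r mulr_ge0 ?(ltW l0)// divr_ge0 ?(ltW (dd0 j))//.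
  by rewrite addr_ge0// mulr_ge0 ?(ltW h0) ?(ltW e20).
pose B := [set v : 'rV[R]_n | forall j, a j <= v ord0 j <= a j + r j].
have mB : measurable B.
  pose Bj j : set (measurableTypeR R) := [set` `[a j, a j + r j]].
  have -> : B = [set v : 'rV[R]_n | forall j, Bj j (v ord0 j)].
    by apply/seteqP; split => v /= H j; move: (H j); rewrite /Bj/= in_itv.
  by apply: measurable_box => j; exact: measurable_itv.
have SB : S `<=` (mulmxr U \o mulmxr L) @^-1` B.
  move=> x Sx j /=; have [xx0 xx0Y] := SS _ _ Sx Sx0.
  have /andP[Y1 Y2] := SY _ Sx j.
  have := HC _ h01 (x - x0); rewrite -/L -/U -/D => H.
  have {}H : `|(x - x0) *m L *m U *m D - (Y x - Y x0)| <= e2 * h * l / 2.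
    rewrite -[X in `|X|](subrKA ((x - x0) *m (1%:M + h *: A))).
    apply: le_trans (ler_normD _ _) _.
    have -> : e2 * h * l / 2 = e2 / 4 * h * l + e2 / 4 * h * l by field.
    apply: lerD => //; apply: le_trans H _.
    have : C * h ^+ 2 * `|x - x0| <= C * h ^+ 2 * (2 * l).
      by rewrite ler_wpM2l// mulr_ge0// sqr_ge0.
    move=> /le_trans; apply.
    have -> : C * h ^+ 2 * (2 * l) = (h * C) * 2 * (h * l) by ring.
    have -> : e2 / 4 * h * l = (e2 / 8) * 2 * (h * l) by field.
    apply: ler_wpM2r; first exact: mulr_ge0 (ltW h0) (ltW l0).
    apply: ler_wpM2r => //; apply: (@le_trans _ _ (h * (C + 1))).
      by rewrite ler_wpM2l ?(ltW h0)// lerDl.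
    apply: le_trans (ler_wpM2r (ltW C1) hC) _.
    by rewrite le_eqVlt; apply/orP; left; apply/eqP; field; rewrite gt_eqF.
  have := ler_norm_coord ((x - x0) *m L *m U *m D - (Y x - Y x0)) j.
  move=> /le_trans /(_ H).
  have -> : ((x - x0) *m L *m U *m D - (Y x - Y x0)) 0 j =
      ((x *m L *m U) 0 j * dd j) - (x0 *m L *m U *m D) 0 j - (Y x 0 j - Y x0 0 j).
    by rewrite !mulmxBl !subr_coord mulmx_dia.
  rewrite ler_norml => /andP[HL HR].
  have -> : a j + r j = ((x0 *m L *m U *m D) 0 j + q j - Y x0 0 j - e2 * h * l / 2
      + l * (1 + h * e2)) / dd j by rewrite /a /r; field; rewrite gt_eqF.
  rewrite ler_pdivrMr// ler_pdivlMr//; apply/andP; split; lra.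
apply: (@le_trans _ _ (lam n ((mulmxr U \o mulmxr L) @^-1` B))).
  apply: le_measure => //; rewrite inE//.
  by rewrite -[X in measurable X]setTI; exact: LU_vol.1.
rewrite LU_vol.2// lebesgue_rV_closed_box// lee_fin big_split/=.
by rewrite prodr_const card_ord mulrC; apply: ler_wpM2r => //; rewrite exprn_ge0// ltW.
Qed.

End near_identity_volume.

(** * Covering a set by small cubes *)

Section regularity.
Context (R : realType) (n : nat).

(** The points at distance at least [e] from the complement, without an infimum; if the complement
    is empty this is the whole space. *)
Definition inner_set (O : set 'rV[R]_n) (e : R) :=
  [set x | forall y, ~ O y -> e <= `|x - y|].

Lemma closed_inner_set O e : closed (inner_set O e).
Proof.
have -> : inner_set O e = \bigcap_(y in ~` O) ((fun x => `|x - y|) @^-1` [set r | e <= r]).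
  by apply/seteqP; split => x H y; exact: H.
have cdist y : continuous (fun x : 'rV[R]_n => `|x - y|).
  move=> x; apply: (@cvg_norm _ _ _ (nbhs x)).
  by apply: (@cvgB _ _ _ (nbhs x)); [exact: cvg_id|exact: cvg_cst].
apply: closed_bigI => y _; apply: preimage_closed; last exact: closed_ge.
by move=> x _; exact: cdist.
Qed.

Lemma inner_set_sub O e : 0 < e -> inner_set O e `<=` O.
Proof.
by move=> e0 x Ox; apply: contrapT => /Ox; rewrite subrr normr0 leNgt e0.
Qed.

Lemma inner_set_le O (e e' : R) : e <= e' -> inner_set O e' `<=` inner_set O e.
Proof. by move=> ee' x Ox y /Ox; exact: le_trans. Qed.

Lemma bigcup_inner_set O : open O -> \bigcup_k inner_set O k.+1%:R^-1 = O.
Proof.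
move=> oO; apply/seteqP; split => [x [k _]|x Ox].
  by apply: inner_set_sub; rewrite invr_gt0.
move: oO; rewrite openE => /(_ _ Ox)/nbhs_ballP[e /= e0 eO].
exists (Num.truncn e^-1) => // y; apply: contra_notP => /negP; rewrite -ltNge => xy.
apply: eO; rewrite -ball_normE/=; apply: (lt_trans xy).
by rewrite invf_plt ?posrE// truncnS_gt.
Qed.

Lemma borel_measurable_closed (C : set 'rV[R]_n) : closed C -> measurable C.
Proof.
move=> cC; rewrite -(setCK C); apply: measurableC; apply: open_measurable_rV.
exact: closed_openC.
Qed.

Variable m : {measure set 'rV[R]_n -> \bar R}.
Hypothesis mT : (m setT < +oo)%E.
Local Open Scope ereal_scope.

Let mfin A : measurable A -> m A < +oo.
Proof. by move=> mA; apply: le_lt_trans mT; apply: le_measure; rewrite ?inE. Qed.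

Lemma nonincreasing_small (A : (set 'rV[R]_n)^nat) (e : R) : (0 < e)%R ->
  (forall k, measurable (A k)) ->
  {homo A : i j / (i <= j)%N >-> (j `<=` i)} ->
  \bigcap_k A k = set0 -> exists k, m (A k) < e%:E.
Proof.
move=> e0 mA ndA A0.
have := @nonincreasing_cvg_mu _ _ _ m A (mfin (mA 0%N)) mA.
rewrite A0 => /(_ measurable0); rewrite measure0.
have nA : nonincreasing_seq A by move=> i j ij; apply/subsetPset; exact: ndA.
move=> /(_ nA) /fine_cvgP[_ /cvgrPdist_lt /(_ _ e0)] [k _ /(_ k (leqnn k))] /=.
rewrite sub0r normrN ger0_norm ?fine_ge0// => mAk; exists k.
by rewrite -[X in X < _]fineK ?lte_fin// ge0_fin_numE// mfin.
Qed.

(** The closed sets are carried along with the open ones because complementation exchanges the two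
    approximations; this makes the class a sigma-algebra. *)
Let regular_set := [set A : set 'rV[R]_n | measurable A /\
  forall e : R, (0 < e)%R -> exists C O,
    [/\ closed C, open O, C `<=` A, A `<=` O & m (O `\` C) < e%:E]].

Let regular_open O : open O -> regular_set O.
Proof.
move=> oO; split; first exact: open_measurable_rV.
move=> e e0; pose A k := O `\` inner_set O k.+1%:R^-1.
have [k|i j ij||k Ak] := @nonincreasing_small A e e0.
- apply: measurableD; first exact: open_measurable_rV.
  by apply: borel_measurable_closed; exact: closed_inner_set.
- apply: setDS; apply: inner_set_le.
  by rewrite lef_pV2 ?posrE// ler_nat.
- apply/seteqP; split => // x Ax; have [Ox _] := Ax 0%N I.
  have [k _ xk] : (\bigcup_k inner_set O k.+1%:R^-1) x by rewrite bigcup_inner_set.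
  by have [_] := Ax k I.
exists (inner_set O k.+1%:R^-1), O; split => //; first exact: closed_inner_set.
exact: inner_set_sub.
Qed.

Let regularC A : regular_set A -> regular_set (~` A).
Proof.
move=> [mA rA]; split; first exact: measurableC.
move=> e /rA[C [ O [cC oO CA AO mOC]]]; exists (~` O), (~` C); split.
- exact: open_closedC.
- exact: closed_openC.
- exact: subsetC.
- exact: subsetC.
by rewrite setDE setCK setIC -setDE.
Qed.

Let regular_bigcup (A : (set 'rV[R]_n)^nat) :
  (forall k, regular_set (A k)) -> regular_set (\bigcup_k A k).
Proof.
move=> rA; have mA k : measurable (A k) by have [] := rA k.
split; first exact: bigcupT_measurable.
move=> e e0.
have ek k : (0 < e / 2 / (2 ^ k.+1)%:R)%R by rewrite !divr_gt0.
have [C HC] := choice (fun k => (rA k).2 _ (ek k)).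
have [ O HO] := choice HC.
(* The union of the closed sets need not be closed, so it is cut after [k] terms; [B k] is what is
   lost. Half of [e] goes to [B k], the other half to the sum of the individual errors. *)
pose B k := \bigcup_i C i `\` \big[setU/set0]_(i < k) C i.
have mC k : measurable (C k) by have [? _ _ _ _] := HO k; exact: borel_measurable_closed.
have mO k : measurable (O k) by have [_ ? _ _ _] := HO k; exact: open_measurable_rV.
have cCk k : closed (\big[setU/set0]_(i < k) C i).
  by apply: closed_bigsetU => i _; have [] := HO i.
have mCk k : measurable (\big[setU/set0]_(i < k) C i).
  exact: borel_measurable_closed.
have e20 : (0 < e / 2)%R by rewrite divr_gt0.
have [k|i j ij||k Bk] := @nonincreasing_small B _ e20.
- by apply: measurableD => //; exact: bigcupT_measurable.
- by apply: setDS; exact: subset_bigsetU.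
- apply/seteqP; split => // x Bx; have [[i _ Cix] _] := Bx 0%N I.
  have [_] := Bx i.+1 I; apply.
  by rewrite -bigcup_mkord; exists i => //=.
exists (\big[setU/set0]_(i < k) C i), (\bigcup_i O i); split => //.
- by apply: bigcup_open => i _; have [] := HO i.
- rewrite -bigcup_mkord => x [i /= _ Cix]; exists i => //.
  by have [_ _ H _ _] := HO i; exact: H.
- move=> x [i _ Aix]; exists i => //.
  by have [_ _ _ H _] := HO i; exact: H.
apply: (@le_lt_trans _ _ (m (\bigcup_i (O i `\` C i) `|` B k))).
  apply: le_measure; rewrite ?inE.
  - by apply: measurableD => //; exact: bigcupT_measurable.
  - apply: measurableU; last by apply: measurableD => //; exact: bigcupT_measurable.
    by apply: bigcupT_measurable => i; exact: measurableD.
  move=> x [[i _ Oix] Ckx]; have [[j _ Cjx]|nC] := pselect ((\bigcup_i C i) x).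
    by right; split => //; exists j.
  by left; exists i => //; split => // Cix; apply: nC; exists i.
apply: le_lt_trans (_ : _ <= m (\bigcup_i (O i `\` C i)) + m (B k)) _.
  apply: measureU2 => //; last by apply: measurableD => //; exact: bigcupT_measurable.
  by apply: bigcupT_measurable => i; exact: measurableD.
have -> : e%:E = (e / 2)%:E + (e / 2)%:E by rewrite -EFinD -splitr.
apply: lee_ltD => //.
  rewrite ge0_fin_numE//; apply: mfin; apply: bigcupT_measurable => i; exact: measurableD.
apply: le_trans (epsilon_trick0 xpredT (ltW e20)).
apply: (@le_trans _ _ (\sum_(i <oo) m (O i `\` C i))).
  apply: measure_sigma_subadditive => //.
  - by move=> i; exact: measurableD.
  - by apply: bigcupT_measurable => i; exact: measurableD.
apply: lee_nneseries => // i _; apply: ltW.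
by have [_ _ _ _] := HO i.
Qed.

Lemma outer_regularity (A : set 'rV[R]_n) (e : R) : measurable A -> (0 < e)%R ->
  exists O : set 'rV[R]_n, [/\ open O, A `<=` O & m (O `\` A) < e%:E].
Proof.
move=> mA e0.
have : regular_set A.
  move: A mA; apply: smallest_sub; last exact: regular_open.
  split.
  - by apply: regular_open; exact: open0.
  - by move=> A rA; rewrite setTD; exact: regularC.
  - exact: regular_bigcup.
move=> [_ /(_ _ e0)[C [ O [cC oO CA AO mOC]]]]; exists O; split => //.
apply: le_lt_trans mOC; apply: le_measure; rewrite ?inE.
- by apply: measurableD => //; exact: open_measurable_rV.
- apply: measurableD; [exact: open_measurable_rV|exact: borel_measurable_closed].
- exact: setDS.
Qed.

End regularity.

Section dyadic_comparison.
Context (R : realType) (n : nat).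

Definition half_open_box (q : 'rV[R]_n) (l : R) : set 'rV[R]_n :=
  [set x | forall j, q 0 j <= x 0 j < q 0 j + l].

Lemma measurable_half_open_box q l : measurable (half_open_box q l).
Proof.
pose B j : set (measurableTypeR R) := [set` `[q 0 j, q 0 j + l[].
have -> : half_open_box q l = [set v : 'rV[R]_n | forall j, B j (v ord0 j)].
  by apply/seteqP; split => v /= H j; move: (H j); rewrite /B/= in_itv.
by apply: measurable_box => j; exact: measurable_itv.
Qed.

Lemma lebesgue_rV_half_open_box q l : 0 <= l ->
  lebesgue_rV R n (half_open_box q l) = (l ^+ n)%:E.
Proof.
move=> l0; pose B j : set (measurableTypeR R) := [set` `[q 0 j, q 0 j + l[].
transitivity (lebesgue_rV R n [set v : 'rV[R]_n | forall j, B j (v ord0 j)]).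
  apply: (congr1 (lebesgue_rV R n)); apply/seteqP.
  by split => v /= H j; move: (H j); rewrite /B/= in_itv/=.
rewrite lebesgue_rV_box => [|j]; last exact: measurable_itv.
rewrite (eq_bigr (fun _ => l%:E)) => [|j _].
  by rewrite prodEFin prodr_const card_ord.
rewrite /B lebesgue_measure_itv/= lte_fin; case: ifPn => [_|].
  by rewrite -EFinD addrAC subrr add0r.
by rewrite -leNgt gerDl => lj; congr EFin; apply/eqP; rewrite eq_le l0 lj.
Qed.

Let floor_double (a b : R) : Num.floor (2 * a) = Num.floor (2 * b) ->
  Num.floor a = Num.floor b.
Proof.
have H (x y : R) : Num.floor (2 * x) = Num.floor (2 * y) -> Num.floor x <= Num.floor y.
  move=> xy; rewrite floor_ge_int -(@ler_pM2l _ 2)//.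
  apply: le_trans (floor_le (2 * y)); rewrite -xy.
  have -> : 2 * (Num.floor x)%:~R = (2 * Num.floor x)%:~R :> R by rewrite intrM.
  by rewrite ler_int floor_ge_int intrM ler_pM2l// floor_le.
by move=> ab; apply/eqP; rewrite eq_le !H.
Qed.

Let grid m (x : 'rV[R]_n) : 'rV[int]_n := map_mx Num.floor (2 ^+ m *: x).

Let gridE m z : grid m @^-1` [set z] =
  half_open_box ((2 ^+ m)^-1 *: map_mx intr z) (2 ^+ m)^-1.
Proof.
apply/seteqP; split => x.
  move=> <- j; rewrite !mxE -[X in _ < _ + X]mulr1 -mulrDr.
  by rewrite ler_pdivrMl// ltr_pdivlMl// -[X in _ + X]/(1%:~R) -intrD floor_itv.
move=> H; apply/rowP => j; move: (H j); rewrite !mxE -[X in _ < _ + X]mulr1 -mulrDr.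
rewrite ler_pdivrMl// ltr_pdivlMl// -[X in _ + X]/(1%:~R) -intrD => xj.
exact: floor_def.
Qed.

Let grid_nested m x y : grid m.+1 x = grid m.+1 y -> grid m x = grid m y.
Proof.
move=> /rowP xy; apply/rowP => j; move: (xy j); rewrite !mxE exprS -!mulrA.
exact: floor_double.
Qed.

Variables (m1 m2 : {measure set 'rV[R]_n -> \bar R}) (W : set 'rV[R]_n) (c : R).
Hypothesis c0 : 0 <= c.
Hypothesis oW : open W.
Hypothesis m2W : (m2 W < +oo)%E.
Hypothesis m12 : forall q l, 0 < l -> half_open_box q l `<=` W ->
  (m1 (half_open_box q l) <= c%:E * m2 (half_open_box q l))%E.

Local Open Scope ereal_scope.

(** An open set is the increasing union, over the levels [m], of the dyadic cells of side 2^-m that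
    it contains; at each level these cells are disjoint and the hypothesis on boxes can be
    summed. *)
Let open_comparison (V : set 'rV[R]_n) : open V -> V `<=` W -> m1 V <= c%:E * m2 V.
Proof.
move=> oV VW.
(* Cells are indexed by the codes of their integer corners; a code that decodes to nothing, or to a
   cell not inside [V], gives the empty set. *)
pose B m k : set 'rV[R]_n := if (pickle_inv k : option 'rV[int]_n) is Some z then
  if `[< grid m @^-1` [set z] `<=` V >] then grid m @^-1` [set z] else set0 else set0.
have mB m k : measurable (B m k).
  rewrite /B; case: pickle_inv => // z; case: ifP => // _.
  by rewrite gridE; exact: measurable_half_open_box.
have tB m : trivIset setT (B m).
  move=> i j _ _ [x []]; rewrite /B.
  have := @pickle_invK 'rV[int]_n i; have := @pickle_invK 'rV[int]_n j.
  case: pickle_inv => [z|//] /= <-; case: pickle_inv => [z'|//] /= <-.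
  by case: ifP => // _ /= <-; case: ifP => // _ /= <-.
have B12 m k : m1 (B m k) <= c%:E * m2 (B m k).
  rewrite /B; case: pickle_inv => [z|]; last by rewrite !measure0 mule0.
  case: ifPn => [/asboolP zV|_]; last by rewrite !measure0 mule0.
  rewrite gridE in zV *; apply: m12; last exact: subset_trans zV VW.
  by rewrite invr_gt0 exprn_gt0.
pose U m := \bigcup_k B m k.
have mU m : measurable (U m) by apply: bigcupT_measurable => k; exact: mB.
have UE m : U m = [set x | grid m @^-1` [set grid m x] `<=` V].
  apply/seteqP; split => x.
    move=> [k _]; rewrite /B; case: pickle_inv => // z; case: ifPn => // /asboolP zV /= xz.
    by rewrite xz.
  move=> xV; exists (pickle (grid m x)) => //; rewrite /B pickleK_inv.
  by case: ifPn => // /asboolP.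
have ndU : nondecreasing_seq U.
  apply/nondecreasing_seqP => m; apply/subsetPset; rewrite !UE => x xV y /= yx.
  by apply: xV => /=; exact: grid_nested.
have UV : \bigcup_m U m = V.
  apply/seteqP; split => [x [m _]|x Vx]; first by rewrite UE => /(_ x); apply.
  move: oV; rewrite openE => /(_ _ Vx)/nbhs_ballP[e /= e0 eV].
  have [m me] : exists m, ((2 ^+ m)^-1 < e)%R.
    exists (Num.truncn e^-1).+1; rewrite invf_plt ?posrE ?exprn_gt0//.
    apply: lt_le_trans (truncnS_gt _) _.
    by rewrite -natrX ler_nat ltnW// ltn_expl.
  exists m => //; rewrite UE => y /= yx; apply: eV.
  rewrite -ball_normE/=; apply: le_lt_trans me.
  apply: rV_norm_le => [|j]; first by rewrite invr_ge0 ltW.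
  have /seteqP[H _] := gridE m (grid m x).
  rewrite subr_coord ler_norml; move: (H x erefl j) (H y yx j).
  set a := fun_of_matrix _ _ _.
  by move=> /andP[? ?] /andP[? ?]; apply/andP; split; lra.
have cU (m' : {measure set 'rV[R]_n -> \bar R}) : m' (U k) @[k --> \oo] --> m' V.
  by rewrite -UV; apply: nondecreasing_cvg_mu => //; rewrite UV; exact: open_measurable_rV.
have cU2 : (fun k => c%:E * m2 (U k)) @ \oo --> c%:E * m2 V.
  by apply: cvgeZl => //; exact: cU.
rewrite -(cvg_lim _ (cU m1))// -(cvg_lim _ cU2)//; apply: lee_lim.
- by apply/cvg_ex; eexists; exact: cU.
- by apply/cvg_ex; eexists; exact: cU2.
apply: nearW => m; rewrite /U !measure_bigcup//.
rewrite -nneseriesZl//; apply: lee_nneseries => // k _; exact: B12.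
Qed.

(** Outer regularity is asked of [m2] restricted to [W], which is finite; [m1] is only compared on
    open sets. The tolerance [e / (c + 1)] stays below [e] after multiplication by [c], also for
    [c = 0]. *)
Lemma dyadic_comparison (A : set 'rV[R]_n) : measurable A -> A `<=` W ->
  m1 A <= c%:E * m2 A.
Proof.
move=> mA AW.
have mW : measurable W by exact: open_measurable_rV.
have mWfin : mrestr m2 mW setT < +oo by rewrite /mrestr setTI.
apply/lee_addgt0Pr => e e0.
have e1 : (0 < e / (c + 1))%R by rewrite divr_gt0// ltr_wpDl.
have [V [oV AV VA]] := @outer_regularity _ _ (mrestr m2 mW) mWfin A _ mA e1.
have mV : measurable V by exact: open_measurable_rV.
apply: (@le_trans _ _ (m1 (V `&` W))).
  apply: le_measure; rewrite ?inE//; first exact: measurableI.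
  by move=> x Ax; split; [exact: AV|exact: AW].
apply: le_trans (open_comparison (openI oV oW) (@subIsetr _ _ _)) _.
apply: (@le_trans _ _ (c%:E * (m2 A + (e / (c + 1))%:E))).
  apply: lee_wpmul2l; first by rewrite lee_fin.
  have -> : V `&` W = A `|` ((V `\` A) `&` W).
    apply/seteqP; split => x; last by case=> [Ax|[[]]//]; split; [exact: AV|exact: AW].
    by move=> [Vx Wx]; have [Ax|nA] := pselect (A x); [left|right].
  apply: le_trans (measureU2 _ _ _) _ => //.
    by apply: measurableI => //; exact: measurableD.
  by apply: leeD => //; exact: ltW.
rewrite ge0_muleDr//; last by rewrite lee_fin ltW.
apply: leeD => //; rewrite -EFinM lee_fin mulrCA ler_piMr// ?(ltW e0)//.
by rewrite ler_pdivrMr ?mul1r ?lerDl// ltr_wpDl.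
Qed.

End dyadic_comparison.

(** * Trajectories of a C^1 vector field *)

Section C1_functions.
Context (R : realType) (n : nat).
Implicit Types (W : set 'rV[R]_n) (f : 'rV[R]_n -> R).

Lemma open_ball_sub (W : set 'rV[R]_n) x : open W -> W x ->
  exists2 r : R, 0 < r & ball x r `<=` W.
Proof. by rewrite openE => + Wx => /(_ _ Wx)/nbhs_ballP[r /= r0 rW]; exists r. Qed.

Lemma continuous_distP (V : normedModType R) (f : 'rV[R]_n -> V) x :
  {for x, continuous f} <->
  forall e : R, 0 < e -> exists2 r : R, 0 < r &
    forall y, `|x - y| < r -> `|f x - f y| < e.
Proof.
split => [cf e e0|H].
  have /nbhs_ballP[r /= r0 H] := cf _ (nbhsx_ballx (f x) e e0).
  exists r => // y xy; have : ball x r y by rewrite -ball_normE.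
  by move=> /H; rewrite -ball_normE.
move=> A /nbhs_ballP[e /= e0 eA]; have [r r0 rA] := H e e0.
apply/nbhs_ballP; exists r => // y; rewrite -ball_normE => /= /rA fxy.
by apply: eA; rewrite -ball_normE.
Qed.

Lemma is_derive_curve (V : normedModType R) (f : 'rV[R]_n -> V) (g : R -> 'rV[R]_n) t v :
  is_derive t (1 : R) g v -> differentiable f (g t) ->
  is_derive t (1 : R) (f \o g) ('D_v f (g t)).
Proof.
move=> gv df; have dg : differentiable g t by apply/derivable1_diffP; exact: ex_derive.
have dfg : differentiable (f \o g) t by exact: differentiable_comp.
apply: DeriveDef; first exact/derivable1_diffP.
have dgv : 'd g t 1 = v by rewrite -deriveE// derive_val.
by rewrite deriveE// diff_comp//= dgv deriveE.
Qed.

Lemma derive_coord (v x : 'rV[R]_n) j : 'D_v (fun y : 'rV[R]_n => y 0 j) x = v 0 j.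
Proof.
have -> : v 0 j = ('D_v (@id 'rV[R]_n) x) 0 j by rewrite derive_id.
by rewrite derive_mx// mxE.
Qed.

Lemma is_derive_line (x d : 'rV[R]_n) (t : R) :
  is_derive t 1 (fun u : R => x + u *: d) d.
Proof.
have q : h^-1 *: ((x + (h *: (1 : R) + t) *: d) - (x + t *: d)) @[h --> 0^'] --> d.
  apply: cvg_near_cst; near=> h.
  rewrite opprD addrACA subrr add0r -scalerBl addrK scalerA [h *: 1]mulr1 mulVf ?scale1r//.
  by near: h; exact: nbhs_dnbhs_neq.
by apply: DeriveDef; [apply/cvg_ex; exists d; exact: q|exact: cvg_lim q].
Unshelve. all: by end_near. Qed.

Lemma is_derive_coord (g : R -> 'rV[R]_n) t v j :
  is_derive t (1 : R) g v -> is_derive t (1 : R) (fun u => g u 0 j) (v 0 j).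
Proof.
move=> gv; rewrite -(derive_coord v (g t) j).
by apply: (is_derive_curve gv); exact: differentiable_coord.
Qed.

Lemma derive_sum_coord (V : normedModType R) (f : 'rV[R]_n -> V) x v :
  differentiable f x ->
  'D_v f x = \sum_j v 0 j *: 'D_(delta_mx 0 j) f x.
Proof.
move=> df; rewrite deriveE// [in LHS](row_sum_delta v) raddf_sum.
by apply: eq_bigr => j _; rewrite deriveE//; exact: (linearZZ ('d f x)).
Qed.

Lemma ball_segment (c x x' : 'rV[R]_n) r t : ball c r x -> ball c r x' ->
  0 <= t <= 1 -> ball c r (x' + t *: (x - x')).
Proof.
rewrite -!ball_normE/= => cx cx' /andP[t0 t1].
have -> : c - (x' + t *: (x - x')) = t *: (c - x) + (1 - t) *: (c - x').
  apply/rowP => j; rewrite !mxE; ring.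
apply: le_lt_trans (ler_normD _ _) _; rewrite !normrZ !ger0_norm ?subr_ge0//.
have [->|t_neq0] := eqVneq t 0; first by rewrite mul0r add0r subr0 mul1r.
have -> : r = t * r + (1 - t) * r by ring.
apply: ltr_leD; first by rewrite ltr_pM2l// lt_neqAle eq_sym t_neq0.
by rewrite ler_wpM2l ?subr_ge0// ltW.
Qed.

Definition C1_open (V : normedModType R) W (f : 'rV[R]_n -> V) :=
  (forall x, W x -> differentiable f x) /\
  forall v x, W x -> {for x, continuous ('D_v f)}.

Lemma C1_open_coord m W (F : 'rV[R]_n -> 'rV[R]_m) j : open W ->
  C1_open W F -> C1_open W (fun y => F y 0 j).
Proof.
move=> oW [dF cF].
have dFj x : W x -> differentiable (fun y => F y 0 j) x.
  move=> Wx; apply: (@differentiable_comp _ _ _ _ F (fun y : 'rV[R]_m => y 0 j)).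
    exact: dF.
  exact: differentiable_coord.
have DE v x : W x -> 'D_v (fun y => F y 0 j) x = ('D_v F x) 0 j.
  move=> Wx; rewrite derive_mx ?mxE//; apply: diff_derivable; exact: dF.
split => // v x Wx.
have [r r0 rW] := open_ball_sub oW Wx.
apply/continuous_distP => e e0; have [r' r'0 H] := (continuous_distP _ _).1 (cF v x Wx) _ e0.
exists (Num.min r r'); first by rewrite lt_min r0.
move=> y; rewrite lt_min => /andP[xy xy'].
have Wy : W y by apply: rW; rewrite -ball_normE.
by rewrite !DE// -subr_coord; apply: le_lt_trans (H _ xy'); exact: ler_norm_coord.
Qed.

(** Strict differentiability: the linear map is frozen at [c] while both points vary, which
    differentiability at [c] alone does not give. It comes from the mean value theorem on the
    segment and the continuity of the partial derivatives. *)
Lemma C1_local_estimate W f c (e : R) : open W -> C1_open W f -> W c -> 0 < e ->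
  exists r : R, [/\ 0 < r, ball c r `<=` W &
    forall x x', ball c r x -> ball c r x' ->
      `|f x - f x' - 'D_(x - x') f c| <= e * `|x - x'|].
Proof.
move=> oW [df cf] Wc e0; pose e1 := e / (n%:R + 1).
have e10 : 0 < e1 by rewrite divr_gt0.
have [r0 r00 r0W] := open_ball_sub oW Wc.
have /choice[r1 Hr1] : forall j : 'I_n, exists r : R, 0 < r /\ forall x, `|c - x| < r ->
    `|'D_(delta_mx 0 j) f c - 'D_(delta_mx 0 j) f x| < e1.
  move=> j; have [r ? ?] := (continuous_distP _ _).1 (cf (delta_mx 0 j) c Wc) _ e10.
  by exists r.
pose r := \big[Num.min/r0]_j r1 j.
have r_gt0 : 0 < r by apply/bigmin_gtP; split => // j _; have [] := Hr1 j.
have H x : ball c r x -> W x /\ forall j,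
    `|'D_(delta_mx 0 j) f c - 'D_(delta_mx 0 j) f x| < e1.
  rewrite -ball_normE/= => cx; split.
    apply: r0W; rewrite -ball_normE/=; apply: lt_le_trans cx _; exact: bigmin_le_id.
  by move=> j; apply: (Hr1 j).2; apply: lt_le_trans cx _; exact: bigmin_le.
exists r; split => //; first by move=> x /H[].
move=> x x' xc xc'; set d := x - x'; pose g (t : R) := x' + t *: d.
have gin t : 0 <= t <= 1 -> ball c r (g t) by exact: ball_segment.
have dg (t : R) : is_derive t 1 g d by exact: is_derive_line.
have dfg (t : R) : 0 <= t <= 1 -> is_derive t 1 (f \o g) ('D_d f (g t)).
  by move=> t01; apply: (is_derive_curve (dg t)); apply: df; have [] := H _ (gin _ t01).
have [||t tin] := @MVT_segment _ (f \o g) (fun t => 'D_d f (g t)) 0 1 ler01.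
- by move=> t; rewrite in_itv/= => /andP[? ?]; apply: dfg; rewrite !ltW.
- apply: derivable_within_continuous => t; rewrite in_itv/= => t01.
  by case: (dfg _ t01).
have gt : ball c r (g t) by apply: gin; move: tin; rewrite in_itv.
have g1 : g 1 = x by rewrite /g scale1r /d addrC subrK.
have g0 : g 0 = x' by rewrite /g scale0r addr0.
rewrite /= g1 g0 subr0 mulr1 => ->.
have [Wg Hg] := H _ gt.
rewrite !derive_sum_coord; [|exact: df..].
rewrite -sumrB; apply: le_trans (ler_norm_sum _ _ _) _.
apply: (@le_trans _ _ (\sum_(j < n) `|d| * e1)).
  apply: ler_sum => j _; rewrite -scalerBr normrM; apply: ler_pM => //.
    exact: ler_norm_coord.
  by rewrite distrC ltW.
rewrite sumr_const card_ord -[leLHS]mulr_natr mulrAC -mulrA mulrC.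
apply: ler_wpM2r => //; rewrite /e1 mulrC mulrAC ler_pdivrMr//.
by rewrite ler_wpM2l ?(ltW e0)// lerDl.
Qed.

End C1_functions.

Section trajectories.
Context (R : realType) (n : nat).
Implicit Types (g : R -> 'rV[R]_n) (F : 'rV[R]_n -> 'rV[R]_n).

(** A single number serves both as the radius of the neighbourhood and as the parameter of [P], so
    that shrinking it is harmless. Upper bounds are put in this form by writing them as [r^-1]. *)
Lemma compact_uniform (K : set 'rV[R]_n) (P : R -> 'rV[R]_n -> Prop) : compact K ->
  (forall r r' z, 0 < r' <= r -> P r z -> P r' z) ->
  (forall c, K c -> exists2 r, 0 < r & forall z, ball c r z -> P r z) ->
  exists2 r, 0 < r & forall z, K z -> P r z.
Proof.
move=> /compact_near_coveringP cK Pmono Ploc.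
have : \forall r \near 0^'+, K `<=` P r.
  apply: cK => c Kc; have [r r0 rP] := Ploc c Kc.
  exists (ball c r, [set u | 0 < u <= r]).
    split; first exact: nbhsx_ballx.
    by near=> u => /=; apply/andP; split; near: u; [exact: nbhs_right_gt|exact: nbhs_right_le].
  by move=> [z u] [/= /rP rz ur]; exact: Pmono ur rz.
move=> H; near (0 : R)^'+ => r; exists r; first by near: r; exact: nbhs_right_gt.
by near: r.
Unshelve. all: by end_near. Qed.

Lemma within_continuous_dist (A : set R) (g : R -> 'rV[R]_n) :
  {within A, continuous g} -> forall t, A t -> forall e : R, 0 < e ->
  exists2 r : R, 0 < r & forall u, A u -> `|t - u| < r -> `|g t - g u| < e.
Proof.
move=> /subspace_continuousP cg t At e e0.
have := cg t At _ (nbhsx_ballx (g t) e e0); rewrite /= /within /= /nbhs/=.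
move=> /nbhs_ballP[r /= r0 H]; exists r => // u Au tu.
have : ball t r u by rewrite -ball_normE.
by move=> /H/(_ Au); rewrite -ball_normE.
Qed.

Lemma within_continuous_coord (A : set R) g j :
  {within A, continuous g} -> {within A, continuous (fun t => g t 0 j)}.
Proof.
move=> cg t; apply: (@continuous_comp (subspace A) _ _ g (fun v : 'rV[R]_n => v 0 j)).
  exact: cg.
exact: coord_continuous.
Qed.

Lemma curve_mean_value g (dg : R -> 'rV[R]_n) (a b M : R) : a <= b -> 0 <= M ->
  {within `[a, b], continuous g} ->
  (forall t, a < t < b -> is_derive t 1 g (dg t)) ->
  (forall t, a < t < b -> `|dg t| <= M) ->
  `|g b - g a| <= M * (b - a).
Proof.
move=> ab M0 cg dgP dgM; apply: rV_norm_le => [|j].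
  by rewrite mulr_ge0// subr_ge0.
rewrite subr_coord; move: ab; rewrite le_eqVlt => /predU1P[->|ab].
  by rewrite !subrr normr0 mulr0.
have [|t tab ->] := @MVT R (fun t => g t 0 j) (fun t => dg t 0 j) a b ab _ (within_continuous_coord (j := j) cg).
  by move=> t; rewrite in_itv/= => /dgP; exact: is_derive_coord.
rewrite normrM [X in _ * X]ger0_norm ?subr_ge0 ?(ltW ab)//.
apply: ler_wpM2r; first by rewrite subr_ge0 ltW.
by apply: le_trans (ler_norm_coord _ _) _; apply: dgM; rewrite in_itv in tab.
Qed.

Definition trajectory F g := {within `[0, +oo[, continuous g} /\
  forall t : R, 0 < t -> is_derive t 1 g (F (g t)).

Lemma trajectory_within F g (a b : R) : trajectory F g -> 0 <= a ->
  {within `[a, b], continuous g}.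
Proof.
move=> [cg _] a0; apply: continuous_subspaceW cg => t/=; rewrite !in_itv/= andbT.
by move=> /andP[at_ _]; exact: le_trans at_.
Qed.

Lemma C1_local_linear W F c (e : R) : open W -> C1_open W F -> W c -> 0 < e ->
  exists r : R, [/\ 0 < r, ball c r `<=` W &
    forall x x', ball c r x -> ball c r x' ->
      `|F x - F x' - (x - x') *m jacobian F c| <= e * `|x - x'|].
Proof.
move=> oW cF Wc e0; have [r0 r00 r0W] := open_ball_sub oW Wc.
have /choice[r1 Hr1] : forall j : 'I_n, exists r : R, 0 < r /\
    forall x x', ball c r x -> ball c r x' ->
    `|F x 0 j - F x' 0 j - ((x - x') *m jacobian F c) 0 j| <= e * `|x - x'|.
  move=> j; have [r [r_gt0 rW H]] := C1_local_estimate oW (C1_open_coord j oW cF) Wc e0.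
  exists r; split => // x x' cx cx'; have := H x x' cx cx'.
  rewrite -deriveEjacobian; last exact: cF.1.
  rewrite derive_mx ?mxE//; apply: diff_derivable; exact: cF.1.
exists (\big[Num.min/r0]_j r1 j); split.
- by apply/bigmin_gtP; split => // j _; have [] := Hr1 j.
- by apply: subset_trans r0W; apply: le_ball; exact: bigmin_le_id.
move=> x x' cx cx'; apply: rV_norm_le => [|j]; first by rewrite mulr_ge0// ltW.
rewrite !subr_coord; apply: (Hr1 j).2.
- by apply: le_ball cx; exact: bigmin_le.
- by apply: le_ball cx'; exact: bigmin_le.
Qed.

End trajectories.

Section two_trajectories.
Context (R : realType) (n : nat).
Variables (F : 'rV[R]_n -> 'rV[R]_n) (g1 g2 : R -> 'rV[R]_n).
Hypotheses (tg1 : trajectory F g1) (tg2 : trajectory F g2).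

Let d t := g1 t - g2 t.

Let cd (a b : R) : 0 <= a -> {within `[a, b], continuous d}.
Proof.
move=> a0 t; apply: (@continuousB _ _ (subspace `[a, b])).
  exact: (trajectory_within tg1).
exact: (trajectory_within tg2).
Qed.

Let dd (t : R) : 0 < t -> is_derive t 1 d (F (g1 t) - F (g2 t)).
Proof. by move=> t0; apply: is_deriveB; [exact: tg1.2|exact: tg2.2]. Qed.

(** Short-time substitute for the Gronwall inequality, valid in both time directions: let [c] be the
    time of the largest gap. Between [c] and any other time the gap changes by at most
    [L * (b - a) <= 1/2] times its maximum. *)
Lemma gap_comparable (a b L : R) : 0 <= a -> a <= b -> 0 <= L ->
  (b - a) * L <= 2^-1 ->
  (forall t, a < t < b -> `|F (g1 t) - F (g2 t)| <= L * `|d t|) ->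
  forall t t', a <= t <= b -> a <= t' <= b -> `|d t| <= 2 * `|d t'|.
Proof.
move=> a0 ab L0 abL FL t t' tab t'ab.
have cn : {within `[a, b], continuous (fun t => `|d t|)}.
  move=> u; apply: (@continuous_comp (subspace `[a, b]) _ _ d Num.norm).
    exact: cd.
  exact: norm_continuous.
have [c cab cmax] := EVT_max ab cn.
rewrite in_itv/= in cab.
have dmax u : a <= u <= b -> `|d u| <= `|d c| by move=> uab; apply: cmax; rewrite in_itv.
have dle u v : a <= u -> u <= v -> v <= b -> `|d v - d u| <= 2^-1 * `|d c|.
  move=> au uv vb; apply: (@le_trans _ _ (L * `|d c| * (v - u))).
    apply: (@curve_mean_value _ _ _ (fun t => F (g1 t) - F (g2 t))) => //.
    - by rewrite mulr_ge0.
    - by apply: cd; exact: le_trans au.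
    - by move=> w /andP[uw _]; apply: dd; apply: le_lt_trans uw; exact: le_trans au.
    move=> w /andP[uw wv]; apply: le_trans (FL w _) _.
      by rewrite (le_lt_trans au)//= (lt_le_trans wv).
    apply: ler_wpM2l => //; apply: dmax.
    by rewrite (le_trans au (ltW uw))//= (le_trans (ltW wv)).
  rewrite mulrAC; apply: ler_wpM2r => //; apply: le_trans abL.
  by rewrite mulrC; apply: ler_wpM2r => //; apply: lerB.
have ct : `|d c - d t'| <= 2^-1 * `|d c|.
  case/andP: cab => ac cb; case/andP: t'ab => at' t'b.
  by have [ct'|/ltW t'c] := leP c t'; [rewrite distrC|]; exact: dle.
have : `|d c| <= `|d c - d t'| + `|d t'|.
  by rewrite -[X in `|X| <= _](subrK (d t')); exact: ler_normD.
have := dmax t tab; lra.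
Qed.

(** The gap nearly solves the linear equation with matrix [J]. Errors are measured against the final
    gap [d h], because in the volume estimate it is the endpoints that are known to lie in a small
    cube. *)
Lemma gap_linear (h L e : R) (J : 'M[R]_n) (B : set 'rV[R]_n) : 0 <= h -> 0 <= e ->
  L = mx_sum_norm J + e -> h * L <= 2^-1 ->
  (forall x x', B x -> B x' -> `|F x - F x' - (x - x') *m J| <= e * `|x - x'|) ->
  (forall t, 0 <= t <= h -> B (g1 t) /\ B (g2 t)) ->
  `|d 0| <= 2 * `|d h| /\
  `|d 0 *m (1%:M + h *: J) - d h| <= 2 * (e + h * L * mx_sum_norm J) * h * `|d h|.
Proof.
move=> h0 e0 LE hL FJ gB.
have S0 := mx_sum_norm_ge0 J.
have L0 : 0 <= L by rewrite LE addr_ge0.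
have FL t : 0 <= t <= h -> `|F (g1 t) - F (g2 t)| <= L * `|d t|.
  move=> th; have [B1 B2] := gB t th.
  rewrite -[X in `|X|](subrK (d t *m J)); apply: le_trans (ler_normD _ _) _.
  rewrite LE mulrDl addrC lerD//; first by rewrite mulrC norm_mulmx_le.
  exact: FJ.
have dcomp t t' : 0 <= t <= h -> 0 <= t' <= h -> `|d t| <= 2 * `|d t'|.
  apply: (@gap_comparable 0 h L) => //; first by rewrite subr0.
  by move=> u /andP[u0 uh]; apply: FL; rewrite !ltW.
have hh : 0 <= h <= h by rewrite h0 lexx.
have h00 : 0 <= (0 : R) <= h by rewrite lexx.
split; first exact: dcomp.
have ddh t : 0 <= t <= h -> `|d t - d 0| <= L * (2 * `|d h|) * h.
  move=> /andP[t0 th]; apply: (@le_trans _ _ (L * (2 * `|d h|) * (t - 0))); last first.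
    by rewrite subr0; apply: ler_wpM2l => //; rewrite !mulr_ge0.
  apply: (@curve_mean_value _ _ _ (fun t => F (g1 t) - F (g2 t))) => //.
  - by rewrite !mulr_ge0.
  - exact: cd.
  - by move=> u /andP[u0 _]; exact: dd.
  move=> u /andP[u0 ut]; have uh : 0 <= u <= h by rewrite (ltW u0) (ltW (lt_le_trans ut th)).
  by apply: le_trans (FL u uh) _; apply: ler_wpM2l => //; exact: dcomp.
(* Subtracting the uniform motion with the initial linear speed leaves a curve of small speed: [e]
   times the gap, plus the effect of [J] on the change of the gap since time 0. *)
pose k t := d t - t *: (d 0 *m J).
have -> : d 0 *m (1%:M + h *: J) - d h = - (k h - k 0).
  rewrite /k scale0r subr0 mulmxDr mulmx1 -scalemxAr.
  by apply/rowP => j; rewrite !mxE; ring.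
rewrite normrN.
have -> : 2 * (e + h * L * mx_sum_norm J) * h * `|d h| =
  2 * (e + h * L * mx_sum_norm J) * `|d h| * (h - 0) by ring.
apply: (@curve_mean_value _ _ k (fun t => F (g1 t) - F (g2 t) - d 0 *m J)) => //.
- by rewrite !mulr_ge0// addr_ge0// !mulr_ge0.
- move=> t; apply: (@continuousB _ _ (subspace `[0, h])); first exact: cd.
  by apply: continuous_subspaceT => u; exact: scalel_continuous.
- move=> t /andP[t0 _]; apply: is_deriveB; first exact: dd.
  by have := @is_derive_line _ _ 0 (d 0 *m J) t; under eq_fun do rewrite add0r.
move=> t /andP[t0 th]; have th' : 0 <= t <= h by rewrite !ltW.
have [B1 B2] := gB t th'.
have -> : F (g1 t) - F (g2 t) - d 0 *m J =
    (F (g1 t) - F (g2 t) - d t *m J) + (d t - d 0) *m J.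
  by rewrite (mulmxBl (d t) (d 0)) addrA subrK.
apply: le_trans (ler_normD _ _) _.
have -> : 2 * (e + h * L * mx_sum_norm J) * `|d h| =
  e * (2 * `|d h|) + L * (2 * `|d h|) * h * mx_sum_norm J by ring.
apply: lerD.
  apply: le_trans (FJ _ _ B1 B2) _.
  by apply: ler_wpM2l => //; exact: dcomp.
apply: le_trans (norm_mulmx_le _ _) _.
by apply: ler_wpM2r => //; exact: ddh.
Qed.

End two_trajectories.

Section dependence.
Context (R : realType) (n : nat).
Variables (F : 'rV[R]_n -> 'rV[R]_n) (U : set 'rV[R]_n).
Hypotheses (oU : open U) (cF : C1_open U F).

(** The point [w] may leave [K]: it will be on a second trajectory, of which only the initial
    closeness is known. *)
Lemma lipschitz_near_compact (K : set 'rV[R]_n) : compact K -> K `<=` U ->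
  exists2 r : R, 0 < r & forall z, K z -> forall w, `|w - z| < r ->
    `|F w - F z| <= r^-1 * `|w - z|.
Proof.
move=> cK KU.
apply: (@compact_uniform _ _ K (fun r z => forall w, `|w - z| < r ->
    `|F w - F z| <= r^-1 * `|w - z|)) => //.
  move=> r r' z /andP[r'0 r'r] H w wz; apply: le_trans (H w (lt_le_trans wz r'r)) _.
  by apply: ler_wpM2r => //; rewrite lef_pV2 ?posrE// (lt_le_trans r'0).
move=> c Kc; have [r0 [r00 _ H]] := C1_local_linear oU cF (KU _ Kc) ltr01.
set L := mx_sum_norm (jacobian F c) + 1.
have L0 : 0 < L by rewrite ltr_wpDl// mx_sum_norm_ge0.
exists (Num.min (r0 / 2) L^-1); first by rewrite lt_min divr_gt0//= invr_gt0.
move=> z; rewrite -ball_normE/= lt_min => /andP[cz _] w; rewrite lt_min => /andP[wz _].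
have -> : F w - F z = (F w - F z - (w - z) *m jacobian F c) + (w - z) *m jacobian F c.
  by rewrite subrK.
apply: le_trans (ler_normD _ _) _; apply: (@le_trans _ _ (L * `|w - z|)).
  rewrite /L mulrDl addrC; apply: lerD; first by rewrite mulrC norm_mulmx_le.
  apply: H; rewrite -ball_normE/=; last by apply: lt_trans cz _; lra.
  have -> : c - w = (c - z) + (z - w) by rewrite addrA subrK.
  by apply: le_lt_trans (ler_normD _ _) _; rewrite (distrC z); lra.
apply: ler_wpM2r => //; rewrite -[leLHS]invrK lef_pV2 ?posrE.
- by rewrite ge_min lexx orbT.
- by rewrite invr_gt0.
- by rewrite lt_min divr_gt0//= invr_gt0.
Qed.

Variables (g1 : R -> 'rV[R]_n) (T : R).
Hypotheses (tg1 : trajectory F g1) (g1U : forall t, 0 <= t <= T -> U (g1 t)).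

(** Continuation argument. Let [t1] be the supremum of the times up to which the gap stays below
    [rho / 2]; up to [t1] the Lipschitz bound applies and the gap is at most twice its initial
    value, hence still below [rho / 2], so [t1 < b] would contradict continuity. *)
Let gap_step rho g2 (a b : R) : trajectory F g2 -> 0 < rho -> 0 <= a -> a <= b ->
  (b - a) * rho^-1 <= 2^-1 ->
  (forall t, a <= t <= b -> forall w, `|w - g1 t| < rho ->
    `|F w - F (g1 t)| <= rho^-1 * `|w - g1 t|) ->
  `|g1 a - g2 a| < rho / 4 -> `|g1 b - g2 b| <= 2 * `|g1 a - g2 a|.
Proof.
move=> tg2 rho0 a0 ab abrho HF; set d := fun t => g1 t - g2 t; rewrite -/(d a) -/(d b) => da.
have cd' (t e : R) : 0 <= t -> 0 < e ->
    exists2 r : R, 0 < r & forall u, 0 <= u -> `|t - u| < r -> `|d t - d u| < e.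
  move=> t0 e0; have cont : {within `[0, +oo[, continuous d}.
    by move=> u; exact: (continuousB (tg1.1 u) (tg2.1 u)).
  have [|r r0 H] := within_continuous_dist cont (t := t) _ e0; first by rewrite /= in_itv/= t0.
  by exists r => // u u0 /H; rewrite /= in_itv/= u0; exact.
have cd (t e : R) : 0 <= t -> 0 < e ->
    exists2 r : R, 0 < r & forall u, 0 <= u -> `|t - u| < r -> `|d u| < `|d t| + e.
  move=> t0 e0; have [r r0 H] := cd' t e t0 e0; exists r => // u u0 /(H _ u0) H'.
  rewrite -[X in `|X| < _](subrK (d t)) addrC; apply: le_lt_trans (ler_normD _ _) _.
  by rewrite ltrD2l distrC.
pose A := [set t | a <= t <= b /\ forall u, a <= u <= t -> `|d u| < rho / 2].
have Aa : A a.
  split; first by rewrite lexx.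
  move=> u /andP[au ua]; have -> : u = a by apply/eqP; rewrite eq_le ua.
  lra.
have supA : has_sup A by split; [exists a|exists b => t [/andP[]]].
pose t1 := sup A.
have at1 : a <= t1 by apply: sup_upper_bound.
have t1b : t1 <= b by apply: ge_sup; [exists a|move=> t [/andP[]]].
have below u : a <= u -> u < t1 -> `|d u| < rho / 2.
  move=> au ut1; have t1u : 0 < t1 - u by rewrite subr_gt0.
  have [t [_ At] ut] := sup_adherent t1u supA.
  by apply: At; rewrite au/= ltW//; move: ut; rewrite -/t1 opprB addrC subrK.
have below_eq u : a <= u <= t1 -> `|d u| < rho.
  move=> /andP[au]; rewrite le_eqVlt => /predU1P[->|ut1]; last by have := below u au ut1; lra.
  have [t1a|at1'] := leP t1 a.
    have -> : t1 = a by apply/eqP; rewrite eq_le t1a.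
    lra.
  have [||r r0 H] := cd' t1 (rho / 2); [exact: le_trans at1|by rewrite divr_gt0|].
  pose v := Num.max a (t1 - r / 2).
  have vt1 : v < t1 by rewrite gt_max at1' ltrBlDr ltrDl divr_gt0.
  have av : a <= v by rewrite le_max lexx.
  have : `|d t1 - d v| < rho / 2.
    apply: H; first exact: le_trans av.
    rewrite gtr0_norm ?subr_gt0// ltrBlDr -ltrBlDl.
    by apply: (@lt_le_trans _ _ (t1 - r / 2)); [lra|rewrite le_max lexx orbT].
  have := below v av vt1.
  have : `|d t1| <= `|d t1 - d v| + `|d v|.
    by rewrite -[X in `|X| <= _](subrK (d v)); exact: ler_normD.
  lra.
have close t : a <= t <= t1 -> `|d t| <= 2 * `|d a|.
  move=> tt; apply: (gap_comparable tg1 tg2 (a := a) (b := t1) (L := rho^-1)) => //.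
  - by rewrite invr_ge0 ltW.
  - apply: le_trans abrho; apply: ler_wpM2r; first by rewrite invr_ge0 ltW.
    by rewrite lerD2r.
  - move=> u /andP[au ut1]; rewrite distrC (distrC (g1 u)).
    apply: HF; first by rewrite (ltW au) (le_trans (ltW ut1)).
    by rewrite distrC; apply: below_eq; rewrite !ltW.
  - by rewrite lexx.
suff -> : b = t1 by apply: close; rewrite at1 lexx.
apply/eqP; rewrite eq_le t1b andbT leNgt; apply/negP => t1_lt_b.
have dt1 : `|d t1| < rho / 2.
  have := close t1; rewrite at1 lexx => /(_ isT); lra.
have [|r r0 H] := cd t1 (rho / 2 - `|d t1|) (le_trans a0 at1); first by rewrite subr_gt0.
pose t2 := Num.min b (t1 + r / 2).
have t12 : t1 < t2 by rewrite lt_min t1_lt_b ltrDl divr_gt0.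
have : A t2.
  split; first by rewrite (le_trans at1 (ltW t12)) ge_min lexx.
  move=> u /andP[au ut2]; have [ut1|t1u] := leP u t1.
    by have := close u; rewrite au ut1 => /(_ isT); lra.
  have -> : rho / 2 = `|d t1| + (rho / 2 - `|d t1|) by ring.
  apply: H; first exact: le_trans au.
  rewrite ltr0_norm ?subr_lt0// opprB ltrBlDl; apply: le_lt_trans ut2 _.
  by apply: (@le_lt_trans _ _ (t1 + r / 2)); [rewrite ge_min lexx orbT|lra].
by move=> /(sup_upper_bound supA); rewrite leNgt t12.
Qed.

(** The gap at most doubles over each time interval of length [rho / 2], and [k] of these cover
    [[0, T]]; the initial gap is taken so small that after [k] doublings it is still below the
    threshold [rho / 4]. Only [g1] is assumed to stay in [U]. Equal initial values give
    uniqueness. *)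
Lemma trajectory_dependence : 0 <= T -> exists C r : R, [/\ 0 <= C, 0 < r &
  forall g2, trajectory F g2 -> `|g1 0 - g2 0| < r ->
    forall t, 0 <= t <= T -> `|g1 t - g2 t| <= C * `|g1 0 - g2 0|].
Proof.
move=> T0; pose K := g1 @` `[0, T].
have cK : compact K.
  by apply: continuous_compact; [exact: (trajectory_within tg1)|exact: segment_compact].
have KU : K `<=` U by move=> _ [t /= tT <-]; apply: g1U; move: tT; rewrite in_itv.
have [rho rho0 HF] := lipschitz_near_compact cK KU.
have {}HF t : 0 <= t <= T -> forall w, `|w - g1 t| < rho ->
    `|F w - F (g1 t)| <= rho^-1 * `|w - g1 t|.
  by move=> tT; apply: HF; exists t => //=; rewrite in_itv.
have H k : forall g2, trajectory F g2 -> 2 ^+ k * `|g1 0 - g2 0| < rho / 4 ->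
    forall t, 0 <= t <= T -> t <= k%:R * (rho / 2) ->
    `|g1 t - g2 t| <= 2 ^+ k * `|g1 0 - g2 0|.
  elim: k => [|k IHk] g2 tg2 g2rho t /andP[t0 tT] tk.
    have -> : t = 0 by apply/eqP; rewrite eq_le t0 andbT; rewrite mul0r in tk.
    by rewrite expr0 mul1r.
  have k2 : 2 ^+ k * `|g1 0 - g2 0| <= 2 ^+ k.+1 * `|g1 0 - g2 0|.
    by apply: ler_wpM2r => //; rewrite exprS ler_peMl ?exprn_ge0// ler1n.
  have krho := le_lt_trans k2 g2rho.
  have [tk'|/ltW kt] := leP t (k%:R * (rho / 2)).
    by apply: le_trans k2; apply: IHk => //; rewrite t0.
  have a0 : 0 <= k%:R * (rho / 2) by rewrite mulr_ge0// divr_ge0// ltW.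
  have da := IHk g2 tg2 krho (k%:R * (rho / 2)).
  rewrite a0 (le_trans kt tT) lexx in da; have {}da := da isT isT.
  rewrite exprS -mulrA; apply: le_trans (gap_step tg2 rho0 a0 kt _ _ _) _.
  - rewrite ler_pdivrMr// lerBlDl; apply: le_trans tk _.
    rewrite -natr1 mulrDl; lra.
  - move=> u /andP[ku ut]; apply: HF; rewrite (le_trans a0 ku)/=; exact: le_trans tT.
  - exact: le_lt_trans krho.
  - by apply: ler_wpM2l.
pose k := (Num.truncn (T / (rho / 2))).+1.
exists (2 ^+ k), (rho / 4 / 2 ^+ k); split.
- by rewrite exprn_ge0.
- by rewrite !divr_gt0// exprn_gt0.
move=> g2 tg2; rewrite ltr_pdivlMr ?exprn_gt0// mulrC => g2rho t tT.
apply: H => //; have /andP[_ tT'] := tT; apply: le_trans tT' _.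
rewrite -ler_pdivrMr ?divr_gt0//; exact/ltW/truncnS_gt.
Qed.

End dependence.

(** * Measurability of the flow and of survival in a closed set *)

Section relatively_open.
Context (R : realType) (n : nat).

Let norm_rV_cons (z z' : measurableTypeR R * 'rV[R]_n) :
  `|z.1 - z'.1| <= `|rV_cons z - rV_cons z'| /\
  `|z.2 - z'.2| <= `|rV_cons z - rV_cons z'|.
Proof.
case: z => x v; case: z' => y u /=; split.
  have := ler_norm_coord (rV_cons (x, v) - rV_cons (y, u)) (@lshift 1 n 0).
  by rewrite subr_coord !(@row_mxEl R 1 1 n) !mxE !eqxx !mulr1n.
apply: rV_norm_le => // j.
have := ler_norm_coord (rV_cons (x, v) - rV_cons (y, u)) (@rshift 1 n j).
by rewrite !subr_coord !(@row_mxEr R 1 1 n).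
Qed.

(** The product sigma-algebra is generated by rectangles, not by open sets. The set is therefore
    written as the trace on [Y] of the preimage under [rV_cons] of an open set of R^(n+1), where
    open sets are measurable by definition. *)
Lemma relatively_open_measurable (Y Z : set (measurableTypeR R * 'rV[R]_n)) :
  measurable Y -> Z `<=` Y ->
  (forall z, Z z -> exists2 r : R, 0 < r & forall z', Y z' ->
     `|z.1 - z'.1| < r -> `|z.2 - z'.2| < r -> Z z') ->
  measurable Z.
Proof.
move=> mY ZY Zopen.
pose V : set 'rV[R]_n.+1 := \bigcup_(w in [set w | forall z', Y z' ->
  ball (w.1 : 'rV[R]_n.+1) (w.2 : R) (rV_cons z') -> Z z']) ball (w.1 : 'rV[R]_n.+1) w.2.
have oV : open V by apply: bigcup_open => w _; exact: ball_open.
have -> : Z = Y `&` (@rV_cons R n @^-1` V).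
  apply/seteqP; split => [z Zz|z [Yz [w wV]]]; last exact: wV.
  split; first exact: ZY.
  have [r r0 H] := Zopen z Zz; exists (rV_cons z, r); last exact: ballxx.
  move=> z' Yz'; rewrite -ball_normE/= => zz'; have [H1 H2] := norm_rV_cons z z'.
  by apply: H => //; exact: le_lt_trans zz'.
apply: measurableI => //; rewrite -[X in measurable X]setTI.
by apply: measurable_rV_cons => //; exact: open_measurable_rV.
Qed.

End relatively_open.

Section flow.
Context (R : realType) (n : nat).
Variables (X U : set 'rV[R]_n) (F : 'rV[R]_n -> 'rV[R]_n) (s : R -> 'rV[R]_n -> 'rV[R]_n).
Hypotheses (mX : measurable X) (oU : open U) (XU : X `<=` U) (cF : C1_open U F).
Hypothesis F_flow : solution_map X F s.

Lemma flow0 x : X x -> s 0 x = x. Proof. by move=> /F_flow[]. Qed.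

Lemma flow_in x t : X x -> 0 <= t -> X (s t x).
Proof. by move=> /F_flow[_ + _ _]; exact. Qed.

Lemma flow_trajectory x : X x -> trajectory F (s^~ x).
Proof. by move=> /F_flow[]. Qed.

Let shift_trajectory g t : trajectory F g -> 0 <= t -> trajectory F (fun u => g (u + t)).
Proof.
move=> [cg dg] t0; split.
  apply/subspace_continuousP => u; rewrite /= in_itv/= andbT => u0.
  apply/cvgrPdist_lt => e e0.
  have [|r r0 H] := within_continuous_dist cg (t := u + t) _ e0.
    by rewrite /= in_itv/= andbT addr_ge0.
  rewrite /within/=; apply/nbhs_ballP; exists r => //= v; rewrite -ball_normE/= => uv.
  rewrite in_itv/= andbT => v0; apply: H; first by rewrite /= in_itv/= andbT addr_ge0.
  by rewrite opprD addrACA subrr addr0.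
move=> u u0; have ut0 : 0 < u + t by exact: ltr_wpDr.
have [dgu dgE] := dg _ ut0.
have E : (fun h : R => h^-1 *: (((fun v => g (v + t)) \o shift u) (h *: 1) - g (u + t))) =
         (fun h : R => h^-1 *: ((g \o shift (u + t)) (h *: 1) - g (u + t))).
  by apply/funext => h /=; rewrite addrA.
by apply: DeriveDef; rewrite /derivable /derive E; [exact: dgu|exact: dgE].
Qed.

(** Uniqueness of trajectories: the time-shifted trajectory of [x] and the trajectory of [s t x]
    have initial gap 0. *)
Lemma flowD x t u : X x -> 0 <= t -> 0 <= u -> s (u + t) x = s u (s t x).
Proof.
move=> Xx t0 u0; have Xst := flow_in Xx t0.
have := @trajectory_dependence _ _ F U oU cF (s^~ (s t x)) u (flow_trajectory Xst) _ u0.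
move=> [v /andP[v0 _]|C [r [C0 r0 H]]]; first by apply/XU/flow_in.
have := H _ (shift_trajectory (flow_trajectory Xx) t0).
rewrite add0r flow0// subrr normr0 mulr0 => /(_ r0 u).
by rewrite u0 lexx => /(_ isT); rewrite normr_le0 subr_eq0 => /eqP.
Qed.

Lemma flow_continuous x t (e : R) : X x -> 0 <= t -> 0 < e ->
  exists2 r : R, 0 < r & forall x' t', X x' -> 0 <= t' ->
    `|t - t'| < r -> `|x - x'| < r -> `|s t x - s t' x'| < e.
Proof.
move=> Xx t0 e0.
(* The margin 1 leaves room for times [t'] beyond [t]. *)
have t1 : 0 <= t + 1 by rewrite addr_ge0.
have := @trajectory_dependence _ _ F U oU cF (s^~ x) (t + 1) (flow_trajectory Xx) _ t1.
move=> [v /andP[v0 _]|C [r [C0 r0 H]]]; first by apply/XU/flow_in.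
have e2 : 0 < e / 2 by rewrite divr_gt0.
have [|r' r'0 H'] := within_continuous_dist (flow_trajectory Xx).1 (t := t) _ e2.
  by rewrite /= in_itv/= t0.
have C1 : 0 < C + 1 by rewrite ltr_wpDl.
exists (Num.min (Num.min 1 r') (Num.min r (e / 2 / (C + 1)))).
  by rewrite !lt_min ltr01 r'0 r0 divr_gt0.
move=> x' t' Xx' t'0; rewrite !lt_min => /andP[/andP[tt1 ttr'] _] /andP[_ /andP[xr xe]].
rewrite -[X in `|X|](subrKA (s t' x)); apply: le_lt_trans (ler_normD _ _) _.
rewrite (splitr e); apply: ltr_leD.
  by apply: H' => //; rewrite /= in_itv/= t'0.
have := H _ (flow_trajectory Xx'); rewrite !flow0// => /(_ xr t').
rewrite t'0/= => /(_ _)/le_trans; apply.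
  by move: tt1; rewrite ltr_norml => /andP[? ?]; lra.
move: xe; rewrite ltr_pdivlMr// => /ltW; apply: le_trans; rewrite mulrC.
by apply: ler_wpM2l => //; rewrite lerDl.
Qed.

Definition timed : set (measurableTypeR R * 'rV[R]_n) := [set z | 0 <= z.1 /\ X z.2].

Lemma measurable_timed : measurable timed.
Proof.
have -> : timed = ([set` `[0, +oo[] : set (measurableTypeR R)) `*` X.
  by apply/seteqP; split => z; rewrite /timed/= in_itv/= andbT.
by apply: measurableX => //; exact: measurable_itv.
Qed.

Lemma measurable_flow : measurable_fun timed (fun z => s z.1 z.2).
Proof.
apply: (@measurability _ _ _ _ timed _ (@open 'rV[R]_n)) => //.
move=> _ [V oV <-]; apply: (relatively_open_measurable measurable_timed).
  exact: subIsetl.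
move=> [t x] [[/= t0 Xx] Vs]; have [e e0 eV] := open_ball_sub oV Vs.
have [r r0 H] := flow_continuous Xx t0 e0.
exists r => // -[t' x'] [/= t'0 Xx'] tt' xx'; split => //=.
by apply: eV; rewrite -ball_normE/=; exact: H.
Qed.

Definition alive (K : set 'rV[R]_n) : set (measurableTypeR R * 'rV[R]_n) :=
  [set z | timed z /\ forall u, 0 <= u <= z.1 -> K (s u z.2)].

(** Having left a closed set by time [t] is a relatively open condition: at some time [u <= t] the
    trajectory is at positive distance from [K], and so are nearby trajectories at nearby times. *)
Lemma measurable_alive K : closed K -> measurable (alive K).
Proof.
move=> cK; have -> : alive K = timed `\` (timed `\` alive K).
  apply/seteqP; split => z; first by case=> tz Kz; split => //; case=> _; apply.
  by case=> tz nz; apply: contrapT => H; apply: nz.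
apply: measurableD; first exact: measurable_timed.
apply: (relatively_open_measurable measurable_timed); first exact: subDsetl.
move=> [t x] [[/= t0 Xx] H].
have [u [/andP[u0 ut] nK]] : exists u, 0 <= u <= t /\ ~ K (s u x).
  apply: contrapT => nH; apply: H; split => // u ut.
  by apply: contrapT => nK; apply: nH; exists u.
have [e e0 eK] := open_ball_sub (closed_openC cK) nK.
have [r r0 Hr] := flow_continuous Xx u0 e0.
(* The perturbed time [t'] may precede the exit time [u]; [Num.min u t'] is admissible and still
   close to [u]. *)
exists r => // -[t' x'] [/= t'0 Xx'] tt' xx'; split => // -[_ /= /(_ (Num.min u t'))].
rewrite ge_min lexx orbT le_min u0 t'0 => /(_ isT).
apply: eK; rewrite -ball_normE/=; apply: Hr => //.
  by rewrite le_min u0.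
have [ut'|t'u] := leP u t'; first by rewrite subrr normr0.
apply: le_lt_trans tt'.
rewrite ger0_norm ?subr_ge0 ?(ltW t'u)//; apply: le_trans (ler_norm _).
by rewrite lerD2r.
Qed.

Lemma aliveD K t u x : X x -> 0 <= t -> 0 <= u ->
  alive K (t + u, x) <-> alive K (t, x) /\ alive K (u, s t x).
Proof.
move=> Xx t0 u0; split.
  move=> [_ /= H]; split; split => //=.
  - by move=> v /andP[v0 vt]; apply: H; rewrite v0/= ler_wpDr.
  - by split => //; exact: flow_in.
  - by move=> v /andP[v0 vu]; rewrite -flowD//; apply: H; rewrite addr_ge0//= addrC lerD2l.
move=> [[_ /= H1] [_ /= H2]]; split => /=; first by split => //=; rewrite addr_ge0.
move=> v /andP[v0 vtu]; have [vt|/ltW tv] := leP v t; first by apply: H1; rewrite v0.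
rewrite -(subrK t v) flowD ?subr_ge0//; apply: H2.
by rewrite subr_ge0 tv/= lerBlDl.
Qed.

End flow.

(** * Volume transported by the flow *)

Section flow_volume.
Context (R : realType) (n : nat).
Variables (X U : set 'rV[R]_n) (F : 'rV[R]_n -> 'rV[R]_n) (s : R -> 'rV[R]_n -> 'rV[R]_n).
Hypotheses (mX : measurable X) (oU : open U) (XU : X `<=` U) (cF : C1_open U F).
Hypothesis F_flow : solution_map X F s.
Local Notation lam := (lebesgue_rV R n).
Local Notation T0 := ([set` `[0%R, +oo[] : set (measurableTypeR R)).
Local Notation "'div'" := (fun x => \tr (jacobian F x)).

Lemma xsectionP d (T : measurableType d) (A : set (measurableTypeR R * T)) t x :
  xsection A t x <-> A (t, x).
Proof. by rewrite /xsection /=; split => [/set_mem|/mem_set]. Qed.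

(** A push-forward measure needs a map measurable on the whole space, while [s] is constrained only
    on [X]. *)
Definition flow_ext t x := if x \in X then s t x else 0.

Lemma flow_extE t x : X x -> flow_ext t x = s t x.
Proof. by move=> Xx; rewrite /flow_ext mem_set. Qed.

Lemma measurable_flow_ext :
  measurable_fun (T0 `*` setT) (fun z : measurableTypeR R * 'rV[R]_n => flow_ext z.1 z.2).
Proof.
move=> mD B mB.
have -> : T0 `*` setT `&`
    (fun z : measurableTypeR R * 'rV[R]_n => flow_ext z.1 z.2) @^-1` B =
  (timed X `&` (fun z => s z.1 z.2) @^-1` B) `|`
  (T0 `*` (~` X `&` [set _ | B 0])).
  apply/seteqP; split => -[t x]; rewrite /timed /= in_itv/= andbT /flow_ext.
    move=> [[t0 _]]; case: ifPn => xX H.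
      by left; split => //; split => //; exact: set_mem.
    by right; split => //; split => //; move: xX; rewrite notin_setE.
  case=> [[[t0 Xx] H]|[t0 [nX H]]]; split => //; first by rewrite mem_set.
  by rewrite memNset.
apply: measurableU.
  by apply: (measurable_flow mX oU XU cF F_flow); first exact: measurable_timed.
apply: measurableX; first exact: measurable_itv.
apply: measurableI; first exact: measurableC.
have [B0|nB0] := pselect (B 0).
  by rewrite (_ : [set _ | _] = setT)//; apply/seteqP; split.
by rewrite (_ : [set _ | _] = set0)//; apply/seteqP; split.
Qed.

Lemma measurable_flow_extr t : 0 <= t -> measurable_fun setT (flow_ext t).
Proof.
move=> t0 _ B mB.
have mD : measurable (T0 `*` setT : set (measurableTypeR R * 'rV[R]_n)).
  by apply: measurableX => //; exact: measurable_itv.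
have := measurable_xsection t (measurable_flow_ext mD mB).
congr measurable; apply/seteqP; split => x.
  by move=> /xsectionP[].
by move=> [_ H]; apply/xsectionP; split => //; split => //=; rewrite in_itv/= t0.
Qed.

Definition alive_at K t : set 'rV[R]_n := xsection (alive X s K) t.

Lemma alive_atP K t x : alive_at K t x <->
  [/\ 0 <= t, X x & forall u, 0 <= u <= t -> K (s u x)].
Proof.
by split => [/xsectionP[[? ?] ?]|[? ? ?]]; [|apply/xsectionP]; split.
Qed.

Lemma measurable_alive_at K t : closed K -> measurable (alive_at K t).
Proof.
move=> cK; apply: measurable_xsection.
exact: (measurable_alive mX oU XU cF F_flow).
Qed.

Definition arrival K (h : R) (A : set 'rV[R]_n) := alive_at K h `&` flow_ext h @^-1` A.

Lemma arrivalP K h A x : arrival K h A x -> alive_at K h x /\ A (s h x).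
Proof. by move=> [Kx]; have [_ Xx _] := (alive_atP _ _ _).1 Kx; rewrite /= flow_extE. Qed.

Lemma measurable_arrival K h A : closed K -> 0 <= h -> measurable A ->
  measurable (arrival K h A).
Proof.
move=> cK h0 mA; apply: measurableI; first exact: measurable_alive_at.
by rewrite -[X in measurable X]setTI; exact: measurable_flow_extr.
Qed.

Lemma compact_norm_bound (V : normedModType R) (G : 'rV[R]_n -> V) K : compact K ->
  (forall x, K x -> {for x, continuous G}) ->
  exists2 M, 0 < M & forall x, K x -> `|G x| <= M.
Proof.
move=> cK cG.
have [r r0 H] : exists2 r : R, 0 < r & forall z, K z -> `|G z| <= r^-1.
  apply: (compact_uniform cK) => [r r' z /andP[r'0 r'r] H|c Kc].
    by apply: le_trans H _; rewrite lef_pV2 ?posrE// (lt_le_trans r'0).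
  have [r r0 H] := (continuous_distP _ _).1 (cG c Kc) _ ltr01.
  have C0 : 0 < `|G c| + 1 by rewrite ltr_wpDl.
  exists (Num.min r (`|G c| + 1)^-1); first by rewrite lt_min r0 invr_gt0.
  move=> z; rewrite -ball_normE/= lt_min => /andP[/H cz _].
  apply: (@le_trans _ _ (`|G c| + 1)).
    rewrite -[X in `|X| <= _](subrK (G c)) addrC; apply: le_trans (ler_normD _ _) _.
    by rewrite lerD2l distrC ltW.
  rewrite -[leLHS]invrK lef_pV2 ?posrE ?invr_gt0//; last by rewrite lt_min r0 invr_gt0.
  by rewrite ge_min lexx orbT.
by exists r^-1; rewrite ?invr_gt0.
Qed.

(** The time [h] is fixed before the side [l] of the cubes: the error of [gap_linear] is
    proportional to [h * l], so [volume_near_identity] holds for all cubes in the ball, however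
    small, and [dyadic_comparison] extends it to measurable sets. *)
Lemma local_volume K c (e : R) : compact K -> K `<=` U -> K c -> 0 < e ->
  exists r, [/\ 0 < r, forall h, 0 < h <= r -> 0 <= 1 - h * div c + e * h &
    forall h, 0 < h <= r -> forall A, measurable A -> A `<=` ball c r ->
      (lam (arrival K h A) <= (1 - h * div c + e * h)%:E * lam A)%E].
Proof.
move=> cK KU Kc e0; set J := jacobian F c.
have clK : closed K by apply: compact_closed => //; exact: norm_hausdorff.
have [e1 [h1 [e10 h10 Hvol]]] := volume_near_identity J e0.
have e14 : 0 < e1 / 4 by rewrite divr_gt0.
have [r0 [r00 r0U HJ]] := C1_local_linear oU cF (KU _ Kc) e14.
have [M M0 HM] : exists2 M, 0 < M & forall x, K x -> `|F x| <= M.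
  apply: compact_norm_bound => // x Kx; apply: differentiable_continuous.
  exact/cF.1/KU.
have SJ0 := mx_sum_norm_ge0 J; pose L := mx_sum_norm J + e1 / 4.
have L0 : 0 < L by rewrite ltr_wpDl.
have LS1 : 0 < L * mx_sum_norm J + 1 by rewrite ltr_wpDl// mulr_ge0// ltW.
have T1 : 0 < `|\tr J| + 1 by rewrite ltr_wpDl.
(* In order: endpoints within [r0 / 2] of [c]; displacement at most [r0 / 2], so that whole
   trajectories stay in [ball c r0]; the range of [volume_near_identity]; the range of [gap_linear];
   the second-order term at most [e1 / 4]; a nonnegative factor [1 - h tr J]. *)
pose r := Num.min (Num.min (Num.min (r0 / 2) (r0 / 2 / M)) (Num.min h1 (2 * L)^-1))
  (Num.min (e1 / 4 / (L * mx_sum_norm J + 1)) (`|\tr J| + 1)^-1).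
have r_gt0 : 0 < r.
  by rewrite !lt_min h10 !divr_gt0// !invr_gt0 mulr_gt0.
have hbounds h : 0 < h <= r -> [/\ h * M <= r0 / 2, h <= h1, h * L <= 2^-1,
    h * L * mx_sum_norm J <= e1 / 4 & h * `|\tr J| <= 1].
  move=> /andP[h0]; rewrite !le_min => /andP[/andP[/andP[_ hM] /andP[hh1 hL]] /andP[hLS hT]].
  split => //.
  - by rewrite -ler_pdivlMr.
  - by rewrite -ler_pdivlMr// -invfM.
  - rewrite ler_pdivlMr// in hLS; apply: le_trans hLS.
    by rewrite -mulrA ler_wpM2l ?(ltW h0)// lerDl.
  - rewrite -div1r ler_pdivlMr// in hT; apply: le_trans hT.
    by rewrite ler_wpM2l ?(ltW h0)// lerDl.
have coef h : 0 < h <= r -> 0 <= 1 - h * \tr J + e * h.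
  move=> hr; have [_ _ _ _ hT] := hbounds h hr; case/andP: hr => h0 _.
  have : h * \tr J <= h * `|\tr J| by rewrite ler_wpM2l ?ler_norm// ltW.
  have : 0 <= e * h by rewrite mulr_ge0// ltW.
  lra.
exists r; split => // h hr A mA Ac.
have [hM hh1 hL hLS _] := hbounds h hr; have /andP[h0 _] := hr; have h0' := ltW h0.
have mS := measurable_alive_at h clK.
pose m0 : {measure set 'rV[R]_n -> \bar R} := mrestr lam mS.
pose m1 : {measure set 'rV[R]_n -> \bar R} :=
  measure_function_pushforward__canonical__measure_function_Measure m0
    (measurable_flow_extr h0').
have m1E B : m1 B = lam (arrival K h B) by rewrite /m1/= /pushforward/= /mrestr setIC.
rewrite -m1E; apply: (@dyadic_comparison _ _ m1 lam (ball c r)) => //.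
- exact: coef.
- exact: ball_open.
- apply: (@le_lt_trans _ _ (lam (half_open_box (c - const_mx r) (2 * r)))).
    have mc : measurable (ball c r : set 'rV[R]_n).
      by apply: open_measurable_rV; exact: ball_open.
    have mb := measurable_half_open_box (c - const_mx r) (2 * r).
    apply: le_measure; [exact: mem_set|exact: mem_set|].
    move=> x; rewrite -ball_normE/= => cx j; rewrite !mxE.
    have := le_lt_trans (ler_norm_coord _ j) cx; rewrite subr_coord ltr_norml.
    by move=> /andP[? ?]; apply/andP; split; lra.
  have : (lam (half_open_box (c - const_mx r) (2 * r)) < +oo)%E.
    by rewrite lebesgue_rV_half_open_box ?ltry// mulr_ge0// ltW.
  exact.
move=> q l l0 qc; rewrite m1E.
suff : (lam (arrival K h (half_open_box q l)) <=
    (1 - h * div c + e * h)%:E * lam (half_open_box q l))%E by exact.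
rewrite lebesgue_rV_half_open_box ?(ltW l0)// -EFinM.
apply: (Hvol h _ _ (s h) (fun j => q 0 j)) => //.
- by rewrite h0.
- by apply: measurable_arrival => //; exact: measurable_half_open_box.
- by move=> x /arrivalP[_ H] j; have /andP[-> /ltW] := H j.
move=> x x' /arrivalP[/alive_atP[_ Xx Kx] qx] /arrivalP[/alive_atP[_ Xx' Kx'] qx'].
have inball y : X y -> (forall u, 0 <= u <= h -> K (s u y)) -> ball c r (s h y) ->
    forall t, 0 <= t <= h -> ball c r0 (s t y).
  move=> Xy Ky cy t /andP[t0 th]; rewrite -ball_normE/=.
  rewrite -[X in `|X|](subrKA (s h y)); apply: le_lt_trans (ler_normD _ _) _.
  have -> : r0 = r0 / 2 + r0 / 2 by rewrite -splitr.
  apply: ltr_leD.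
    rewrite -ball_normE/= in cy; apply: lt_le_trans cy _.
    by rewrite !ge_min lexx.
  apply: le_trans hM; apply: (@le_trans _ _ (M * (h - t))).
    apply: (@curve_mean_value _ _ (s^~ y) (fun u => F (s u y))) => //.
    - exact: ltW.
    - exact: (trajectory_within (flow_trajectory F_flow Xy)).
    - move=> u /andP[tu _]; apply: (flow_trajectory F_flow Xy).2.
      exact: le_lt_trans tu.
    move=> u /andP[tu uh]; apply: HM; apply: Ky.
    by rewrite (le_trans t0 (ltW tu)) ltW.
  by rewrite mulrC ler_wpM2r ?(ltW M0)// lerBlDr lerDl.
have gB t : 0 <= t <= h -> ball c r0 (s t x) /\ ball c r0 (s t x').
  by move=> th; split; apply: inball => //; exact: qc.
have := @gap_linear _ _ F (s^~ x) (s^~ x') (flow_trajectory F_flow Xx)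
  (flow_trajectory F_flow Xx') h L (e1 / 4) J (ball c r0) h0' (ltW e14) erefl hL HJ gB.
rewrite !(flow0 F_flow)// => -[H1 H2].
have dl : `|s h x - s h x'| <= l.
  apply: rV_norm_le => [|j]; first exact: ltW.
  rewrite subr_coord ler_norml; have := qx j; have := qx' j.
  by move=> /andP[? ?] /andP[? ?]; apply/andP; split; lra.
split; first by apply: le_trans H1 _; rewrite ler_wpM2l.
apply: le_trans H2 _; apply: ler_pM => //.
  by rewrite !mulr_ge0// addr_ge0 ?(ltW e14)// !mulr_ge0// ltW.
by rewrite ler_wpM2r//; lra.
Qed.

End flow_volume.

Section divergence_C1.
Context (R : realType) (n : nat).
Variables (U : set 'rV[R]_n) (F : 'rV[R]_n -> 'rV[R]_n).
Hypotheses (oU : open U) (cF : C1_open U F).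

Lemma tr_jacobian x : U x -> \tr (jacobian F x) = divergence F x.
Proof.
move=> Ux; rewrite /mxtrace /divergence; apply: eq_bigr => j _.
have dFx : differentiable F x by exact: cF.1.
have := derive_mx (@diff_derivable _ _ _ F x (delta_mx 0 j) dFx).
move=> /matrixP/(_ 0 j); rewrite mxE => <-.
by rewrite deriveEjacobian// -rowE [RHS]mxE.
Qed.

Lemma continuous_sum_coord (G : 'I_n -> 'rV[R]_n -> R) x :
  (forall j, {for x, continuous (G j)}) -> {for x, continuous (fun y => \sum_j G j y)}.
Proof.
move=> cG; apply/continuous_distP => e e0; pose e1 := e / (n%:R + 1).
have e10 : 0 < e1 by rewrite divr_gt0.
have /choice[r1 Hr1] : forall j, exists r : R, 0 < r /\
    forall y, `|x - y| < r -> `|G j x - G j y| < e1.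
  by move=> j; have [r ? ?] := (continuous_distP _ _).1 (cG j) _ e10; exists r.
exists (\big[Num.min/1]_j r1 j).
  by apply/bigmin_gtP; split => // j _; have [] := Hr1 j.
move=> y xy; rewrite -sumrB; apply: le_lt_trans (ler_norm_sum _ _ _) _.
apply: (@le_lt_trans _ _ (\sum_(j < n) e1)).
  apply: ler_sum => j _; apply/ltW/(Hr1 j).2; apply: lt_le_trans xy _.
  exact: bigmin_le.
rewrite sumr_const card_ord -mulr_natr /e1 mulrAC ltr_pdivrMr//.
by rewrite ltr_pM2l// ltrDl.
Qed.

Lemma divergence_continuous x : U x -> {for x, continuous (divergence F)}.
Proof.
move=> Ux; apply: continuous_sum_coord => j.
by apply: (C1_open_coord j oU cF).2.
Qed.

End divergence_C1.

Lemma continuous_on_measurable (R : realType) n (K : set 'rV[R]_n) (f : 'rV[R]_n -> R) :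
  measurable K -> (forall x, K x -> {for x, continuous f}) ->
  measurable_fun K (f : 'rV[R]_n -> measurableTypeR R).
Proof.
move=> mK cf; apply: (measurability _ (RGenOpens.measurableE R)) => //.
move=> _ [_ [a [b ->] <-]].
pose V := \bigcup_(w in [set w : 'rV[R]_n * R | ball w.1 w.2 `&` K `<=` f @^-1` `]a, b[])
  ball w.1 w.2.
have oV : open V by apply: bigcup_open => w _; exact: ball_open.
rewrite [X in measurable X](_ : _ = K `&` V).
  by apply: measurableI => //; exact: open_measurable_rV.
apply/seteqP; split => [x [Kx fx]|x [Kx [w H xw]]]; last by split => //; exact: H.
split => //; have : nbhs (f x) `]a, b[%classic by apply: open_nbhs_nbhs; split => //; exact: interval_open.
move=> /nbhs_ballP[e /= e0 He]; have [r r0 Hr] := (continuous_distP _ _).1 (cf x Kx) _ e0.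
exists (x, r); last exact: ballxx.
move=> y [+ Ky]; rewrite -ball_normE/= => /Hr xy.
by apply: He; rewrite -ball_normE.
Qed.

Section transport.
Context (R : realType) (n : nat).
Variables (X U : set 'rV[R]_n) (F : 'rV[R]_n -> 'rV[R]_n) (s : R -> 'rV[R]_n -> 'rV[R]_n).
Hypotheses (mX : measurable X) (oU : open U) (XU : X `<=` U) (cF : C1_open U F).
Hypothesis F_flow : solution_map X F s.
Local Notation lam := (lebesgue_rV R n).
Local Notation arrival := (arrival X s).
Local Notation alive_at := (alive_at X s).

(** The local estimates are glued along a finite cover of [K]. Freezing the divergence at a centre
    is undone by its continuity, which gives a bound on sets by a density; [integral_le_density]
    then turns it into a bound for functions. *)
Lemma transport K (e : R) : compact K -> K `<=` U -> 0 < e ->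
  exists2 h0, 0 < h0 & forall h, 0 < h <= h0 ->
    (forall y, K y -> 0 <= 1 - h * divergence F y + e * h) /\
    forall f : 'rV[R]_n -> \bar R, measurable_fun setT f -> (forall x, 0 <= f x)%E ->
    (\int[lam]_(x in alive_at K h) f (s h x) <=
     \int[lam]_(y in K) (f y * (1 - h * divergence F y + e * h)%:E))%E.
Proof.
move=> cK KU e0.
have clK : closed K by apply: compact_closed => //; exact: norm_hausdorff.
have mK : measurable K by exact: borel_measurable_closed.
have e2 : 0 < e / 2 by rewrite divr_gt0.
have [B B0 HB] := compact_norm_bound cK (fun x Kx => divergence_continuous oU cF (KU x Kx)).
have mdiv : measurable_fun K (divergence F : _ -> measurableTypeR R).
  by apply: continuous_on_measurable => // x /KU Ux; exact: (divergence_continuous oU cF Ux).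
have mcoef h A : measurable A -> A `<=` K ->
    measurable_fun A (fun y => 1 - h * divergence F y + e * h : measurableTypeR R).
  move=> mA AK; apply: measurable_funD; last exact: measurable_cst.
  apply: measurable_funB; first exact: measurable_cst.
  apply: measurable_funM; first exact: measurable_cst.
  exact: measurable_funS mdiv.
(* Half of [e] pays for the volume estimate at the centre, half for replacing the divergence at the
   centre by its value at the arrival point. *)
have [r r0 Hr] : exists2 r : R, 0 < r & forall c, K c -> forall h, 0 < h <= r ->
    (forall y, K y -> 0 <= 1 - h * divergence F y + e * h) ->
    forall A, measurable A -> A `<=` ball c r `&` K ->
    (lam (arrival K h A) <= \int[lam]_(y in A) (1 - h * divergence F y + e * h)%:E)%E.
  apply: (compact_uniform cK) => [r r' z /andP[r'0 r'r] H h /andP[h0 hr'] pos A mA Az|c Kc].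
    apply: H => //; first by rewrite h0 (le_trans hr').
    by move=> x /Az[zx Kx]; split => //; exact: le_ball zx.
  have [r1 [r10 pos1 H1]] := local_volume mX oU XU cF F_flow cK KU Kc e2.
  have [r2 r20 H2] := (continuous_distP _ _).1 (divergence_continuous oU cF (KU _ Kc)) _ e2.
  pose r := Num.min r1 r2; have r_gt0 : 0 < r by rewrite lt_min r10.
  exists (r / 2); first by rewrite divr_gt0.
  move=> z; rewrite -ball_normE/= => cz h /andP[h0 hr] pos A mA Az.
  have Ac : A `<=` ball c r `&` K.
    move=> x /Az[]; rewrite -!ball_normE/= => zx Kx; split => //.
    rewrite -[X in `|X|](subrKA z); apply: le_lt_trans (ler_normD _ _) _; lra.
  have hr1 : 0 < h <= r1.
    have : r <= r1 by rewrite ge_min lexx.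
    by rewrite h0/= => H; apply: le_trans H; lra.
  apply: le_trans (H1 h hr1 A mA _) _.
    by move=> x /Ac[cx _]; apply: le_ball cx; rewrite ge_min lexx.
  have pc := pos1 h hr1.
  rewrite (tr_jacobian cF (KU _ Kc)) in pc *.
  rewrite -integral_cst//; apply: ge0_le_integral => //.
  - by apply/measurable_EFinP; apply: mcoef => // x /Az[].
  move=> x /Ac[cx Kx]; rewrite lee_fin.
  have : `|divergence F c - divergence F x| < e / 2.
    by apply: H2; rewrite -ball_normE/= in cx; apply: lt_le_trans cx _; rewrite ge_min lexx orbT.
  rewrite ltr_norml => /andP[dcx _].
  have : h * (divergence F x - divergence F c) <= h * (e / 2).
    apply: ler_wpM2l; lra.
  lra.
pose h0 := Num.min r (B + 1)^-1.
have B1 : 0 < B + 1 by rewrite ltr_wpDl// ltW.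
exists h0; first by rewrite lt_min r0 invr_gt0.
move=> h /andP[h_gt0]; rewrite le_min => /andP[hr hB].
have pos y : K y -> 0 <= 1 - h * divergence F y + e * h.
  move=> Ky; have : h * divergence F y <= h * (B + 1).
    rewrite ler_wpM2l ?(ltW h_gt0)// (le_trans (ler_norm _))// (le_trans (HB _ Ky))//.
    by rewrite lerDl.
  rewrite -div1r ler_pdivlMr// in hB.
  have : 0 <= e * h by rewrite mulr_ge0// ltW.
  lra.
split => // f mf f0.
pose w := (fun y => (1 - h * divergence F y + e * h)%:E) \_ K.
have mw : measurable_fun setT w.
  by apply/(measurable_restrictT _ mK); apply/measurable_EFinP; exact: mcoef.
have w0 y : (0 <= w y)%E.
  by rewrite /w patchE; case: ifPn => //; rewrite inE => Ky; rewrite lee_fin pos.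
have h0' := ltW h_gt0.
have mS := measurable_alive_at mX oU XU cF F_flow h clK.
pose m0 : {measure set 'rV[R]_n -> \bar R} := mrestr lam mS.
pose m1 : {measure set 'rV[R]_n -> \bar R} :=
  measure_function_pushforward__canonical__measure_function_Measure m0
    (measurable_flow_extr mX oU XU cF F_flow h0').
have m1E A : m1 A = lam (arrival K h A) by rewrite /m1/= /pushforward/= /mrestr setIC.
have m1w A : measurable A -> (m1 A <= \int[lam]_(x in A) w x)%E.
  move=> mA.
  have -> : m1 A = m1 (A `&` K).
    rewrite !m1E; congr (lam _); apply/seteqP; split => x [Kx Ax]; split => //.
      split => //; have [_ Xx H] := (alive_atP _ _ _ _ _).1 Kx.
      by rewrite flow_extE//; apply: H; rewrite h0' lexx.
    by case: Ax.
  have -> : (\int[lam]_(x in A) w x = \int[lam]_(y in A `&` K) (1 - h * divergence F y + e * h)%:E)%E.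
    by rewrite integral_mkcondr.
  have := cK; rewrite compact_cover => /(_ _ K (fun c => ball c r)).
  move=> [c _|x Kx|D DK KD]; [exact: ball_open|by exists x => //; exact: ballxx|].
  have {KD} : A `&` K `<=` \bigcup_(c in [set` (finmap.enum_fset D)]) ball c r.
    by move=> x [_ /KD].
  have {DK} : forall c, c \in (finmap.enum_fset D) -> K c by move=> c cD; apply: set_mem; exact: DK.
  have : measurable (A `&` K) by exact: measurableI.
  have : A `&` K `<=` K by move=> x [].
  (* The set is generalized and split into disjoint pieces: the part in the first ball obeys [Hr],
     the rest is covered by the remaining balls. *)
  elim: (finmap.enum_fset D) (A `&` K) => [|c D' IHD] C CK mC DK CD.
    have -> : C = set0 by apply/seteqP; split => // x /CD[].
    by rewrite measure0 integral_set0.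
  have mb : measurable (ball c r : set 'rV[R]_n).
    by apply: open_measurable_rV; exact: ball_open.
  have CE : C = (C `\` ball c r) `|` (C `&` ball c r) by rewrite setUC setUIDK.
  have mC1 := measurableD mC mb; have mC2 := measurableI _ _ mC mb.
  have HB2 : (m1 (C `&` ball c r) <=
      \int[lam]_(y in C `&` ball c r) (1 - h * divergence F y + e * h)%:E)%E.
    rewrite m1E; apply: (Hr c) => //.
    - by apply: DK; rewrite inE eqxx.
    - by rewrite h_gt0.
    - by move=> x [/CK].
  rewrite (measureDI m1 mC mb) [in leRHS]CE ge0_integral_setU//; last 3 first.
  - by rewrite -CE; apply/measurable_EFinP; exact: mcoef.
  - by rewrite -CE => x /CK Kx; rewrite lee_fin pos.
  - by apply/disj_setPS => x [[_ nb] [_ b]].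
  apply: leeD.
    apply: IHD => //.
    - by move=> x [/CK].
    - by move=> c' c'D; apply: DK; rewrite inE c'D orbT.
    move=> x [/CD[c' /=]]; rewrite inE => /predU1P[->//|c'D] xc' _; by exists c'.
  exact: HB2.
have := integral_le_density mw w0 m1w mf f0.
rewrite (ge0_integral_pushforward (measurable_flow_extr mX oU XU cF F_flow h0'))//=.
rewrite preimage_setT => H.
have -> : (\int[lam]_(y in K) (f y * (1 - h * divergence F y + e * h)%:E) =
           \int[lam]_x (f x * w x))%E.
  rewrite integral_mkcond; apply: eq_integral => y _; rewrite /w !patchE.
  by case: ifP => // _; rewrite mule0.
apply: le_trans H.
have -> : (\int[lam]_(x in alive_at K h) f (s h x) =
           \int[mrestr lam mS]_(x in alive_at K h) f (flow_ext X s h x))%E.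
  transitivity (\int[lam]_(x in alive_at K h) f (flow_ext X s h x))%E.
    apply: eq_integral => x; rewrite inE => /alive_atP[_ Xx _].
    by rewrite flow_extE.
  apply: eq_measure_integral => A mA AK.
  by rewrite /mrestr/=; apply: (congr1 (lebesgue_rV R n)); rewrite (setIidl AK).
apply: ge0_subset_integral => //.
apply: measurableT_comp => //; exact: (measurable_flow_extr mX oU XU cF F_flow h0').
Qed.

End transport.

(** * Killed semigroup and one-step inequality *)

Section killed_semigroup.
Context (R : realType) (n : nat).
Variables (X U : set 'rV[R]_n) (F : 'rV[R]_n -> 'rV[R]_n) (s : R -> 'rV[R]_n -> 'rV[R]_n).
Hypotheses (mX : measurable X) (oU : open U) (XU : X `<=` U) (cF : C1_open U F).
Hypothesis F_flow : solution_map X F s.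
Local Notation lam := (lebesgue_rV R n).

Definition kill K (f : 'rV[R]_n -> \bar R) (z : measurableTypeR R * 'rV[R]_n) : \bar R :=
  ((fun z => f (s z.1 z.2)) \_ (alive X s K)) z.

Lemma killE K f t x : alive X s K (t, x) -> kill K f (t, x) = f (s t x).
Proof. by move=> az; rewrite /kill patchE mem_set. Qed.

Lemma killN K f t x : ~ alive X s K (t, x) -> kill K f (t, x) = 0%E.
Proof. by move=> az; rewrite /kill patchE memNset. Qed.

Lemma measurable_kill K f : closed K -> measurable_fun setT f ->
  measurable_fun setT (kill K f).
Proof.
move=> cK mf; have mA := measurable_alive mX oU XU cF F_flow cK.
apply/(measurable_restrictT _ mA).
apply: (@measurable_comp _ _ _ _ _ _ setT) => //.
apply: (measurable_funS _ _ (measurable_flow mX oU XU cF F_flow)).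
- exact: measurable_timed.
- by move=> z [].
Qed.

Lemma measurable_kill_at K f t : closed K -> measurable_fun setT f ->
  measurable_fun setT (fun x => kill K f (t, x)).
Proof.
move=> cK mf; apply: measurableT_comp; first exact: measurable_kill.
exact: pair1_measurable.
Qed.

Lemma kill_ge0 K f z : (forall x, 0 <= f x)%E -> (0 <= kill K f z)%E.
Proof. by move=> f0; rewrite /kill patchE; case: ifP. Qed.

Lemma killD K f t u x : 0 <= t -> 0 <= u ->
  kill K (fun y => kill K f (u, y)) (t, x) = kill K f (t + u, x).
Proof.
move=> t0 u0; have [az|naz] := pselect (alive X s K (t, x)); last first.
  rewrite killN// killN// => az; apply: naz.
  have Xx : X x by case: az => -[].
  by have [] := (aliveD oU XU cF F_flow K Xx t0 u0).1 az.
have Xx : X x by case: az => -[].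
rewrite killE//; have [az'|naz'] := pselect (alive X s K (u, s t x)).
  rewrite !killE//; last by apply/(aliveD oU XU cF F_flow K Xx t0 u0).
  by rewrite addrC (flowD oU XU cF F_flow Xx t0 u0).
rewrite !killN// => /(aliveD oU XU cF F_flow K Xx t0 u0)[_ ?]; exact: naz'.
Qed.

Lemma kill_notin K f t x : ~ K x -> kill K f (t, x) = 0%E.
Proof.
move=> nK; apply: killN => -[[/= t0 Xx] /= /(_ 0)]; rewrite lexx t0 => /(_ isT).
by rewrite (flow0 F_flow).
Qed.

Lemma integral_kill K f t : closed K ->
  (\int[lam]_x kill K f (t, x) = \int[lam]_(x in alive_at X s K t) f (s t x))%E.
Proof.
move=> cK; rewrite [RHS]integral_mkcond; apply: eq_integral => x _.
rewrite patchE; case: ifPn => [/set_mem/xsectionP az|/negP az].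
  by rewrite killE.
by rewrite killN// => az'; apply: az; apply/mem_set/xsectionP.
Qed.

Variable N : set 'rV[R]_n.
Hypothesis N_inv : forall x, X x -> N x -> forall t, 0 <= t -> N (s t x).

Definition supported_outside (f : 'rV[R]_n -> \bar R) := forall x, ~ (X `\` N) x -> f x = 0%E.

(** Forward invariance of [N] read backwards. Through it [kill f] inherits the support of [f], so
    that the hypotheses on [rho] and [h0], which concern X1 only, suffice at every step. *)
Lemma backward_outside t x : X x -> 0 <= t -> (X `\` N) (s t x) -> (X `\` N) x.
Proof. by move=> Xx t0 [Xs nNs]; split => // Nx; apply: nNs; exact: N_inv. Qed.

Lemma kill_supported K f t : supported_outside f -> supported_outside (fun x => kill K f (t, x)).
Proof.
move=> sf x nx; have [[[/= t0 Xx] H]|naz] := pselect (alive X s K (t, x)); last exact: killN.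
rewrite killE// sf// => H'; apply: nx; exact: backward_outside H'.
Qed.

End killed_semigroup.

Section one_step.
Context (R : realType) (n : nat).
Variables (X U V N : set 'rV[R]_n) (F : 'rV[R]_n -> 'rV[R]_n) (s : R -> 'rV[R]_n -> 'rV[R]_n).
Hypotheses (mX : measurable X) (oU : open U) (XU : X `<=` U) (cF : C1_open U F).
Hypothesis F_flow : solution_map X F s.
Hypothesis mN : measurable N.
Hypothesis N_inv : forall x, X x -> N x -> forall t, 0 <= t -> N (s t x).
Variables (rho h0 : 'rV[R]_n -> R).
Hypothesis crho : C1_open V rho.
Local Notation X1 := (X `\` N).
Hypothesis rho_ge0 : forall x, X1 x -> 0 <= rho x.
Hypothesis mrho : measurable_fun X1 rho.
Hypothesis h0_ge0 : forall x, X1 x -> 0 <= h0 x.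
Hypothesis mh0 : measurable_fun X1 h0.
Local Notation lam := (lebesgue_rV R n).
Hypothesis continuity_eq :
  {ae lam, forall x, X1 x -> divergence (fun y => rho y *: F y) x = h0 x}.

(** The derivative of [rho] along [F] has a direction that varies with the point; in terms of the
    fixed coordinate directions its continuity follows from that of the partial derivatives. *)
Definition drift_derive x := \sum_j F x 0 j * 'D_(delta_mx 0 j) rho x.

Lemma drift_deriveE x : V x -> 'D_(F x) rho x = drift_derive x.
Proof. by move=> Vx; rewrite derive_sum_coord//; exact: crho.1. Qed.

Lemma drift_derive_continuous x : U x -> V x -> {for x, continuous drift_derive}.
Proof.
move=> Ux Vx; apply: continuous_sum_coord => j; apply: continuousM; last exact: crho.2.
apply: differentiable_continuous; exact: (C1_open_coord j oU cF).1.
Qed.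

Lemma divergence_scale x : U x -> V x ->
  divergence (fun y => rho y *: F y) x = rho x * divergence F x + drift_derive x.
Proof.
move=> Ux Vx; rewrite /divergence /drift_derive mulr_sumr -big_split/=.
apply: eq_bigr => j _; under eq_fun do rewrite mxE.
rewrite deriveM; last 2 first.
- by apply: diff_derivable; exact: crho.1.
- by apply: diff_derivable; exact: (C1_open_coord j oU cF).1.
by [].
Qed.

Variable K : set 'rV[R]_n.
Hypotheses (cK : compact K) (KU : K `<=` U) (KV : K `<=` V).

Local Notation kill := (kill X s K).
Local Notation rX := (rho \_ X1).
Local Notation hX := (h0 \_ X1).

Let mX1 : measurable X1. Proof. exact: measurableD. Qed.
Let clK : closed K. Proof. by apply: compact_closed => //; exact: norm_hausdorff. Qed.
Let mK : measurable K. Proof. exact: borel_measurable_closed. Qed.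

Lemma rX_ge0 x : 0 <= rX x.
Proof. by rewrite patchE; case: ifPn => // /set_mem; exact: rho_ge0. Qed.

Lemma hX_ge0 x : 0 <= hX x.
Proof. by rewrite patchE; case: ifPn => // /set_mem; exact: h0_ge0. Qed.

Lemma measurable_rX : measurable_fun setT rX.
Proof. exact/(measurable_restrictT _ mX1). Qed.

Lemma measurable_hX : measurable_fun setT hX.
Proof. exact/(measurable_restrictT _ mX1). Qed.

(** First-order expansion along a trajectory, with the derivative taken at the endpoint, since
    [transport] integrates over arrival points. The bound on [h] keeps the displacement below the
    radius [r] of uniform continuity. *)
Lemma density_along_flow (e : R) : 0 < e -> exists2 h1, 0 < h1 &
  forall h x, 0 < h <= h1 -> alive X s K (h, x) ->
    rho x <= rho (s h x) - h * drift_derive (s h x) + e * h.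
Proof.
move=> e0.
have [M M0 HM] : exists2 M, 0 < M & forall x, K x -> `|F x| <= M.
  apply: compact_norm_bound => // x Kx; apply: differentiable_continuous.
  exact/cF.1/KU.
have [r r0 Hr] : exists2 r : R, 0 < r & forall z, K z -> forall w, `|w - z| < r ->
    `|drift_derive w - drift_derive z| <= e.
  apply: (compact_uniform cK) => [r r' z /andP[r'0 r'r] H w wz|c Kc].
    by apply: H; exact: lt_le_trans wz r'r.
  have e2 : 0 < e / 2 by rewrite divr_gt0.
  have [r r0 H] := (continuous_distP _ _).1 (drift_derive_continuous (KU Kc) (KV Kc)) _ e2.
  exists (r / 2); first by rewrite divr_gt0.
  move=> z; rewrite -ball_normE/= => cz w wz.
  rewrite -[X in `|X|](subrKA (drift_derive c)); apply: le_trans (ler_normD _ _) _.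
  rewrite (splitr e); apply: lerD.
    rewrite distrC; apply/ltW/H; rewrite -[X in `|X|](subrKA z).
    by apply: le_lt_trans (ler_normD _ _) _; rewrite (distrC z); lra.
  by apply/ltW/H; lra.
exists (r / (2 * M)); first by rewrite divr_gt0// mulr_gt0.
move=> h x /andP[h_gt0 hr] [[/= _ Xx] Kx].
have traj := flow_trajectory F_flow Xx.
have h0' := ltW h_gt0.
have [||t] := @MVT R (fun t => rho (s t x)) (fun t => drift_derive (s t x)) 0 h h_gt0.
- move=> t; rewrite in_itv/= => /andP[t0 th].
  have Vt : V (s t x) by apply: KV; apply: Kx; rewrite !ltW.
  rewrite -drift_deriveE//; apply: (is_derive_curve (traj.2 t t0)).
  exact: crho.1.
- apply: within_continuous_comp => [z /set_mem[t /= th <-]|]; last first.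
    exact: (trajectory_within traj (lexx 0)).
  rewrite in_itv/= in th; apply: differentiable_continuous; apply: crho.1.
  exact/KV/Kx.
rewrite in_itv/= => /andP[t0 th]; rewrite (flow0 F_flow Xx) subr0 => E.
have Kh : K (s h x) by apply: Kx; rewrite h0' lexx.
have : `|drift_derive (s t x) - drift_derive (s h x)| <= e.
  apply: Hr => //; rewrite distrC; apply: (@le_lt_trans _ _ (M * (h - t))).
    apply: (@curve_mean_value _ _ (s^~ x) (fun u => F (s u x))) => //.
    - exact: ltW.
    - exact: ltW.
    - exact: (trajectory_within traj (ltW t0)).
    - by move=> u /andP[tu _]; apply: traj.2; exact: lt_trans tu.
    move=> u /andP[tu uh]; apply: HM; apply: Kx.
    by rewrite (le_trans (ltW t0) (ltW tu)) ltW.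
  apply: (@le_lt_trans _ _ (M * h)); first by rewrite ler_wpM2l ?(ltW M0)// gerBl ltW.
  move: hr; rewrite invfM mulrA ler_pdivlMr// => hr.
  by rewrite mulrC; apply: le_lt_trans hr _; lra.
rewrite ler_norml => /andP[H _].
have : h * (drift_derive (s h x) - e) <= h * drift_derive (s t x).
  by apply: ler_wpM2l => //; lra.
move: E; rewrite [_ * h]mulrC; lra.
Qed.

(* The real inequality behind one step: [r], [d], [g] stand for the values of
   rho, div F and F.grad rho at the endpoint of a step of length [h]. *)
Lemma one_step_ineq (B eta0 eta h r d g : R) : 0 <= r <= B -> `|d| <= B -> `|g| <= B ->
  0 < eta0 -> eta0 <= eta -> eta <= 1 -> 0 < h -> h <= eta0 ->
  (r + eta - h * g + eta0 * h) * (1 - h * d + eta0 * h) + h * (r * d + g) <=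
  r + eta * (1 + (3 + 4 * B + B ^+ 2) * h).
Proof.
move=> /andP[r0 rB] dB gB e0 ee e1 h_gt0 he.
have h0' := ltW h_gt0; have e0' := ltW e0; have eta_ge0 : 0 <= eta := le_trans e0' ee.
have h1 : h <= eta := le_trans he ee.
have prodB a b : 0 <= a <= eta -> `|b| <= B -> - (a * b) <= eta * B.
  move=> /andP[a0 ae] bB; apply: (@le_trans _ _ (a * `|b|)); last exact: ler_pM.
  by rewrite -mulrN ler_wpM2l// -normrN ler_norm.
have T1 : - (eta * d) <= eta * B by apply: prodB; rewrite ?eta_ge0/=.
have T2 : h * (g * d) <= eta * B ^+ 2.
  apply: (@le_trans _ _ (h * `|g * d|)); first by rewrite ler_wpM2l ?ler_norm.
  by apply: ler_pM => //; rewrite normrM expr2; apply: ler_pM.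
have e0h : 0 <= eta0 * h <= eta.
  by rewrite mulr_ge0//= (le_trans _ h1)// ler_piMl//; lra.
have T3 : - (eta0 * h * d) <= eta * B by exact: prodB.
have T4 : eta0 * r <= eta * B by apply: ler_pM.
have T5 : eta0 * eta <= eta by rewrite ler_piMl//; lra.
have T6 : - (eta0 * h * g) <= eta * B by exact: prodB.
have T7 : eta0 * (eta0 * h) <= eta.
  by case/andP: e0h => e0h1 e0h2; rewrite (le_trans _ e0h2)// ler_piMl//; lra.
(* The terms [h * r * d] and [h * g] cancel. Of the eight that remain, three are at most [eta], four
   at most [eta * B] and one at most [eta * B ^+ 2], whence the constant [3 + 4 * B + B ^+ 2]. *)
have -> : (r + eta - h * g + eta0 * h) * (1 - h * d + eta0 * h) + h * (r * d + g) =
  r + eta + h * (eta0 - eta * d + h * (g * d) - eta0 * h * d + eta0 * r + eta0 * eta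
    - eta0 * h * g + eta0 * (eta0 * h)) by ring.
have -> : r + eta * (1 + (3 + 4 * B + B ^+ 2) * h) =
  r + eta + h * (eta * (3 + 4 * B + B ^+ 2)) by ring.
by rewrite lerD2l; apply: ler_wpM2l => //; lra.
Qed.

(** The order of quantifiers matters: [C] comes before [eta0], only the step size depends on [eta0],
    and one step size serves all [eta] between [eta0] and 1, because [eta] grows along the
    iteration. *)
Lemma one_step : exists2 C, 0 <= C & forall eta0 : R, 0 < eta0 -> exists2 h1, 0 < h1 &
  forall h eta, 0 < h <= h1 -> eta0 <= eta <= 1 ->
  forall f, measurable_fun setT f -> (forall x, 0 <= f x)%E -> supported_outside X N f ->
  (\int[lam]_x (kill f (h, x) * (rX x + eta)%:E) + \int[lam]_(x in K) (f x * (h * hX x)%:E)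
   <= \int[lam]_(x in K) (f x * (rX x + eta * (1 + C * h))%:E))%E.
Proof.
have [B1 B10 HB1] := compact_norm_bound cK (fun x Kx => divergence_continuous oU cF (KU Kx)).
have [B2 B20 HB2] := compact_norm_bound cK (fun x Kx => drift_derive_continuous (KU Kx) (KV Kx)).
have [B3 B30 HB3] := compact_norm_bound cK (fun x Kx => differentiable_continuous (crho.1 _ (KV Kx))).
pose B := B1 + B2 + B3.
have B0 : 0 < B by rewrite !addr_gt0.
exists (3 + 4 * B + B ^+ 2); first by rewrite !addr_ge0 ?mulr_ge0 ?sqr_ge0// ltW.
move=> eta0 eta00.
have [h1 h10 Hrho] := density_along_flow eta00.
have [h2 h20 Htr] := transport mX oU XU cF F_flow cK KU eta00.
have B1' : 0 < B + 1 by rewrite ltr_wpDl// ltW.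
exists (Num.min (Num.min h1 h2) (Num.min eta0 (eta0 / (B + 1)))).
  by rewrite !lt_min h10 h20 eta00 divr_gt0.
move=> h eta /andP[h_gt0]; rewrite !le_min => /andP[/andP[hh1 hh2] /andP[he hB]] /andP[ee e1].
move=> f mf f0 sf.
have [|pos tr] := Htr h; first by rewrite h_gt0.
have bK x : K x -> [/\ `|divergence F x| <= B, `|drift_derive x| <= B & rho x <= B].
  move=> Kx; have := HB1 x Kx; have := HB2 x Kx; have := le_trans (ler_norm _) (HB3 x Kx).
  by rewrite /B => ? ? ?; split; lra.
(* By [density_along_flow], the value of [k] at the endpoint dominates [rho + eta] at the starting
   point; it moves the weight under [kill], where [transport] applies. *)
pose k := (fun y => rho y + eta - h * drift_derive y + eta0 * h) \_ (K `&` X1).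
have mKX1 : measurable (K `&` X1) by exact: measurableI.
have k0 y : 0 <= k y.
  rewrite /k patchE; case: ifPn => // /set_mem[Ky X1y].
  have [_ + _] := bK y Ky; rewrite ler_norml => /andP[_ gB].
  have := rho_ge0 X1y; rewrite ler_pdivlMr// in hB.
  have : h * drift_derive y <= h * (B + 1) by rewrite ler_wpM2l ?(ltW h_gt0)//; lra.
  have : 0 <= eta0 * h by rewrite mulr_ge0// ltW.
  lra.
have mk : measurable_fun setT k.
  apply/(measurable_restrictT _ mKX1).
  have md : measurable_fun K (drift_derive : _ -> measurableTypeR R).
    apply: continuous_on_measurable => // x Kx.
    exact: (drift_derive_continuous (KU Kx) (KV Kx)).
  apply: measurable_funD; last exact: measurable_cst.
  apply: measurable_funB.
    apply: measurable_funD; last exact: measurable_cst.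
    by apply: measurable_funS mrho => // x [].
  apply: measurable_funM; first exact: measurable_cst.
  by apply: measurable_funS md => // x [].
have mfk : measurable_fun setT (fun x => f x * (k x)%:E)%E.
  by apply: emeasurable_funM => //; exact/measurable_EFinP.
have fk0 x : (0 <= f x * (k x)%:E)%E by rewrite mule_ge0// lee_fin.
have step1 : (\int[lam]_x (kill f (h, x) * (rX x + eta)%:E) <=
    \int[lam]_x kill (fun y => f y * (k y)%:E) (h, x))%E.
  apply: ge0_le_integral => //.
  - move=> x _; rewrite mule_ge0 ?kill_ge0// lee_fin addr_ge0 ?rX_ge0//.
    exact: le_trans (ltW eta00) ee.
  - apply: emeasurable_funM; first exact: (measurable_kill_at mX oU XU cF F_flow).
    apply/measurable_EFinP; apply: measurable_funD; last exact: measurable_cst.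
    exact: measurable_rX.
  - exact: (measurable_kill_at mX oU XU cF F_flow).
  move=> x _; have [az|naz] := pselect (alive X s K (h, x)); last by rewrite !killN// mul0e.
  rewrite !killE//; have [[/= _ Xx] Kz] := az.
  have [X1s|nX1s] := pselect (X1 (s h x)); last by rewrite sf// !mul0e.
  apply: lee_wpmul2l => //; rewrite lee_fin.
  have h0' := ltW h_gt0.
  have X1x := backward_outside N_inv Xx h0' X1s.
  have Ks : K (s h x) by apply: Kz; rewrite h0' lexx.
  rewrite /k !patchE !mem_set//.
  have := Hrho h x _ az; rewrite h_gt0 => /(_ hh1); lra.
apply: le_trans (leeD2r _ step1) _.
rewrite (integral_kill _ _ _ _)//.
apply: le_trans (leeD2r _ (tr _ mfk fk0)) _.
have mw : measurable_fun K (fun y => (1 - h * divergence F y + eta0 * h : measurableTypeR R)).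
  apply: measurable_funD; last exact: measurable_cst.
  apply: measurable_funB; first exact: measurable_cst.
  apply: measurable_funM; first exact: measurable_cst.
  by apply: continuous_on_measurable => // x Kx; exact: (divergence_continuous oU cF (KU Kx)).
have mfK : measurable_fun K f by exact: measurable_funTS.
rewrite -ge0_integralD//; last 4 first.
- by move=> y Ky; rewrite mule_ge0// lee_fin pos.
- apply: emeasurable_funM; first exact: measurable_funTS.
  exact/measurable_EFinP.
- by move=> y Ky; rewrite mule_ge0// lee_fin mulr_ge0 ?hX_ge0// ltW.
- apply: emeasurable_funM => //; apply/measurable_EFinP.
  apply: measurable_funM; first exact: measurable_cst.
  by apply: measurable_funTS; exact: measurable_hX.
apply: ae_ge0_le_integral => //.
- move=> y Ky; rewrite adde_ge0// mule_ge0// lee_fin ?pos//.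
  by rewrite mulr_ge0 ?hX_ge0// ltW.
- apply: emeasurable_funD.
    by apply: emeasurable_funM; [exact: measurable_funTS|exact/measurable_EFinP].
  apply: emeasurable_funM => //; apply/measurable_EFinP.
  apply: measurable_funM; first exact: measurable_cst.
  by apply: measurable_funTS; exact: measurable_hX.
- move=> y Ky; rewrite mule_ge0// lee_fin addr_ge0 ?rX_ge0// mulr_ge0//.
    exact: le_trans (ltW eta00) ee.
  by rewrite !addr_ge0// mulr_ge0 ?(ltW h_gt0)// !addr_ge0 ?mulr_ge0 ?sqr_ge0// ltW.
- apply: emeasurable_funM => //; apply/measurable_EFinP.
  apply: measurable_funD; last exact: measurable_cst.
  by apply: measurable_funTS; exact: measurable_rX.
(* What remains is pointwise: [h0] is replaced by the divergence of [rho F] and [one_step_ineq]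
   concludes. Off X1 both sides vanish with [f]. *)
move: continuity_eq; apply: filterS => y ce Ky.
have [X1y|nX1y] := pselect (X1 y); last by rewrite sf// !mul0e adde0.
rewrite -muleA -ge0_muleDr ?lee_fin ?mulr_ge0 ?k0 ?pos ?hX_ge0 ?(ltW h_gt0)//.
apply: lee_wpmul2l => //; rewrite -EFinM -EFinD lee_fin.
have [dB gB rB] := bK y Ky.
rewrite /k !patchE !mem_set// -(ce X1y) divergence_scale; [|exact: KU|exact: KV].
by apply: one_step_ineq => //; rewrite rho_ge0.
Qed.

End one_step.

(** * Occupation measure *)

Section occupation.
Context (R : realType) (n : nat).
Variables (X U V N : set 'rV[R]_n) (F : 'rV[R]_n -> 'rV[R]_n) (s : R -> 'rV[R]_n -> 'rV[R]_n).
Hypotheses (mX : measurable X) (oU : open U) (XU : X `<=` U) (cF : C1_open U F).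
Hypothesis F_flow : solution_map X F s.
Hypothesis mN : measurable N.
Hypothesis N_inv : forall x, X x -> N x -> forall t, 0 <= t -> N (s t x).
Variables (rho h0 : 'rV[R]_n -> R).
Hypothesis crho : C1_open V rho.
Local Notation X1 := (X `\` N).
Hypothesis rho_ge0 : forall x, X1 x -> 0 <= rho x.
Hypothesis mrho : measurable_fun X1 rho.
Hypothesis h0_ge0 : forall x, X1 x -> 0 <= h0 x.
Hypothesis mh0 : measurable_fun X1 h0.
Local Notation lam := (lebesgue_rV R n).
Hypothesis continuity_eq :
  {ae lam, forall x, X1 x -> divergence (fun y => rho y *: F y) x = h0 x}.

Section iteration.
Variable K : set 'rV[R]_n.
Hypotheses (cK : compact K) (KU : K `<=` U) (KV : K `<=` V).
Local Notation kill := (kill X s K).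
Local Notation rX := (rho \_ X1).
Local Notation hX := (h0 \_ X1).
Local Open Scope ereal_scope.

Let clK : closed K. Proof. by apply: compact_closed => //; exact: norm_hausdorff. Qed.
Let mK : measurable K. Proof. exact: borel_measurable_closed. Qed.
Let rX0 := rX_ge0 rho_ge0.
Let hX0 := hX_ge0 h0_ge0.
Let mrX := measurable_rX mX mN mrho.
Let mhX := measurable_hX mX mN mh0.

Let mkill f t : measurable_fun setT f -> measurable_fun setT (fun x => kill f (t, x)).
Proof. exact: (measurable_kill_at mX oU XU cF F_flow). Qed.

Let mrXe (e : R) : measurable_fun setT (fun x => (rX x + e)%:E).
Proof.
apply/measurable_EFinP; apply: measurable_funD; first exact: mrX.
exact: measurable_cst.
Qed.

Let mhXh (h : R) : measurable_fun setT (fun x => (h * hX x)%:E).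
Proof.
apply/measurable_EFinP; apply: measurable_funM; last exact: mhX.
exact: measurable_cst.
Qed.

Let kill0_le f x : (forall x, 0 <= f x) -> kill f (0%R, x) <= f x.
Proof.
move=> f0; have [az|naz] := pselect (alive X s K (0%R, x)); last by rewrite killN.
by have [[/= _ Xx] _] := az; rewrite killE// (flow0 F_flow).
Qed.

(** The step is applied to [kill f] at time [k * h] with the current [eta], and the induction
    hypothesis to [f] with [eta * (1 + C * h)]; hence the statement is for all [eta] whose last
    enlargement is still at most 1. *)
Lemma iterated_step (C eta0 h : R) : (0 <= C)%R -> (0 < eta0)%R -> (0 < h)%R ->
  (forall eta, (eta0 <= eta <= 1)%R ->
   forall f, measurable_fun setT f -> (forall x, 0 <= f x) -> supported_outside X N f ->
   \int[lam]_x (kill f (h, x) * (rX x + eta)%:E) + \int[lam]_(x in K) (f x * (h * hX x)%:E)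
   <= \int[lam]_(x in K) (f x * (rX x + eta * (1 + C * h))%:E)) ->
  forall k eta f, (eta0 <= eta)%R -> (eta * (1 + C * h) ^+ k <= 1)%R ->
    measurable_fun setT f -> (forall x, 0 <= f x) -> supported_outside X N f ->
    \int[lam]_x (kill f (k%:R * h, x)%R * (rX x + eta)%:E) +
    \sum_(j < k) \int[lam]_x (kill f (j%:R * h, x)%R * (h * hX x)%:E) <=
    \int[lam]_x (f x * (rX x + eta * (1 + C * h) ^+ k)%:E).
Proof.
move=> C0 eta00 h_gt0 step k eta f; have h0' := ltW h_gt0.
have Ch0 : (0 <= C * h)%R by rewrite mulr_ge0.
elim: k eta => [|k IHk] eta ee e1 mf f0 sf.
  have eta_ge0 : (0 <= eta)%R := le_trans (ltW eta00) ee.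
  rewrite big_ord0 adde0 mul0r expr0 mulr1; apply: ge0_le_integral => //.
  - by move=> x _; rewrite mule_ge0 ?kill_ge0// lee_fin addr_ge0.
  - by apply: emeasurable_funM => //; exact: mkill.
  - exact: emeasurable_funM.
  - by move=> x _; apply: lee_wpmul2r; [rewrite lee_fin addr_ge0|exact: kill0_le].
have eta_ge0 : (0 <= eta)%R := le_trans (ltW eta00) ee.
have pk : (1 <= (1 + C * h) ^+ k)%R by rewrite exprn_ege1// lerDl.
have e1' : (eta * (1 + C * h) * (1 + C * h) ^+ k <= 1)%R by rewrite -mulrA -exprS.
have p0 : (0 <= eta * (1 + C * h))%R by rewrite mulr_ge0// addr_ge0.
have ee' : (eta0 <= eta * (1 + C * h))%R.
  by apply: le_trans ee _; rewrite ler_peMr// lerDl.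
have eta_le1 : (eta <= 1)%R.
  apply: le_trans e1'; apply: (@le_trans _ _ (eta * (1 + C * h))%R).
    by rewrite ler_peMr// lerDl.
  by rewrite ler_peMr.
pose g x := kill f (k%:R * h, x)%R.
have mg : measurable_fun setT g by exact: mkill.
have g0 x : 0 <= g x by exact: kill_ge0.
have sg : supported_outside X N g by exact: (kill_supported N_inv).
have := step eta _ g mg g0 sg; rewrite ee eta_le1 => /(_ isT).
(* Outside [K] a trajectory is killed at time 0, so the integral over [K] is already the full
   one. *)
have -> : \int[lam]_(x in K) (g x * (h * hX x)%:E) = \int[lam]_x (g x * (h * hX x)%:E).
  rewrite integral_mkcond; apply: eq_integral => x _; rewrite patchE.
  by case: ifPn => // /negP nK; rewrite /g (kill_notin F_flow) ?mul0e// => Kx; apply/nK/mem_set.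
have kh0 : (0 <= k%:R * h)%R by rewrite mulr_ge0.
under [X in X + _ <= _ -> _]eq_integral => x _.
  rewrite /g (killD oU XU cF F_flow _ _ _ h0' kh0).
  have -> : (h + k%:R * h = k.+1%:R * h)%R by rewrite -natr1 mulrDl mul1r addrC.
  over.
move=> Hstep.
have gK : \int[lam]_(x in K) (g x * (rX x + eta * (1 + C * h))%:E) <=
    \int[lam]_x (g x * (rX x + eta * (1 + C * h))%:E).
  apply: ge0_subset_integral => //; first exact: emeasurable_funM.
  by move=> x _; rewrite mule_ge0// lee_fin addr_ge0.
have := IHk _ ee' e1' mf f0 sf; rewrite -mulrA -exprS; apply: le_trans.
rewrite big_ord_recr/= [X in _ + X]addeC addeA; apply: leeD2r.
exact: le_trans Hstep gK.
Qed.

(** A Riemann sum with an arbitrary offset [v]: averaging over [v] in [[0, h[] will give the time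
    integral exactly, without continuity in time. The offset costs one more step, of length [v],
    whence the exponent [k.+1]. *)
Lemma occupation_sum (C eta0 h1 : R) : (0 <= C)%R -> (0 < eta0)%R ->
  (forall h eta, (0 < h <= h1)%R -> (eta0 <= eta <= 1)%R ->
   forall f, measurable_fun setT f -> (forall x, 0 <= f x) -> supported_outside X N f ->
   \int[lam]_x (kill f (h, x) * (rX x + eta)%:E) + \int[lam]_(x in K) (f x * (h * hX x)%:E)
   <= \int[lam]_(x in K) (f x * (rX x + eta * (1 + C * h))%:E)) ->
  forall k h v f, (0 < h <= h1)%R -> (0 <= v <= h)%R -> (eta0 * (1 + C * h) ^+ k.+1 <= 1)%R ->
    measurable_fun setT f -> (forall x, 0 <= f x) -> supported_outside X N f ->
    \sum_(j < k) \int[lam]_x (kill f (j%:R * h + v, x)%R * (h * hX x)%:E) <=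
    \int[lam]_x (f x * (rX x + eta0 * (1 + C * h) ^+ k.+1)%:E).
Proof.
move=> C0 eta00 step k h v f /andP[h_gt0 hh1] /andP[v0 vh] e1 mf f0 sf.
have h0' := ltW h_gt0.
have Ch0 : (0 <= C * h)%R by rewrite mulr_ge0.
have step_h eta : (eta0 <= eta <= 1)%R -> _ := step h eta (introT andP (conj h_gt0 hh1)).
have pk : (1 <= (1 + C * h) ^+ k)%R by rewrite exprn_ege1// lerDl.
pose e := (eta0 * (1 + C * h) ^+ k)%R.
have ee : (eta0 <= e)%R by rewrite /e ler_peMr// ltW.
have e0 : (0 <= e)%R := le_trans (ltW eta00) ee.
have eS : (e * (1 + C * h) = eta0 * (1 + C * h) ^+ k.+1)%R by rewrite /e exprSr mulrA.
have el1 : (e <= 1)%R.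
  by rewrite -eS in e1; apply: le_trans e1; rewrite ler_peMr// lerDl.
pose g x := kill f (v, x).
have mg : measurable_fun setT g by exact: mkill.
have g0 x : 0 <= g x by exact: kill_ge0.
have sg : supported_outside X N g by exact: (kill_supported N_inv).
have H := iterated_step C0 eta00 h_gt0 step_h (lexx _) el1 mg g0 sg.
have -> : \sum_(j < k) \int[lam]_x (kill f (j%:R * h + v, x)%R * (h * hX x)%:E) =
    \sum_(j < k) \int[lam]_x (kill g (j%:R * h, x)%R * (h * hX x)%:E).
  apply: eq_bigr => j _; apply: eq_integral => x _.
  by rewrite /g (killD oU XU cF F_flow)// mulr_ge0.
apply: (@le_trans _ _ (\int[lam]_x (g x * (rX x + e)%:E))).
  apply: le_trans H; rewrite leeDr//; apply: integral_ge0 => x _.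
  by rewrite mule_ge0 ?kill_ge0// lee_fin addr_ge0// ltW.
(* The step hypothesis requires a positive length, so the offset 0 is treated apart. *)
rewrite -eS; move: v0; rewrite le_eqVlt => /predU1P[v0|v_gt0].
  apply: ge0_le_integral => //.
  - by move=> x _; rewrite mule_ge0// lee_fin addr_ge0.
  - exact: emeasurable_funM.
  - exact: emeasurable_funM.
  move=> x _; apply: lee_pmul => //; first by rewrite lee_fin addr_ge0.
    by rewrite /g -v0; exact: kill0_le.
  by rewrite lee_fin lerD2l ler_peMr// lerDl.
have := step v e _ _ f mf f0 sf; rewrite v_gt0 (le_trans vh hh1) ee el1 => /(_ isT isT) Hv.
apply: (@le_trans _ _ (\int[lam]_(x in K) (f x * (rX x + e * (1 + C * v))%:E))).
  apply: le_trans Hv; rewrite leeDl//; apply: integral_ge0 => x _.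
  by rewrite mule_ge0// lee_fin mulr_ge0// ltW.
apply: (@le_trans _ _ (\int[lam]_x (f x * (rX x + e * (1 + C * v))%:E))).
  apply: ge0_subset_integral => //; first exact: emeasurable_funM.
  move=> x _; rewrite mule_ge0// lee_fin addr_ge0// mulr_ge0// addr_ge0//.
  by rewrite mulr_ge0// ltW.
apply: ge0_le_integral => //.
- move=> x _; rewrite mule_ge0// lee_fin addr_ge0// mulr_ge0// addr_ge0//.
  by rewrite mulr_ge0// ltW.
- exact: emeasurable_funM.
- exact: emeasurable_funM.
move=> x _; apply: lee_wpmul2l => //; rewrite lee_fin lerD2l ler_wpM2l// lerD2l.
by rewrite ler_wpM2l.
Qed.

End iteration.

End occupation.

Section time_steps.
Context (R : realType).
Local Notation mu := (@lebesgue_measure R).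
Local Open Scope ereal_scope.

Lemma integral_steps (a : R -> \bar R) (h : R) k : measurable_fun setT a ->
  (forall t, 0 <= a t) -> (0 <= h)%R ->
  \int[mu]_(t in `[0%R, (k%:R * h)%R[) a t =
  \sum_(j < k) \int[mu]_(v in `[0%R, h[) a (j%:R * h + v)%R.
Proof.
move=> ma a0 h0; elim: k => [|k IHk].
  by rewrite big_ord0 mul0r set_itvco0 integral_set0.
have kh0 : (0 <= k%:R * h)%R by rewrite mulr_ge0.
have khS : (k%:R * h <= k.+1%:R * h)%R by rewrite ler_wpM2r// ler_nat.
rewrite big_ord_recr/= -IHk.
rewrite (@itv_bndbnd_setU _ _ (BLeft 0%R) (BLeft (k%:R * h)%R)) ?bnd_simp//.
rewrite ge0_integral_setU//; last 2 first.
- by apply: measurable_funTS.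
- apply/disj_setPS => t [] /=; rewrite !in_itv/= => /andP[_ tk] /andP[kt _].
  by move: (lt_le_trans tk kt); rewrite ltxx.
congr (_ + _).
pose b t := (a \_ `[(k%:R * h)%R, (k.+1%:R * h)%R[) t.
transitivity (\int[mu]_t b t); first by rewrite integral_mkcond.
rewrite -(@integral_addr _ (k%:R * h)%R b); last 2 first.
- have mI : measurable (`[(k%:R * h)%R, (k.+1%:R * h)%R[%classic : set (measurableTypeR R)).
    exact: measurable_itv.
  by apply/(measurable_restrictT _ mI); exact: measurable_funTS.
- by move=> t; rewrite /b patchE; case: ifP.
rewrite [RHS]integral_mkcond; apply: eq_integral => t _.
rewrite /b !patchE [in RHS]addrC; congr (if _ then _ else _).
apply/idP/idP; rewrite !inE/= !in_itv/= => /andP[t1 t2]; apply/andP; split; lra.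
Qed.

End time_steps.

Section occupation_time.
Context (R : realType) (n : nat).
Variables (X U V N : set 'rV[R]_n) (F : 'rV[R]_n -> 'rV[R]_n) (s : R -> 'rV[R]_n -> 'rV[R]_n).
Hypotheses (mX : measurable X) (oU : open U) (XU : X `<=` U) (cF : C1_open U F).
Hypothesis F_flow : solution_map X F s.
Hypothesis mN : measurable N.
Hypothesis N_inv : forall x, X x -> N x -> forall t, 0 <= t -> N (s t x).
Variables (rho h0 : 'rV[R]_n -> R).
Hypothesis crho : C1_open V rho.
Local Notation X1 := (X `\` N).
Hypothesis rho_ge0 : forall x, X1 x -> 0 <= rho x.
Hypothesis mrho : measurable_fun X1 rho.
Hypothesis h0_ge0 : forall x, X1 x -> 0 <= h0 x.
Hypothesis mh0 : measurable_fun X1 h0.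
Local Notation lam := (lebesgue_rV R n).
Hypothesis continuity_eq :
  {ae lam, forall x, X1 x -> divergence (fun y => rho y *: F y) x = h0 x}.

Section compact_part.
Variable K : set 'rV[R]_n.
Hypotheses (cK : compact K) (KU : K `<=` U) (KV : K `<=` V).
Local Notation kill := (kill X s K).
Local Notation rX := (rho \_ X1).
Local Notation hX := (h0 \_ X1).
Local Notation mu := (@lebesgue_measure R).
Local Open Scope ereal_scope.

Let clK : closed K. Proof. by apply: compact_closed => //; exact: norm_hausdorff. Qed.
Let rX0 := rX_ge0 rho_ge0.
Let hX0 := hX_ge0 h0_ge0.
Let mrX := measurable_rX mX mN mrho.
Let mhX := measurable_hX mX mN mh0.

Lemma measurable_occupation f : measurable_fun setT f -> (forall x, 0 <= f x) ->
  measurable_fun setT (fun t : measurableTypeR R =>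
    \int[lam]_x (kill f (t, x) * (hX x)%:E)).
Proof.
move=> mf f0.
pose G (z : measurableTypeR R * 'rV[R]_n) := kill f z * (hX z.2)%:E.
apply: (@measurable_fun_fubini_tonelli_F _ _ _ _ _ lam G) => [|z].
  apply: emeasurable_funM; first exact: (measurable_kill mX oU XU cF F_flow).
  by apply/measurable_EFinP; apply: (measurableT_comp mhX).
by rewrite mule_ge0 ?kill_ge0// lee_fin.
Qed.

Lemma occupation_compact f m : measurable_fun setT f -> (forall x, 0 <= f x) ->
  supported_outside X N f -> \int[lam]_x f x < +oo ->
  \int[mu]_(t in `[0%R, m.+1%:R[) \int[lam]_x (kill f (t, x) * (hX x)%:E) <=
  \int[lam]_x (f x * (rX x)%:E).
Proof.
move=> mf f0 sf foo.
have [C C0 step] := one_step mX oU XU cF F_flow mN N_inv crho rho_ge0 mrho h0_ge0 mh0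
  continuity_eq cK KU KV.
set a := fun t : R => \int[lam]_x (kill f (t, x) * (hX x)%:E).
have ma : measurable_fun setT a by exact: measurable_occupation.
have a0 t : 0 <= a t.
  by apply: integral_ge0 => x _; rewrite mule_ge0 ?kill_ge0// lee_fin.
apply/lee_addgt0Pr => e e0.
have I0 : 0 <= \int[lam]_x f x by exact: integral_ge0.
pose I := fine (\int[lam]_x f x).
have IE : \int[lam]_x f x = I%:E by rewrite /I fineK// ge0_fin_numE.
have I_ge0 : (0 <= I)%R by rewrite /I fine_ge0.
have I1 : (0 < I + 1)%R by rewrite ltr_wpDl.
pose T : R := m.+1%:R.
(* [D] bounds the total growth of [eta], as [(k + 1) * h <= T + 1]. Dividing by it in [eta0] makes
   the final [eta] at most 1 and its contribution, at most [eta] times the integral of [f], at most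
   [e]. *)
pose D := expR (C * (T + 1)); have D0 : (0 < D)%R by exact: expR_gt0.
pose eta0 := (Num.min 1 (e / (I + 1)) / D)%R.
have min0 : (0 < Num.min 1 (e / (I + 1)))%R by rewrite lt_min ltr01 divr_gt0.
have eta00 : (0 < eta0)%R by rewrite divr_gt0.
have [h1 h10 Hstep] := step _ eta00.
pose h2 := (Num.min h1 1)%R; have h20 : (0 < h2)%R by rewrite lt_min h10 ltr01.
(* The step must divide [T] exactly and not exceed [h1] or 1. *)
pose k := (Num.truncn (T / h2)).+1.
pose h := (T / k%:R)%R.
have h_gt0 : (0 < h)%R by rewrite divr_gt0.
have hh2 : (h <= h2)%R.
  by rewrite /h ler_pdivrMr// mulrC -ler_pdivrMr//; exact/ltW/truncnS_gt.
have hh1 : (h <= h1)%R by apply: le_trans hh2 _; rewrite ge_min lexx.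
have h_le1 : (h <= 1)%R by apply: le_trans hh2 _; rewrite ge_min lexx orbT.
have kh : (k%:R * h = T)%R by rewrite /h mulrC divfK// gt_eqF.
have Ch0 : (0 <= C * h)%R by rewrite mulr_ge0// ltW.
have powD : ((1 + C * h) ^+ k.+1 <= D)%R.
  apply: (@le_trans _ _ (expR (C * h) ^+ k.+1)%R).
    by apply: lerXn2r; rewrite ?nnegrE ?addr_ge0 ?expR_ge0 ?expR_ge1Dx.
  rewrite -expRM_natl /D ler_expR mulrCA; apply: ler_wpM2l => //.
  by rewrite -natr1 mulrDl mul1r kh lerD2l.
pose e1 := (eta0 * (1 + C * h) ^+ k.+1)%R.
have e1min : (e1 <= Num.min 1 (e / (I + 1)))%R.
  rewrite /e1 /eta0 mulrAC ler_pdivrMr//; apply: ler_wpM2l => //; exact: ltW.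
have e10 : (0 <= e1)%R by rewrite mulr_ge0 ?(ltW eta00)// exprn_ge0// addr_ge0.
rewrite -/T -kh integral_steps//; last exact: ltW.
have mav j : measurable_fun setT (fun v : measurableTypeR R => a (j%:R * h + v)%R).
  by apply: (measurableT_comp ma); apply: measurable_funD => //; exact: measurable_cst.
rewrite -ge0_integral_sum//; last 2 first.
- by move=> j; exact: (measurable_funTS (mav j)).
- by move=> j v _; exact: a0.
set BD := \int[lam]_x (f x * (rX x)%:E) + e%:E.
have BD0 : 0 <= BD.
  rewrite adde_ge0// ?lee_fin ?(ltW e0)//; apply: integral_ge0 => x _.
  by rewrite mule_ge0// lee_fin.
(* For each offset the sum is at most [BD / h]; integrating over an interval of length [h] returns
   [BD]. *)
apply: (@le_trans _ _ (\int[mu]_(v in `[0%R, h[) (BD * (h^-1)%:E))); last first.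
  rewrite integral_cst//= lebesgue_measure_itv/= lte_fin h_gt0 sube0.
  by rewrite -muleA -EFinM mulVf ?mule1// gt_eqF.
apply: ge0_le_integral => //.
- by move=> v _; apply: sume_ge0 => j _; exact: a0.
- by apply: measurable_funTS; apply: emeasurable_sum => j; exact: (mav j).
- move=> v; rewrite /= in_itv/= => /andP[v0 vh].
  rewrite lee_pdivlMr//.
  apply: (@le_trans _ _ (\int[lam]_x (f x * (rX x + e1)%:E))); last first.
    have mfrX : measurable_fun setT (fun x => f x * (rX x)%:E).
      by apply: emeasurable_funM => //; exact/measurable_EFinP.
    have -> : \int[lam]_x (f x * (rX x + e1)%:E) =
        \int[lam]_x (f x * (rX x)%:E) + e1%:E * \int[lam]_x f x.
      rewrite -ge0_integralZl ?lee_fin// -ge0_integralD//.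
      - by apply: eq_integral => x _; rewrite EFinD ge0_muleDr ?lee_fin// [e1%:E * _]muleC.
      - by move=> x _; rewrite mule_ge0// lee_fin.
      - by move=> x _; rewrite mule_ge0// lee_fin.
      - by apply: emeasurable_funM => //; exact: measurable_cst.
    apply: leeD => //; rewrite IE -EFinM lee_fin.
    move: e1min; rewrite le_min ler_pdivlMr// => /andP[_]; apply: le_trans.
    by rewrite ler_wpM2l// lerDl.
  have := occupation_sum mX oU XU cF F_flow mN N_inv rho_ge0 mrho h0_ge0 cK C0 eta00
    Hstep (k := k) (h := h) (v := v).
  move=> /(_ f); rewrite h_gt0 hh1 v0 (ltW vh) => /(_ isT isT).
  move: e1min; rewrite le_min => /andP[-> _] => /(_ isT mf f0 sf); apply: le_trans.
  rewrite le_eqVlt; apply/orP; left; apply/eqP.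
  rewrite muleC ge0_sume_distrr; last by move=> j _; exact: a0.
  apply: eq_bigr => j _.
  rewrite /a -ge0_integralZl//.
  + by apply: eq_integral => x _; rewrite EFinM muleCA.
  + apply: emeasurable_funM; last exact/measurable_EFinP.
    exact: (measurable_kill_at mX oU XU cF F_flow).
  + by move=> x _; rewrite mule_ge0 ?kill_ge0// lee_fin.
  + by rewrite lee_fin ltW.
Qed.

End compact_part.

End occupation_time.

Section exhaustion.
Context (R : realType) (n : nat).

Definition compact_inner (W : set 'rV[R]_n) (m : nat) : set 'rV[R]_n :=
  inner_set W m.+1%:R^-1 `&` [set x | `|x| <= m.+1%:R].

Lemma compact_inner_compact W m : compact (compact_inner W m).
Proof.
apply: bounded_closed_compact.
  exists m.+1%:R; split; first exact: num_real.
  by move=> r mr x [_ /= xm]; apply: le_trans xm (ltW mr).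
apply: closedI; first exact: closed_inner_set.
suff : closed ((fun x : 'rV[R]_n => `|x|) @^-1` [set r | r <= m.+1%:R]) by [].
by apply: preimage_closed; [move=> x _; exact: norm_continuous|exact: closed_le].
Qed.

Lemma compact_inner_sub W m : compact_inner W m `<=` W.
Proof. by move=> x [+ _]; apply: inner_set_sub; rewrite invr_gt0. Qed.

Lemma compact_inner_le W i j : (i <= j)%N -> compact_inner W i `<=` compact_inner W j.
Proof.
move=> ij x [Wx /= xi]; split; last by apply: le_trans xi _; rewrite ler_nat.
by apply: inner_set_le Wx; rewrite lef_pV2 ?posrE// ler_nat.
Qed.

Lemma compact_in_inner W K : open W -> compact K -> K `<=` W ->
  exists m, K `<=` compact_inner W m.
Proof.
move=> oW cK KW.
have [r r0 H] : exists2 r : R, 0 < r & forall z, K z -> inner_set W r z.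
  apply: (compact_uniform cK) => [r r' z /andP[_ r'r]|c Kc]; first exact: inner_set_le.
  have [r r0 rW] := open_ball_sub oW (KW _ Kc).
  exists (r / 2); first by rewrite divr_gt0.
  move=> z; rewrite -ball_normE/= => cz y; apply: contra_notP => /negP; rewrite -ltNge => zy.
  apply: rW; rewrite -ball_normE/= -[X in `|X|](subrKA z).
  by apply: le_lt_trans (ler_normD _ _) _; lra.
have [M [_ HM]] := compact_bounded cK.
pose a := Num.max r^-1 (M + 1); pose m := Num.truncn a.
have am : a < m.+1%:R by exact: truncnS_gt.
exists m => z Kz; split.
  apply: inner_set_le (H z Kz); rewrite -[leRHS]invrK lef_pV2 ?posrE ?invr_gt0//.
  by apply: ltW; apply: le_lt_trans am; rewrite le_max lexx.
apply: (HM m.+1%:R) => //; apply: lt_trans am.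
by rewrite lt_max ltrDl ltr01 orbT.
Qed.

End exhaustion.

Section total_occupation.
Context (R : realType) (n : nat).
Variables (X U V N : set 'rV[R]_n) (F : 'rV[R]_n -> 'rV[R]_n) (s : R -> 'rV[R]_n -> 'rV[R]_n).
Hypotheses (mX : measurable X) (oU : open U) (XU : X `<=` U) (cF : C1_open U F).
Hypothesis F_flow : solution_map X F s.
Hypothesis mN : measurable N.
Hypothesis N_inv : forall x, X x -> N x -> forall t, 0 <= t -> N (s t x).
Variables (rho h0 : 'rV[R]_n -> R).
Hypotheses (oV : open V) (crho : C1_open V rho).
Hypothesis X1V : X `\` N `<=` V.
Local Notation X1 := (X `\` N).
Hypothesis rho_ge0 : forall x, X1 x -> 0 <= rho x.
Hypothesis mrho : measurable_fun X1 rho.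
Hypothesis h0_ge0 : forall x, X1 x -> 0 <= h0 x.
Hypothesis mh0 : measurable_fun X1 h0.
Local Notation lam := (lebesgue_rV R n).
Hypothesis continuity_eq :
  {ae lam, forall x, X1 x -> divergence (fun y => rho y *: F y) x = h0 x}.

Local Notation mu := (@lebesgue_measure R).
Local Open Scope ereal_scope.

(** Monotone convergence on the product of time and space, along an exhaustion of the common domain
    [W] of [F] and [rho] by compact sets and of the half-line by bounded intervals. *)
Lemma occupation f : measurable_fun setT f -> (forall x, 0 <= f x) ->
  supported_outside X N f ->
  (forall K, compact K -> \int[lam]_(x in K) f x < +oo) ->
  \int[mu]_t \int[lam]_x (kill X s setT f (t, x) * ((h0 \_ X1) x)%:E) <=
  \int[lam]_x (f x * ((rho \_ X1) x)%:E).
Proof.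
move=> mf f0 sf ffin.
have rX0 := rX_ge0 rho_ge0; have hX0 := hX_ge0 h0_ge0.
have mrX := measurable_rX mX mN mrho; have mhX := measurable_hX mX mN mh0.
pose W := U `&` V; have oW : open W by exact: openI.
pose K m := compact_inner W m.
have cK m : compact (K m) by exact: compact_inner_compact.
have clK m : closed (K m) by apply: compact_closed => //; exact: norm_hausdorff.
have mK m : measurable (K m) by exact: borel_measurable_closed.
have KU m : K m `<=` U by move=> x /compact_inner_sub[].
have KV m : K m `<=` V by move=> x /compact_inner_sub[].
pose I m : set (measurableTypeR R) := `[0%R, m.+1%:R[%classic.
have mI m : measurable (I m) by exact: measurable_itv.
have mIT m : measurable (I m `*` (setT : set 'rV[R]_n)) by exact: measurableX.
pose G (z : measurableTypeR R * 'rV[R]_n) := kill X s setT f z * ((h0 \_ X1) z.2)%:E.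
pose Gm m (z : measurableTypeR R * 'rV[R]_n) :=
  ((fun z => kill X s (K m) f z * ((h0 \_ X1) z.2)%:E) \_ (I m `*` setT)) z.
have mkill L : closed L ->
    measurable_fun setT (fun z => kill X s L f z * ((h0 \_ X1) z.2)%:E).
  move=> cL; apply: emeasurable_funM; first exact: (measurable_kill mX oU XU cF F_flow).
  by apply/measurable_EFinP; apply: (measurableT_comp mhX).
have mG : measurable_fun setT G by exact: mkill.
have mGm m : measurable_fun setT (Gm m).
  by apply/(measurable_restrictT _ (mIT m)); apply: measurable_funTS; exact: mkill.
have G0 z : 0 <= G z by rewrite mule_ge0 ?kill_ge0// lee_fin.
have Gm0 m z : 0 <= Gm m z.
  by rewrite /Gm patchE; case: ifP => // _; rewrite mule_ge0 ?kill_ge0// lee_fin.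
have kill_mono i j z : (i <= j)%N -> kill X s (K i) f z <= kill X s (K j) f z.
  move=> ij; case: z => t x; have [az|naz] := pselect (alive X s (K i) (t, x)); last first.
    by rewrite killN// kill_ge0.
  rewrite !killE//; case: az => tx Ki; split => // u ut.
  exact: compact_inner_le ij _ (Ki u ut).
have ndG z : nondecreasing_seq (Gm ^~ z).
  move=> i j ij; rewrite /Gm !patchE; case: ifPn => [/set_mem[Iz _]|_].
    have Ijz : (I j `*` setT) z.
      split => //; move: Iz; rewrite /I /= !in_itv/= => /andP[-> /=] /lt_le_trans; apply.
      by rewrite ler_nat.
    rewrite (mem_set Ijz); apply: lee_pmul => //; [exact: kill_ge0|rewrite lee_fin; exact: hX0|exact: kill_mono].
  by case: ifP => // _; apply: mule_ge0; [exact: kill_ge0|rewrite lee_fin; exact: hX0].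
(* The sequence is eventually constant. If the position at time [t] is not in X1, both sides vanish
   with [f]; if it is, the whole past lies in X1, hence is a compact curve in [W] and is contained
   in some [K m]. *)
have limG z : Gm ^~ z @ \oo --> G z.
  apply: cvg_near_cst; case: z => t x.
  have [tz|ntz] := pselect (timed X (t, x)); last first.
    near=> m; rewrite /Gm /G patchE.
    by rewrite !killN ?mul0e ?if_same// => -[].
  have [/= t0 Xx] := tz.
  have [X1s|nX1s] := pselect (X1 (s t x)); last first.
    have Gz : G (t, x) = 0.
      by rewrite /G killE ?sf ?mul0e//; split.
    near=> m; rewrite Gz /Gm patchE; case: ifP => // _.
    have [az|naz] := pselect (alive X s (K m) (t, x)).
      by rewrite killE// sf// mul0e.
    by rewrite killN// mul0e.
  have traj := flow_trajectory F_flow Xx.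
  have cG : compact ((s^~ x) @` `[0%R, t]).
    apply: continuous_compact; last exact: segment_compact.
    exact: (trajectory_within traj (lexx _)).
  have GW : (s^~ x) @` `[0%R, t] `<=` W.
    move=> _ [u /= + <-]; rewrite in_itv/= => /andP[u0 ut].
    split; first by apply: XU; exact: (flow_in F_flow).
    have tu0 : (0 <= t - u)%R by rewrite subr_ge0.
    apply: X1V; apply: (backward_outside N_inv (flow_in F_flow Xx u0) tu0).
    by rewrite -(flowD oU XU cF F_flow Xx u0 tu0) subrK.
  have [M HM] := compact_in_inner oW cG GW.
  near=> m; rewrite /Gm /G patchE mem_set; last first.
    split => //=; rewrite /I /= in_itv/= t0/=.
    apply: lt_le_trans (truncnS_gt t) _; rewrite ler_nat ltnS.
    by near: m; exact: nbhs_infty_ge.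
  rewrite !killE//; split => // u /= ut.
  have Mm : (M <= m)%N by near: m; exact: nbhs_infty_ge.
  by apply: (compact_inner_le Mm); apply: HM; exists u => //=; rewrite in_itv.
have -> : \int[mu]_t \int[lam]_x (kill X s setT f (t, x) * ((h0 \_ X1) x)%:E) =
    \int[(mu \x lam)%E]_z G z by rewrite (@fubini_tonelli1 _ _ _ _ _ mu lam G mG G0).
have := @cvg_monotone_convergence _ _ _ (mu \x lam)%E setT measurableT Gm mGm
  (fun m z _ => Gm0 m z) (fun z _ => ndG z).
have -> : \int[(mu \x lam)%E]_z limn (Gm ^~ z) = \int[(mu \x lam)%E]_z G z.
  by apply: eq_integral => z _; exact: (cvg_lim _ (limG z)).
move=> cvgG; rewrite -(cvg_lim _ cvgG)//; apply: lime_le; first by apply/cvg_ex; eexists; exact: cvgG.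
apply: nearW => m; rewrite (@fubini_tonelli1 _ _ _ _ _ mu lam (Gm m) (mGm m) (Gm0 m)).
(* [occupation_compact] wants an integrable function. Cutting [f] to [K m] changes nothing on the
   left, since a surviving trajectory is in [K m] at its final time. *)
pose fm x := (f \_ (K m)) x.
have mfm : measurable_fun setT fm.
  by apply/(measurable_restrictT _ (mK m)); exact: measurable_funTS.
have fm0 x : 0 <= fm x by rewrite /fm patchE; case: ifP.
have sfm : supported_outside X N fm by move=> x nx; rewrite /fm patchE sf// if_same.
have fmoo : \int[lam]_x fm x < +oo by rewrite /fm -integral_mkcond; exact: ffin.
have := occupation_compact mX oU XU cF F_flow mN N_inv crho rho_ge0 mrho h0_ge0 mh0
  continuity_eq (cK m) (KU m) (KV m) m mfm fm0 sfm fmoo.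
have -> : \int[mu]_t fubini_F lam (Gm m) t =
    \int[mu]_(t in I m) \int[lam]_x (kill X s (K m) fm (t, x) * ((h0 \_ X1) x)%:E).
  rewrite [RHS]integral_mkcond; apply: eq_integral => t _; rewrite /fubini_F patchE.
  case: ifPn => [/set_mem It|nIt].
    apply: eq_integral => x _; rewrite /Gm patchE mem_set//=; congr (_ * _).
    have [az|naz] := pselect (alive X s (K m) (t, x)); last by rewrite !killN.
    rewrite !killE// /fm patchE mem_set//; case: az => [[/= t0 _]]; apply.
    by rewrite t0 lexx.
  apply: integral0_eq => x _; rewrite /Gm patchE memNset// => -[/= It _].
  by move: nIt; rewrite mem_set.
move=> /le_trans; apply; apply: ge0_le_integral => //.
- by move=> x _; rewrite mule_ge0// lee_fin.
- by apply: emeasurable_funM => //; exact/measurable_EFinP.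
- by apply: emeasurable_funM => //; exact/measurable_EFinP.
- move=> x _; apply: lee_wpmul2r; first by rewrite lee_fin.
  by rewrite /fm patchE; case: ifP.
Unshelve. all: by end_near. Qed.

End total_occupation.

Section integral_monotone.
Context d (T : measurableType d) (R : realType) (m : {measure set T -> \bar R}).
Local Open Scope ereal_scope.

(** The integral of a nonnegative function is a supremum over simple functions below it, so it is
    monotone as it stands. This spares proving that the collision integrand is measurable in
    time. *)
Lemma ge0_le_integral_nonmeasurable (D : set T) (f g : T -> \bar R) :
  (forall x, D x -> 0 <= f x) -> (forall x, D x -> f x <= g x) ->
  \int[m]_(x in D) f x <= \int[m]_(x in D) g x.
Proof.
move=> f0 fg; have g0 x : D x -> 0 <= g x by move=> Dx; exact: le_trans (f0 x Dx) (fg x Dx).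
rewrite !ge0_integralE//; apply: ereal_sup_le => _ [h hf <-]; exists h => // x.
apply: le_trans (hf x) _; rewrite !patchE; case: ifPn => // /set_mem; exact: fg.
Qed.

End integral_monotone.

(** * Pull-back of null sets by the flow *)

Section null_preimage.
Context (R : realType) (n : nat).
Variables (X U : set 'rV[R]_n) (F : 'rV[R]_n -> 'rV[R]_n) (s : R -> 'rV[R]_n -> 'rV[R]_n).
Hypotheses (mX : measurable X) (oU : open U) (XU : X `<=` U) (cF : C1_open U F).
Hypothesis F_flow : solution_map X F s.
Local Notation lam := (lebesgue_rV R n).
Local Open Scope ereal_scope.

Let null_preimage_compact K f t : compact K -> K `<=` U -> (0 <= t)%R ->
  measurable_fun setT f -> (forall x, 0 <= f x) -> \int[lam]_x f x = 0 ->
  \int[lam]_x kill X s K f (t, x) = 0.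
Proof.
move=> cK KU t0 mf f0 If.
have clK : closed K by apply: compact_closed => //; exact: norm_hausdorff.
have mK : measurable K by exact: borel_measurable_closed.
have [h1 h10 Htr] := transport mX oU XU cF F_flow cK KU ltr01.
(* By [transport] one step multiplies the integral by at most [1 + h * B + h], so zero stays zero;
   [k] equal steps then reach time [t]. *)
have step h g : (0 < h <= h1)%R -> measurable_fun setT g -> (forall x, 0 <= g x) ->
    \int[lam]_x g x = 0 -> \int[lam]_x kill X s K g (h, x) = 0.
  move=> hh mg g0 Ig; have [pos H] := Htr h hh.
  apply/eqP; rewrite eq_le integral_ge0 ?andbT => [|x _]; last exact: kill_ge0.
  rewrite (integral_kill _ _ _ _)//; apply: le_trans (H g mg g0) _.
  have [B B0 HB] := compact_norm_bound cK (fun x Kx => divergence_continuous oU cF (KU _ Kx)).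
  have c0 : (0 <= 1 + h * B + h)%R.
    by case/andP: hh => /ltW h0 _; rewrite !addr_ge0// mulr_ge0// ltW.
  apply: (@le_trans _ _ (\int[lam]_(x in K) ((1 + h * B + h)%:E * g x))).
    apply: ge0_le_integral_nonmeasurable => x Kx; first by rewrite mule_ge0// lee_fin pos.
    rewrite muleC; apply: lee_wpmul2r => //; rewrite lee_fin mul1r lerD2r lerD2l.
    case/andP: hh => /ltW h0 _; rewrite -mulrN; apply: ler_wpM2l => //.
    by apply: le_trans (HB x Kx); rewrite -normrN ler_norm.
  rewrite ge0_integralZl ?lee_fin//; last exact: measurable_funTS.
  apply: (@le_trans _ _ ((1 + h * B + h)%:E * \int[lam]_x g x)); last by rewrite Ig mule0.
  by apply: lee_wpmul2l; rewrite ?lee_fin//; exact: ge0_subset_integral.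
move: t0; rewrite le_eqVlt => /predU1P[<-|t0].
  apply/eqP; rewrite eq_le integral_ge0 ?andbT => [|x _]; last exact: kill_ge0.
  rewrite -If; apply: ge0_le_integral_nonmeasurable => x _; first exact: kill_ge0.
  have [az|naz] := pselect (alive X s K (0%R, x)); last by rewrite killN.
  by have [[/= _ Xx] _] := az; rewrite killE// (flow0 F_flow).
pose k := (Num.truncn (t / h1)).+1.
pose h := (t / k%:R)%R; have h_gt0 : (0 < h)%R by rewrite divr_gt0.
have hh1 : (h <= h1)%R.
  by rewrite /h ler_pdivrMr// mulrC -ler_pdivrMr//; exact/ltW/truncnS_gt.
have iter j : \int[lam]_x kill X s K f (j.+1%:R * h, x)%R = 0.
  elim: j => [|j IHj]; first by rewrite mul1r; apply: step => //; rewrite h_gt0.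
  have jh : (0 <= j.+1%:R * h)%R by rewrite mulr_ge0// ltW.
  have -> : (j.+2%:R * h = h + j.+1%:R * h)%R by rewrite -[in LHS]natr1 mulrDl mul1r addrC.
  under eq_integral => x _ do rewrite -(killD oU XU cF F_flow _ _ _ (ltW h_gt0) jh).
  apply: step => //; first by rewrite h_gt0.
    exact: (measurable_kill_at mX oU XU cF F_flow).
  by move=> x; exact: kill_ge0.
by have := iter k.-1; rewrite /h mulrC divfK// gt_eqF.
Qed.

(** Trajectories cannot be compressed onto a null set in finite time. For [f] null on a part of
    space, this makes visits to that part negligible at each time; the compact case passes to the
    limit as in [occupation]. *)
Lemma null_preimage f t : (0 <= t)%R ->
  measurable_fun setT f -> (forall x, 0 <= f x) -> \int[lam]_x f x = 0 ->
  \int[lam]_x kill X s setT f (t, x) = 0.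
Proof.
move=> t0 mf f0 If.
pose K m := compact_inner U m.
have cK m : compact (K m) by exact: compact_inner_compact.
have clK m : closed (K m) by apply: compact_closed => //; exact: norm_hausdorff.
have KU m : K m `<=` U by exact: compact_inner_sub.
pose g m x := kill X s (K m) f (t, x).
have mg m : measurable_fun setT (g m) by exact: (measurable_kill_at mX oU XU cF F_flow).
have g0 m x : 0 <= g m x by exact: kill_ge0.
have ndg x : nondecreasing_seq (g ^~ x).
  move=> i j ij; rewrite /g; have [az|naz] := pselect (alive X s (K i) (t, x)); last first.
    by rewrite killN// kill_ge0.
  rewrite !killE//; case: az => tx Ki; split => // u ut.
  exact: compact_inner_le ij _ (Ki u ut).
have limg x : g ^~ x @ \oo --> kill X s setT f (t, x).
  apply: cvg_near_cst; have [Xx|nXx] := pselect (X x); last first.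
    by near=> m; rewrite /g !killN// => -[[]].
  have traj := flow_trajectory F_flow Xx.
  have cG : compact ((s^~ x) @` `[0%R, t]).
    apply: continuous_compact; last exact: segment_compact.
    exact: (trajectory_within traj (lexx _)).
  have GU : (s^~ x) @` `[0%R, t] `<=` U.
    move=> _ [u /= + <-]; rewrite in_itv/= => /andP[u0 ut].
    by apply: XU; exact: (flow_in F_flow).
  have [M HM] := compact_in_inner oU cG GU.
  near=> m; rewrite /g !killE//; split => // u /= ut.
  have Mm : (M <= m)%N by near: m; exact: nbhs_infty_ge.
  by apply: (compact_inner_le Mm); apply: HM; exists u => //=; rewrite in_itv.
have -> : \int[lam]_x kill X s setT f (t, x) = \int[lam]_x limn (g ^~ x).
  by apply: eq_integral => x _; exact/esym/(cvg_lim _ (limg x)).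
rewrite monotone_convergence//.
rewrite (_ : (fun m => _) = cst 0) ?lim_cst//.
by apply/funext => m; exact: null_preimage_compact.
Unshelve. all: by end_near. Qed.

End null_preimage.

(** * Safety and convergence *)

Section convexity.
Context (R : realType) (n : nat).
Local Notation lam := (lebesgue_rV R n).

Lemma C1_onP (V : normedModType R) (Y : set 'rV[R]_n) (f : 'rV[R]_n -> V) :
  C1_on Y f <-> exists W, [/\ open W, Y `<=` W & C1_open W f].
Proof. by split=> -[W] => [[oW YW df cf]|[oW YW [df cf]]]; exists W; split. Qed.

Lemma C1_open_subset (V : normedModType R) W W' (f : 'rV[R]_n -> V) :
  W' `<=` W -> C1_open W f -> C1_open W' f.
Proof. by move=> W'W [df cf]; split => [x /W'W|v x /W'W]; [exact: df|exact: cf]. Qed.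

Lemma derive_comb (f g : 'rV[R]_n -> R) (a b : R) v x :
  differentiable f x -> differentiable g x ->
  'D_v (fun y => a * f y + b * g y) x = a * 'D_v f x + b * 'D_v g x.
Proof.
move=> df dg.
rewrite (_ : (fun y => _) = a *: f + b *: g); last by apply/funext.
rewrite deriveD; [|exact: diff_derivable (differentiableZ _ _)..].
by rewrite !deriveZ//; exact: diff_derivable.
Qed.

Lemma C1_open_comb W (f g : 'rV[R]_n -> R) (a : R) : open W -> 0 <= a <= 1 ->
  C1_open W f -> C1_open W g -> C1_open W (fun y => a * f y + (1 - a) * g y).
Proof.
move=> oW /andP[a0 a1] [df cf] [dg cg]; split => [x Wx|v x Wx].
  rewrite (_ : (fun y => _) = a *: f + (1 - a) *: g); last by apply/funext.
  by apply: differentiableD; apply: differentiableZ; [exact: df|exact: dg].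
apply/continuous_distP => e e0.
have [r1 r10 H1] := (continuous_distP _ _).1 (cf v x Wx) _ e0.
have [r2 r20 H2] := (continuous_distP _ _).1 (cg v x Wx) _ e0.
have [r3 r30 H3] := open_ball_sub oW Wx.
exists (Num.min r3 (Num.min r1 r2)); first by rewrite !lt_min r10 r20 r30.
move=> y; rewrite !lt_min => /and3P[xy3 /H1 xy1 /H2 xy2].
have Wy : W y by apply: H3; rewrite -ball_normE.
rewrite !derive_comb; [|exact: df|exact: dg|exact: df|exact: dg].
set A := 'D_v f x in xy1 *; set A' := 'D_v f y in xy1 *.
set B := 'D_v g x in xy2 *; set B' := 'D_v g y in xy2 *.
have -> : a * A + (1 - a) * B - (a * A' + (1 - a) * B') =
  a * (A - A') + (1 - a) * (B - B') by ring.
apply: le_lt_trans (ler_normD _ _) _.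
rewrite !normrM (ger0_norm a0) (@ger0_norm _ (1 - a)) ?subr_ge0//.
have [a_eq0|a_neq0] := eqVneq a 0.
  by rewrite a_eq0 mul0r add0r subr0 mul1r.
have -> : e = a * e + (1 - a) * e by ring.
apply: ltr_leD; first by rewrite ltr_pM2l// lt_neqAle eq_sym a_neq0.
by rewrite ler_wpM2l ?subr_ge0// ltW.
Qed.

(** On the common open domain of the two densities the product rule makes the divergence linear in
    [rho]; both equations have the same right-hand side, so their convex combination keeps it. *)
Lemma navigation_density_convex (X1 : set 'rV[R]_n) (F : 'rV[R]_n -> 'rV[R]_n)
    (h p : 'rV[R]_n -> R) (gamma : R) (rho1 rho2 : 'rV[R]_n -> R) (a : R) :
  measurable X1 -> C1_on X1 F -> measurable_fun X1 p -> (forall x, X1 x -> 0 <= p x) ->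
  0 <= a <= 1 ->
  navigation_density X1 F h p gamma rho1 -> navigation_density X1 F h p gamma rho2 ->
  navigation_density X1 F h p gamma (fun x => a * rho1 x + (1 - a) * rho2 x).
Proof.
move=> mX1 /C1_onP[U [oU X1U cF]] mp p0 a01 [i1 [/C1_onP[V1 [oV1 X1V1 c1]] pos1] ce1 g1]
  [i2 [/C1_onP[V2 [oV2 X1V2 c2]] pos2] ce2 g2].
have /andP[a0 a1] := a01; have b0 : 0 <= 1 - a by rewrite subr_ge0.
pose V := V1 `&` V2; have oV : open V by exact: openI.
have c1V : C1_open V rho1 by apply: C1_open_subset c1 => x [].
have c2V : C1_open V rho2 by apply: C1_open_subset c2 => x [].
have cV := C1_open_comb oV a01 c1V c2V.
have X1V : X1 `<=` V by move=> x Xx; split; [exact: X1V1|exact: X1V2].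
have mr1 : measurable_fun X1 rho1 by apply/measurable_EFinP; exact: measurable_int i1.
have mr2 : measurable_fun X1 rho2 by apply/measurable_EFinP; exact: measurable_int i2.
split.
- rewrite (_ : EFin \o _ = (fun x => a%:E * (rho1 x)%:E + (1 - a)%:E * (rho2 x)%:E)%E).
    by apply: integrableD => //; apply: integrableZl.
  by apply/funext => x; rewrite /= EFinD !EFinM.
- split; first by apply/C1_onP; exists V; split.
  by move=> x Xx; rewrite addr_ge0// mulr_ge0//; [exact: pos1|exact: pos2].
- move: ce1 ce2; apply: filterS2 => x e1 e2 Xx.
  have Ux := X1U _ Xx; have Vx := X1V _ Xx.
  rewrite (divergence_scale oU cF cV Ux Vx).
  have := e1 Xx; rewrite (divergence_scale oU cF c1V Ux Vx) => E1.
  have := e2 Xx; rewrite (divergence_scale oU cF c2V Ux Vx) => E2.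
  have -> : drift_derive F (fun y => a * rho1 y + (1 - a) * rho2 y) x =
      a * drift_derive F rho1 x + (1 - a) * drift_derive F rho2 x.
    rewrite /drift_derive !mulr_sumr -big_split/=; apply: eq_bigr => j _.
    rewrite derive_comb; [ring|exact: c1V.1|exact: c2V.1].
  transitivity (a * h x + (1 - a) * h x); last by ring.
  rewrite -[in a * h x]E1 -E2; ring.
have mpr r : measurable_fun X1 r -> measurable_fun X1 (fun x => (p x * r x)%:E).
  by move=> mr; apply/measurable_EFinP; exact: measurable_funM.
have -> : (\int[lam]_(x in X1) (p x * (a * rho1 x + (1 - a) * rho2 x))%:E =
    a%:E * \int[lam]_(x in X1) (p x * rho1 x)%:E +
    (1 - a)%:E * \int[lam]_(x in X1) (p x * rho2 x)%:E)%E.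
  rewrite -!ge0_integralZl//; try by [exact: mpr|].
  - rewrite -ge0_integralD//.
    + by apply: eq_integral => x _; rewrite -!EFinM -EFinD; congr EFin; ring.
    + by move=> x Xx; rewrite -EFinM lee_fin !mulr_ge0 ?p0 ?pos1.
    + by apply: emeasurable_funM; [exact: measurable_cst|exact: mpr].
    + by move=> x Xx; rewrite -EFinM lee_fin !mulr_ge0 ?p0 ?pos2.
    + by apply: emeasurable_funM; [exact: measurable_cst|exact: mpr].
  - by move=> x Xx; rewrite lee_fin mulr_ge0 ?p0 ?pos2.
  - by move=> x Xx; rewrite lee_fin mulr_ge0 ?p0 ?pos1.
have -> : gamma%:E = (a%:E * gamma%:E + (1 - a)%:E * gamma%:E)%E.
  by rewrite -!EFinM -EFinD; congr EFin; ring.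
by apply: leeD; apply: lee_wpmul2l; rewrite ?lee_fin.
Qed.

End convexity.

Lemma compact_lebesgue_rV_finite (R : realType) n (K : set 'rV[R]_n) :
  compact K -> (lebesgue_rV R n K < +oo)%E.
Proof.
move=> cK; have [M [_ HM]] := compact_bounded cK.
pose I : set (measurableTypeR R) := `[- (M + 1), M + 1]%classic.
have mI : measurable I by exact: measurable_itv.
pose box := [set v : 'rV[R]_n | forall j, I (v ord0 j)].
have KB : K `<=` box.
  move=> v Kv j; rewrite /I /= in_itv/= -ler_norml.
  by apply: le_trans (ler_norm_coord v j) (HM _ _ v Kv); rewrite ltrDl.
have mK : measurable K.
  apply: borel_measurable_closed; apply: compact_closed => //; exact: norm_hausdorff.
have mB : measurable box.
  have -> : box = \bigcap_(j in [set: 'I_n]) ((fun v : 'rV[R]_n => v ord0 j) @^-1` I).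
    by apply/seteqP; split => v H j; [move=> _|]; exact: H.
  apply: fin_bigcap_measurable => [|j _]; first exact: finite_finset.
  by rewrite -[X in measurable X]setTI; exact: measurable_coord_rV.
apply: le_lt_trans (le_measure _ _ _ KB) _; rewrite ?inE//.
rewrite [X in (X < _)%E](lebesgue_rV_box (A := fun=> I) (fun=> mI)).
have Ioo : (lebesgue_measure I < +oo)%E.
  by rewrite compact_finite_measure//; exact: segment_compact.
suff /andP[] : (0 <= \prod_(j < n) lebesgue_measure I < +oo)%E by [].
elim/big_ind: _ => [|x y /andP[x0 xoo] /andP[y0 yoo]|j _]; first by rewrite ltry lee01.
- by rewrite mule_ge0// lte_mul_pinfty// ge0_fin_numE.
- by rewrite Ioo andbT.
Qed.

Section null_factor.
Context d (T : measurableType d) (R : realType) (m : {measure set T -> \bar R}).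
Local Open Scope ereal_scope.

Lemma ge0_integral_null_mul (f w : T -> \bar R) :
  measurable_fun setT f -> measurable_fun setT w ->
  (forall x, 0 <= f x) -> \int[m]_x f x = 0 -> \int[m]_x (f x * w x) = 0.
Proof.
move=> mf mw f0 If; have H : ae_eq m setT f (cst 0).
  apply/ae_eq_integral_abs => //; rewrite -If; apply: eq_integral => x _.
  by rewrite gee0_abs.
rewrite (ae_eq_integral (cst 0)) ?integral0//; first exact: emeasurable_funM.
by move: H; apply: filterS => x /[apply] /= ->; rewrite mul0e.
Qed.

End null_factor.

Section safety.
Context (R : realType) (n : nat).
Variables (X U V N : set 'rV[R]_n) (F : 'rV[R]_n -> 'rV[R]_n) (s : R -> 'rV[R]_n -> 'rV[R]_n).
Hypotheses (mX : measurable X) (oU : open U) (XU : X `<=` U) (cF : C1_open U F).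
Hypothesis F_flow : solution_map X F s.
Hypothesis mN : measurable N.
Hypothesis N_inv : forall x, X x -> N x -> forall t, 0 <= t -> N (s t x).
Variables (rho h0 : 'rV[R]_n -> R).
Hypotheses (oV : open V) (crho : C1_open V rho).
Hypothesis X1V : X `\` N `<=` V.
Local Notation X1 := (X `\` N).
Local Notation lam := (lebesgue_rV R n).
Local Notation mu := (@lebesgue_measure R).
Hypothesis rho_ge0 : forall x, X1 x -> 0 <= rho x.
Hypothesis irho : lam.-integrable X1 (EFin \o rho).
Hypothesis continuity_eq :
  {ae lam, forall x, X1 x -> divergence (fun y => rho y *: F y) x = h0 x}.
Variable mu0 : probability 'rV[R]_n R.
Hypothesis mu0_h0 : has_density mu0 X h0.
Local Open Scope ereal_scope.

Let mX1 : measurable X1. Proof. exact: measurableD. Qed.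

Let mrho : measurable_fun X1 rho.
Proof. by apply/measurable_EFinP; exact: measurable_int irho. Qed.

Let X1X : X1 `<=` X. Proof. by move=> x []. Qed.

Let h0_ge0 x : X1 x -> (0 <= h0 x)%R.
Proof. by case: mu0_h0 => -[_ + _] _ => + [Xx _]; exact. Qed.

Let mh0X : measurable_fun X h0. Proof. by case: mu0_h0 => -[]. Qed.

Let mh0 : measurable_fun X1 h0.
Proof. exact: measurable_funS mh0X. Qed.

(** The occupation bound for the indicator of X1 is finite because [rho] is integrable, so by
    Tonelli the weighted time spent in X1 is finite for almost every starting point. *)
Lemma finite_escape : {ae lam, forall x, X1 x -> (0 < h0 x)%R ->
  exists2 t : R, (0 <= t)%R & N (s t x)}.
Proof.
pose f x : \bar R := (\1_X1 x)%:E.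
have mf : measurable_fun setT f by apply/measurable_EFinP; exact: measurable_indic.
have f0 x : 0 <= f x by rewrite lee_fin.
have sf : supported_outside X N f by move=> x nx; rewrite /f indicE memNset.
have fK K : compact K -> \int[lam]_(x in K) f x < +oo.
  move=> cK; have mK : measurable K.
    by apply: borel_measurable_closed; apply: compact_closed => //; exact: norm_hausdorff.
  rewrite integral_indic//; apply: le_lt_trans (compact_lebesgue_rV_finite cK).
  by apply: le_measure; rewrite ?inE//; exact: measurableI.
have := occupation mX oU XU cF F_flow mN N_inv oV crho X1V rho_ge0 mrho h0_ge0 mh0
  continuity_eq mf f0 sf fK.
have -> : \int[lam]_x (f x * ((rho \_ X1) x)%:E) = \int[lam]_(x in X1) (rho x)%:E.
  rewrite [RHS]integral_mkcond; apply: eq_integral => x _.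
  by rewrite /f indicE !patchE; case: ifPn; rewrite ?mul1e ?mul0e.
move=> /le_lt_trans /(_ (integrable_lty mX1 irho)).
pose G (z : measurableTypeR R * 'rV[R]_n) := kill X s setT f z * ((h0 \_ X1) z.2)%:E.
have mhX := measurable_hX mX mN mh0.
have mG : measurable_fun setT G.
  apply: emeasurable_funM; first exact: (measurable_kill mX oU XU cF F_flow).
  by apply/measurable_EFinP; apply: (measurableT_comp mhX).
have G0 z : 0 <= G z by rewrite mule_ge0 ?kill_ge0// lee_fin hX_ge0.
rewrite (@fubini_tonelli _ _ _ _ _ mu lam G mG G0) => fin.
have : lam.-integrable setT (fun x => \int[mu]_t G (t, x)).
  apply/integrableP; split; first exact: (@measurable_fun_fubini_tonelli_G _ _ _ _ _ mu G mG G0).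
  apply: le_lt_trans fin; rewrite le_eqVlt; apply/orP; left; apply/eqP.
  by apply: eq_integral => x _; rewrite gee0_abs// integral_ge0.
move=> /(integrable_ae measurableT); apply: filterS => x /(_ I) Gx X1x h0x.
apply: contrapT => /forall2NP noN.
have X1s t : (0 <= t)%R -> X1 (s t x).
  by move=> t0; split; [exact: (flow_in F_flow X1x.1)|have [|] := noN t].
move: Gx; rewrite ge0_fin_numE ?integral_ge0//; apply/negP; rewrite -leNgt.
(* A trajectory that never meets [N] contributes the positive constant [h0 x] at every time, which
   has infinite integral. *)
apply: (@le_trans _ _ (\int[mu]_(t in `[0%R, +oo[) (h0 x)%:E)).
  rewrite integral_cst//.
  by rewrite [X in _ * X](lebesgue_measure_itv `[0%R, +oo[)/= ltry addye// gt0_muley// lte_fin.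
rewrite integral_mkcond; apply: ge0_le_integral_nonmeasurable => t _.
  by rewrite patchE; case: ifP => // _; rewrite lee_fin ltW.
rewrite patchE; case: ifPn => [/set_mem|_]; last exact: G0.
rewrite /= in_itv/= andbT => t0; rewrite /G killE.
  by rewrite /f indicE mem_set ?mul1e ?patchE ?mem_set//; exact: X1s.
by split => //; split => //=; exact: X1x.1.
Qed.

Lemma mu0_integral_le g : measurable_fun setT g -> (forall x, 0 <= g x) ->
  \int[mu0]_(x in X1) g x <= \int[lam]_x (g x * ((h0 \_ X1) x)%:E).
Proof.
move=> mg g0; have [[_ h0X _] mu0E] := mu0_h0; rewrite integral_mkcond.
have mgX : measurable_fun setT (g \_ X1).
  by apply/(measurable_restrictT _ mX1); exact: measurable_funTS.
have gX0 x : 0 <= (g \_ X1) x by rewrite patchE; case: ifP.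
have mw : measurable_fun setT (fun x => ((h0 \_ X) x)%:E).
  by apply/measurable_EFinP; apply/(measurable_restrictT _ mX).
have w0 x : 0 <= ((h0 \_ X) x)%:E.
  by rewrite lee_fin patchE; case: ifPn => // /set_mem; exact: h0X.
have H A : measurable A -> mu0 A <= \int[lam]_(x in A) ((h0 \_ X) x)%:E.
  move=> mA; rewrite mu0E// setIC integral_mkcondr le_eqVlt; apply/orP; left; apply/eqP.
  by apply: eq_integral => x _; rewrite !patchE; case: ifP.
apply: le_trans (integral_le_density mw w0 H mgX gX0) _.
rewrite le_eqVlt; apply/orP; left; apply/eqP; apply: eq_integral => x _.
rewrite !patchE; case: ifPn => [/set_mem[Xx _]|_]; last by rewrite mul0e mule0.
by rewrite mem_set.
Qed.

Variable p : 'rV[R]_n -> R.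
Hypotheses (mp : measurable_fun X p) (p_ge0 : forall x, X x -> (0 <= p x)%R).
Hypothesis p_fin : \int[lam]_(x in X) (p x)%:E < +oo.

Let pX Y : 'rV[R]_n -> \bar R := EFin \o (p \_ Y).

Let mpX Y : measurable Y -> Y `<=` X -> measurable_fun setT (pX Y).
Proof.
move=> mY YX; apply/measurable_EFinP; apply/(measurable_restrictT _ mY).
exact: measurable_funS mp.
Qed.

Let pX_ge0 Y x : Y `<=` X -> 0 <= pX Y x.
Proof. by move=> YX; rewrite lee_fin patchE; case: ifPn => // /set_mem/YX/p_ge0. Qed.

Let integral_pX Y : \int[lam]_x pX Y x = \int[lam]_(x in Y) (p x)%:E.
Proof.
by rewrite [RHS]integral_mkcond; apply: eq_integral => x _; rewrite /pX/= !patchE; case: ifP.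
Qed.

Lemma occupation_unsafe :
  \int[mu]_(t in `[0%R, +oo[)
     \int[lam]_x (kill X s setT (pX X1) (t, x) * ((h0 \_ X1) x)%:E) <=
  \int[lam]_(x in X1) (p x * rho x)%:E.
Proof.
have hX0 := hX_ge0 h0_ge0; have pX10 x := pX_ge0 x X1X.
have sf : supported_outside X N (pX X1) by move=> x nx; rewrite /pX/= patchE memNset.
have fK K : compact K -> \int[lam]_(x in K) pX X1 x < +oo.
  move=> cK; apply: le_lt_trans p_fin; rewrite -integral_pX [leLHS]integral_mkcond.
  apply: ge0_le_integral_nonmeasurable => x _; first by rewrite patchE; case: ifP.
  rewrite patchE; case: ifP => _; last exact: pX_ge0.
  rewrite /pX/= !patchE; case: ifPn => [/set_mem/X1X Xx|_]; first by rewrite mem_set.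
  by case: ifPn => // /set_mem/p_ge0.
have := occupation mX oU XU cF F_flow mN N_inv oV crho X1V rho_ge0 mrho h0_ge0 mh0
  continuity_eq (mpX mX1 X1X) pX10 sf fK.
have -> : \int[lam]_x (pX X1 x * ((rho \_ X1) x)%:E) = \int[lam]_(x in X1) (p x * rho x)%:E.
  rewrite [RHS]integral_mkcond; apply: eq_integral => x _.
  by rewrite /pX/= !patchE; case: ifP; rewrite ?mul0e.
apply: le_trans; rewrite integral_mkcond; apply: ge0_le_integral_nonmeasurable => t _.
  by rewrite patchE; case: ifP => // _; apply: integral_ge0 => x _; rewrite mule_ge0 ?kill_ge0// lee_fin.
rewrite patchE; case: ifP => // _.
by apply: integral_ge0 => x _; rewrite mule_ge0 ?kill_ge0// lee_fin.
Qed.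

Let kill_pX t x Y : (0 <= t)%R -> X x -> Y (s t x) -> kill X s setT (pX Y) (t, x) = (p (s t x))%:E.
Proof. by move=> t0 Xx Ys; rewrite killE /pX/= ?patchE ?mem_set//; split. Qed.

Let mkill t Y : measurable Y -> Y `<=` X ->
  measurable_fun setT (fun x => kill X s setT (pX Y) (t, x)).
Proof. by move=> mY YX; apply: (measurable_kill_at mX oU XU cF F_flow) => //; exact: mpX. Qed.

Lemma collision_outside :
  \int[mu]_(t in `[0%R, +oo[)
     \int[mu0]_(x in X1 `&` s t @^-1` X1) (p (s t x))%:E <=
  \int[lam]_(x in X1) (p x * rho x)%:E.
Proof.
have pX10 x := pX_ge0 x X1X; apply: le_trans occupation_unsafe.
apply: ge0_le_integral_nonmeasurable => t.
  by move=> _; apply: integral_ge0 => x [_ [Xs _]]; rewrite lee_fin p_ge0.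
rewrite /= in_itv/= andbT => t0.
apply: le_trans (mu0_integral_le (mkill t mX1 X1X) (fun x => kill_ge0 X s _ (t, x) pX10)).
rewrite integral_mkcondr; apply: ge0_le_integral_nonmeasurable => x [Xx _].
  by rewrite patchE; case: ifPn => // /set_mem[Xs _]; rewrite lee_fin p_ge0.
rewrite patchE; case: ifPn => [/set_mem Xs|_]; last exact: kill_ge0.
by rewrite kill_pX.
Qed.

(** A trajectory from X1 may later run inside [N], where [rho] gives no control. There [p] vanishes
    almost everywhere, and [null_preimage] makes that part of the integral zero at each time. *)
Lemma collision_total : \int[lam]_(x in X `&` N) (p x)%:E = 0 ->
  \int[mu]_(t in `[0%R, +oo[) \int[mu0]_(x in X1) (p (s t x))%:E <=
  \int[lam]_(x in X1) (p x * rho x)%:E.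
Proof.
have XNX : X `&` N `<=` X by exact: subIsetl.
have mXN : measurable (X `&` N) by exact: measurableI.
have pX10 x := pX_ge0 x X1X; have pXN0 x := pX_ge0 x XNX; have pXX0 x := pX_ge0 x (@subset_refl _ X).
have mhX := measurable_hX mX mN mh0; have hX0 := hX_ge0 h0_ge0.
move=> pN0; apply: le_trans occupation_unsafe.
apply: ge0_le_integral_nonmeasurable => t; rewrite /= in_itv/= andbT => t0.
  by apply: integral_ge0 => x [Xx _]; rewrite lee_fin p_ge0//; exact: (flow_in F_flow).
have -> : \int[mu0]_(x in X1) (p (s t x))%:E = \int[mu0]_(x in X1) kill X s setT (pX X) (t, x).
  apply: eq_integral => x /set_mem[Xx _]; rewrite kill_pX//; exact: (flow_in F_flow).
apply: le_trans (mu0_integral_le (mkill t mX (@subset_refl _ X)) (fun x => kill_ge0 X s _ (t, x) pXX0)) _.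
have kD x : kill X s setT (pX X) (t, x) =
    kill X s setT (pX X1) (t, x) + kill X s setT (pX (X `&` N)) (t, x).
  have [az|naz] := pselect (alive X s setT (t, x)); last by rewrite !killN// adde0.
  have [[/= _ Xx] _] := az; rewrite !killE// /pX/= -EFinD; congr EFin.
  have Xs : X (s t x) by exact: (flow_in F_flow).
  rewrite !patchE mem_set//; have [Ns|nNs] := pselect (N (s t x)).
    by rewrite memNset ?mem_set ?add0r// => -[].
  by rewrite mem_set// memNset ?addr0// => -[].
under eq_integral => x _ do rewrite kD ge0_muleDl ?kill_ge0//.
have kh0 Y x : Y `<=` X -> 0 <= kill X s setT (pX Y) (t, x) * ((h0 \_ X1) x)%:E.
  by move=> YX; rewrite mule_ge0 ?kill_ge0 ?lee_fin// => y; exact: pX_ge0.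
have mkh Y : measurable Y -> Y `<=` X ->
    measurable_fun setT (fun x => kill X s setT (pX Y) (t, x) * ((h0 \_ X1) x)%:E).
  by move=> mY YX; apply: emeasurable_funM; [exact: mkill|exact/measurable_EFinP].
rewrite ge0_integralD//; [|by move=> x _; exact: kh0|exact: mkh|by move=> x _; exact: kh0|exact: mkh].
rewrite [X in _ + X](ge0_integral_null_mul _ _ _ _) ?adde0//.
- exact: mkill.
- exact/measurable_EFinP.
- by move=> x; exact: kill_ge0.
- by apply: (null_preimage mX oU XU cF F_flow t0) => //; [exact: mpX|rewrite integral_pX].
Qed.

End safety.

(** The collision integral restricts the starting point to X1 but evaluates [p] along the whole
    trajectory, while [rho] controls only the time spent in X1. Hence the two forms of the bound:
    the current point kept in X1, or [p] without mass in [N]. *)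
Theorem theorem2 (R : realType) (n : nat) (X N X0 : set 'rV[R]_n)
    (F : 'rV[R]_n -> 'rV[R]_n) (s : R -> 'rV[R]_n -> 'rV[R]_n) (delta : R)
    (mu0 : probability 'rV[R]_n R) (h0 p : 'rV[R]_n -> R) (gamma : R)
    (mX : measurable X) (mN : measurable N) (mX0 : measurable X0)
    (F_C1 : C1_on X F) (F_flow : solution_map X F s)
    (X_has0 : X 0) (F_0 : F 0 = 0)
    (delta_gt0 : 0 < delta) (N_nbhs : ball 0 delta `<=` N)
    (N_stable : locally_stable X s N)
    (X0_sub : X0 `<=` X) (mu0_h0 : has_density mu0 X h0)
    (h0_X0 : supported_on X h0 X0) (p_density : prob_density X p) :
  (forall (rho1 rho2 : 'rV[R]_n -> R) (a : R), 0 <= a <= 1 ->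
     navigation_density (X `\` N) F h0 p gamma rho1 ->
     navigation_density (X `\` N) F h0 p gamma rho2 ->
     navigation_density (X `\` N) F h0 p gamma
       (fun x => a * rho1 x + (1 - a) * rho2 x)) /\
  ((exists rho : 'rV[R]_n -> R, navigation_density (X `\` N) F h0 p gamma rho) ->
   [/\ {ae lebesgue_rV R n, forall x, X0 x ->
          s t x @[t --> +oo] --> (0 : 'rV[R]_n)},
       (\int[lebesgue_measure]_(t in `[0%R, +oo[)
          \int[mu0]_(x in (X `\` N) `&` s t @^-1` (X `\` N))
            (p (s t x))%:E <= gamma%:E)%E &
       (\int[lebesgue_rV R n]_(x in X `&` N) (p x)%:E = 0)%E ->
       (\int[lebesgue_measure]_(t in `[0%R, +oo[)
          \int[mu0]_(x in X `\` N) (p (s t x))%:E <= gamma%:E)%E]).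
Proof.
have mX1 : measurable (X `\` N) by exact: measurableD.
have X1X : X `\` N `<=` X by move=> x [].
have [mp p_ge0 p1] := p_density.
have /C1_onP[U [oU XU cF]] := F_C1.
have [_ N_inv N_cvg] := N_stable.
split=> [rho1 rho2 a a01|[rho [irho [/C1_onP[V [oV X1V crho]] rho_ge0] ceq gam]]].
  apply: navigation_density_convex => //.
  - by apply/C1_onP; exists U; split => //; exact: subset_trans XU.
  - exact: measurable_funS mp.
  - by move=> x /X1X; exact: p_ge0.
have p_fin : (\int[lebesgue_rV R n]_(x in X) (p x)%:E < +oo)%E by rewrite p1 ltry.
split.
- have := finite_escape mX oU XU cF F_flow mN N_inv oV crho X1V rho_ge0 irho ceq mu0_h0.
  move: h0_X0; rewrite /supported_on; apply: filterS2 => x supp escape X0x.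
  have Xx := X0_sub _ X0x; have [Nx|nNx] := pselect (N x); first exact: N_cvg.
  (* The support condition turns membership in [X0] into positivity of [h0]. From the entrance time
     [t] on, the trajectory is that of a point of [N], so it converges to 0. *)
  have [t t0 Nst] := escape (conj Xx nNx) ((supp Xx).1 X0x).
  have := N_cvg _ (flow_in F_flow Xx t0) Nst.
  move=> cvg_st; apply/cvgrPdist_lt => e e0.
  have /cvgrPdist_lt/(_ _ e0)[M [_ HM]] := cvg_st.
  exists (Num.max t (M + t)); split; first exact: num_real.
  move=> v; rewrite gt_max => /andP[tv Mv].
  have vt0 : 0 <= v - t by rewrite subr_ge0 ltW.
  rewrite -(subrK t v) (flowD oU XU cF F_flow Xx t0 vt0).
  by apply: HM; rewrite ltrBrDr.
- apply: le_trans gam.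
  exact: (collision_outside mX oU XU cF F_flow mN N_inv oV crho X1V rho_ge0 irho ceq mu0_h0 mp p_ge0 p_fin).
- move=> pN0; apply: le_trans gam.
  exact: (collision_total mX oU XU cF F_flow mN N_inv oV crho X1V rho_ge0 irho ceq mu0_h0 mp p_ge0 p_fin).
Qed.
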